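(* Let $G$ be a finite simple group (abelian or non-abelian) such that $\kappa(G)=\kappa(A_6)$, where $A_6$ is the alternating group of degree $6$. Then $G\cong A_6$ ($\cong L_2(9)$). In other words, $A_6\cong L_2(9)$ is the unique finite simple group, up to isomorphism, whose power graph has exactly $\kappa(A_6)$ spanning trees.
   Context: For a finite group $G$, the power graph $\mathcal{P}(G)$ is the simple undirected graph whose vertices are the elements of $G$, two distinct vertices $x,y$ being adjacent iff $\langle x\rangle\subseteq\langle y\rangle$ or $\langle y\rangle\subseteq\langle x\rangle$. This graph is connected, and $\kappa(G)$ denotes the number of spanning trees of $\mathcal{P}(G)$. *)

(* Defs.v *)
From mathcomp Require Import all_boot all_order all_fingroup all_solvable.
Set Implicit Arguments. Unset Strict Implicit. Unset Printing Implicit Defensive.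

Local Open Scope group_scope.

Section PowerGraph.
Variable gT : finGroupType.

Definition power_adj (x y : gT) : bool :=
  (x != y) && ((<[x]> \subset <[y]>) || (<[y]> \subset <[x]>)).

Definition power_edges (G : {set gT}) : {set {set gT}} :=
  [set [set x; y] | x in G, y in G & power_adj x y].

Definition sub_adj (T : {set {set gT}}) : rel gT :=
  fun x y => (x != y) && ([set x; y] \in T).

Definition sub_connected (G : {set gT}) (T : {set {set gT}}) : bool :=
  [forall x in G, forall y in G, connect (sub_adj T) x y].

(* The subgraph with edge set T has no cycle: no sequence of k >= 3 pairwise
   distinct vertices, consecutive ones (cyclically) adjacent.  A cycle in a
   graph with vertices in gT has at most #|gT| vertices. *)
Definition sub_acyclic (T : {set {set gT}}) : bool :=
  ~~ [exists k : 'I_(#|gT|).+1, exists t : k.-tuple gT,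
        [&& 2 < k, uniq t & path.cycle (sub_adj T) t]].

Definition power_spanning_tree (G : {set gT}) (T : {set {set gT}}) : bool :=
  [&& T \subset power_edges G, sub_connected G T & sub_acyclic T].

Definition kappa (G : {set gT}) : nat :=
  #|[set T : {set {set gT}} | power_spanning_tree G T]|.

End PowerGraph.

Definition A6 : {group {perm 'I_6}} := Alt_group 'I_6.

(* Main.v *)
Require Import Defs.
From mathcomp Require Import all_boot all_order all_fingroup all_solvable.
From mathcomp Require Import all_algebra all_character ring zify.
Set Implicit Arguments. Unset Strict Implicit. Unset Printing Implicit Defensive.

Local Open Scope group_scope.

(* By the matrix-tree theorem, two vertices with the same closed neighbourhood of size [n] have
   Laplacian rows whose difference is divisible by [n], so a maximal cyclic subgroup [C] contributes
   [#|C| ^ (totient #|C| - 1)] to [kappa G].  With [kappa A6 = 4 ^ 90 * 3 ^ 40 * 5 ^ 108] this bounds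
   the prime divisors of [#|G|] by 5, the number of subgroups of order 5 by 36, of those of order 3
   by 40, and the number of elements of order divisible by 4 by 180; Burnside's theorem then makes
   30 divide [#|G|].  The Sylow 5-subgroups have order 5 and there are 6, 16 or 36 of them.  Six
   embed [G] in [A6], sixteen are impossible, and thirty-six force ten Sylow 3-subgroups of order 9
   with trivial pairwise intersections.  In that case [G] acts doubly transitively on them, parity
   of permutations controls the involutions, counting elements gives [#|G| = 360], and a finite
   check shows that the resulting permutation group of degree 10 is unique.  As [A6] itself is in
   this case, [G] is isomorphic to it. *)

(** * Spanning trees and the Laplacian *)

(** The obstacle is that [kappa G] gives neither the order of [G] nor the orders of its elements:
    the Laplacian argument only produces a divisor of it. The hypothesis is therefore used prime by
    prime, through the valuations 180, 40 and 108 of [kappa A6] at 2, 3 and 5 and 0 elsewhere, and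
    through its size. The valuations act as a budget: each maximal cyclic subgroup [C] spends
    [(totient #|C|).-1 * logn p #|C|] of it, so cyclic subgroups can be neither too many nor too
    large. In the opposite direction, a simple group acts faithfully on every conjugation-stable
    family containing a proper nontrivial subgroup, so [#|G|] divides the factorial of the size of
    the family, which cannot be small. Most numerical cases fall in the gap between the two bounds.
    The exponents 90, 40 and 108 come from the 45 cyclic subgroups of order 4 of [A6], its 40 of
    order 3 and its 36 of order 5, a complete block on [n] vertices having [n ^ (n - 2)] spanning
    trees. *)

Section ParentFunctions.
Variables (gT : finGroupType) (G : {group gT}).
Implicit Types (h : {ffun gT -> gT}) (T : {set {set gT}}).

(* A spanning tree is encoded by the function sending each vertex to its parent when the tree is
   rooted at the identity; vertices outside [G^#] are sent to the root by convention. *)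
Definition parent_choice (v u : gT) : bool :=
  if v \in G^# then (u \in G) && power_adj v u else u == 1.

Definition parent_funs : {set {ffun gT -> gT}} :=
  [set h : {ffun gT -> gT} | [forall v, parent_choice v (h v)] & [forall v, fconnect h v 1]].

Definition parent_edges h : {set {set gT}} := [set [set v; h v] | v in G^#].

Lemma power_adjC : symmetric (@power_adj gT).
Proof. by move=> x y; rewrite /power_adj eq_sym orbC. Qed.

Lemma sub_adjC T : symmetric (sub_adj T).
Proof. by move=> x y; rewrite /sub_adj eq_sym setUC. Qed.

Lemma set2_inj (T : finType) (x y a b : T) :
  [set x; y] = [set a; b] -> (x = a /\ y = b) \/ (x = b /\ y = a).
Proof.
move=> E.
have xab : x \in [set a; b] by rewrite -E set21.
have yab : y \in [set a; b] by rewrite -E set22.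
have axy : a \in [set x; y] by rewrite E set21.
have bxy : b \in [set x; y] by rewrite E set22.
case/set2P: xab => Ex; case/set2P: yab => Ey; subst; auto.
  by left; split=> //; case/set2P: bxy.
by left; split=> //; case/set2P: axy.
Qed.

Lemma power_edgesP x y :
  reflect [/\ x \in G, y \in G & power_adj x y] ([set x; y] \in power_edges G).
Proof.
apply: (iffP imset2P) => [[a b aG /=]|[xG yG xy]]; last by exists x y; rewrite // inE yG xy.
rewrite inE => /andP[bG ab] /set2_inj[[-> ->] | [-> ->]]; split=> //.
by rewrite power_adjC.
Qed.

Lemma parent_choice_in v u :
  v \in G^# -> parent_choice v u = (u \in G) && power_adj v u.
Proof. by rewrite /parent_choice => ->. Qed.

Lemma parent_funsP h :
  reflect ((forall v, parent_choice v (h v)) /\ (forall v, fconnect h v 1)) (h \in parent_funs).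
Proof. by rewrite inE; apply: (iffP andP) => -[/forallP ? /forallP]. Qed.

Lemma parent_edges_adjP h x y : h \in parent_funs ->
  reflect ((x \in G^# /\ h x = y) \/ (y \in G^# /\ h y = x)) (sub_adj (parent_edges h) x y).
Proof.
case/parent_funsP=> hc _.
have hN v : v \in G^# -> v != h v.
  by move=> vG; move: (hc v); rewrite parent_choice_in // => /andP[_ /andP[]].
apply: (iffP andP) => [[_ /imsetP[v vG /set2_inj[[-> ->]|[-> ->]]]]|].
- by left.
- by right.
case=> -[vG <-].
  by rewrite hN //; split=> //; apply: imset_f.
by rewrite eq_sym hN // setUC; split=> //; apply: imset_f.
Qed.

Lemma parent_edges_sub h : h \in parent_funs -> parent_edges h \subset power_edges G.
Proof.
case/parent_funsP=> hc _; apply/subsetP=> E /imsetP[v vG ->].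
move: (hc v); rewrite parent_choice_in // => /andP[hG hv].
by apply/power_edgesP; split=> //; case/setD1P: vG.
Qed.

(** The number of iterations needed to reach the identity is such a depth. Connectedness, acyclicity
    and uniqueness of the encoding all rest on it. *)
Lemma root_depth h : h \in parent_funs ->
  exists d : gT -> nat, forall v, v \in G^# -> d (h v) < d v.
Proof.
case/parent_funsP=> _ hr.
have ex v : exists k, iter k h v == 1.
  by exists (findex h v 1); rewrite iter_findex.
exists (fun v => ex_minn (ex v)) => v /setD1P[v1 _].
case: (ex_minnP (ex v)) => [[|k]] /=; first by rewrite (negPf v1).
rewrite -iterS iterSr => hk _; case: ex_minnP => m _ /(_ k hk).
by rewrite ltnS.
Qed.

Lemma parent_edges_connect h x : h \in parent_funs -> x \in G ->
  connect (sub_adj (parent_edges h)) x 1.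
Proof.
move=> hP; case: (root_depth hP) => d dP.
elim: {x}(d x).+1 {-2}x (ltnSn (d x)) => // n IHn x; rewrite ltnS => dx xG.
have [->|x1] := eqVneq x 1; first exact: connect0.
have xG1 : x \in G^# by rewrite !inE x1.
apply: (@connect_trans _ _ (h x)).
  by apply: connect1; apply/parent_edges_adjP => //; left.
apply: IHn; first exact: leq_trans (dP _ xG1) dx.
case/parent_funsP: hP => /(_ x); rewrite parent_choice_in //.
by case/andP.
Qed.

Lemma parent_edges_tree h : h \in parent_funs -> power_spanning_tree G (parent_edges h).
Proof.
move=> hP; rewrite /power_spanning_tree parent_edges_sub //=; apply/andP; split.
  apply/forall_inP=> x xG; apply/forall_inP=> y yG.
  apply: (@connect_trans _ _ 1); first exact: parent_edges_connect.
  by rewrite (sym_connect_sym (@sub_adjC _)) parent_edges_connect.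
case: (root_depth hP) => d dP.
apply/existsP=> -[k /existsP[t /and3P[k2 ut ct]]].
have [x0 x0t] : exists x0, x0 \in val t.
  by case: t ut ct k2 => -[|x s] /= /eqP <- // _ _ _; exists x; rewrite mem_head.
case: (arg_maxnP d x0t) => v vt vmax.
(* A vertex of maximal depth on a cycle would have its parent as both of its neighbours. *)
have nb u : u \in val t -> sub_adj (parent_edges h) v u -> u = h v.
  move=> ut' /(parent_edges_adjP _ _ hP)[[_ ->] //|[uG hu]].
  by move: (dP u uG) (vmax u ut'); rewrite hu /= ltnNge => /negPf->.
have [i s Es] := rot_to vt.
have us : uniq (v :: s) by rewrite -Es rot_uniq.
have cs : path.cycle (sub_adj (parent_edges h)) (v :: s) by rewrite -Es rot_cycle.
have zs : 2 < size (v :: s) by rewrite -Es size_rot size_tuple.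
have ms u : u \in v :: s -> u \in val t by rewrite -Es mem_rot.
case: s {Es} us cs zs ms => [|a s] //; case/lastP: s => [|s b] //= us cs _ ms.
move: cs; rewrite rcons_path last_rcons => /and3P[va _ bv].
have Ea : a = h v by apply: nb => //; apply: ms; rewrite !inE eqxx orbT.
have Eb : b = h v.
  by apply: nb; [apply: ms; rewrite !inE mem_rcons mem_head !orbT | rewrite sub_adjC].
by case/and3P: us => _; rewrite mem_rcons Ea Eb mem_head.
Qed.

(** If [h] and [h'] disagree at [v], then [h'] must use the edge between [v] and [h v] in the other
    direction, so they disagree at [h v] too: an infinite descent on depth. *)
Lemma parent_edges_inj : {in parent_funs &, injective parent_edges}.
Proof.
move=> h h' hP hP' E; apply/ffunP=> v.
case/parent_funsP: (hP) => hc hr; case/parent_funsP: (hP') => hc' hr'.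
case: (boolP (v \in G^#)) => vG; last first.
  move: (hc v) (hc' v); rewrite /parent_choice (negPf vG).
  by move=> /eqP-> /eqP->.
have step x : x \in G^# -> h' x != h x -> h' (h x) = x /\ h x \in G^#.
  move=> xG ne; have /(parent_edges_adjP _ _ hP') : sub_adj (parent_edges h') x (h x).
    by rewrite -E; apply/parent_edges_adjP => //; left.
  by case=> -[xG' Eh]; [rewrite Eh eqxx in ne | split].
apply/eqP; rewrite eq_sym; apply/negPn/negP=> ne.
case: (root_depth hP) => d dP.
elim: {v}(d v).+1 {-2}v (ltnSn (d v)) vG ne => // n IHn v; rewrite ltnS => dv vG ne.
have [Ev hG] := step v vG ne.
have dhv := dP _ vG.
apply: (IHn (h v)) => //; first exact: leq_trans dhv dv.
by rewrite Ev; apply/eqP=> Ev2; move: (dP _ hG); rewrite -Ev2 ltnNge (ltnW dhv).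
Qed.

(** The parent of [v] is a neighbour closer to the identity in [T]. The resulting tree lies in [T],
    and a further edge of [T] would close a cycle with it. *)
Lemma tree_parent_edges T : power_spanning_tree G T ->
  exists2 h, h \in parent_funs & T = parent_edges h.
Proof.
case/and3P=> sTE cT aT.
have adjG x y : sub_adj T x y -> [/\ x \in G, y \in G & power_adj x y].
  by case/andP=> _ /(subsetP sTE)/power_edgesP.
(* Vertices outside [G] get distance 0, so that [ex] holds on the whole type. *)
have ex v : exists k, (v \notin G) || [exists p : k.-tuple gT, path (sub_adj T) v p && (last v p == 1)].
  case: (boolP (v \in G)) => vG; last by exists 0.
  have /connectP[p pp pl] := forall_inP (forall_inP cT v vG) 1 (group1 G).
  by exists (size p); apply/existsP; exists (in_tuple p); rewrite /= pp -pl eqxx.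
pose d v := ex_minn (ex v).
have dP v : v \in G^# -> exists2 u, sub_adj T v u & d u < d v.
  case/setD1P=> v1 vG; rewrite {2}/d; case: ex_minnP => k; rewrite vG /=.
  case/existsP=> -[[|u p] /= /eqP zp]; first by rewrite (negPf v1).
  case/andP=> /andP[vu up] lp _; exists u => //.
  rewrite /d; case: ex_minnP => m _ /(_ (size p)); rewrite -zp ltnS; apply.
  by apply/orP; right; apply/existsP; exists (in_tuple p); rewrite /= up.
pose h := [ffun v => if v \in G^# then odflt 1 [pick u | sub_adj T v u & d u < d v] else 1].
have hv v : v \in G^# -> sub_adj T v (h v) && (d (h v) < d v).
  move=> vG; rewrite ffunE vG; case: pickP => [u //|no].
  by have [u u1 u2] := dP v vG; move: (no u); rewrite u1 u2.
have hP : h \in parent_funs.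
  apply/parent_funsP; split=> v.
    case: (boolP (v \in G^#)) => vG; last by rewrite /parent_choice ffunE (negPf vG).
    by rewrite parent_choice_in //; case/andP: (hv v vG) => /adjG[_ -> ->].
  elim: {v}(d v).+1 {-2}v (ltnSn (d v)) => // n IHn v; rewrite ltnS => dv.
  apply: connect_trans (fconnect1 h v) _.
  case: (boolP (v \in G^#)) => vG; last by rewrite ffunE (negPf vG).
  by apply: IHn; apply: leq_trans dv; case/andP: (hv v vG).
exists h => //.
have sub : parent_edges h \subset T.
  by apply/subsetP=> E /imsetP[v vG ->]; case/andP: (hv v vG) => /andP[_ ].
apply/eqP; rewrite eqEsubset sub andbT; apply/subsetP=> E ET.
apply/negPn/negP=> nE.
have /imset2P[x y xG] := subsetP sTE _ ET; rewrite inE => /andP[yG xy] EE; subst E.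
have xNy : x != y by case/andP: xy.
case/and3P: (parent_edges_tree hP) => _ ch _.
have /connectP[p0 pp0 pl0] := forall_inP (forall_inP ch x xG) y yG.
case/shortenP: pp0 pl0 => p pp up _ pl.
case/negP: aT; apply/existsP.
have zp : size (x :: p) < (#|gT|).+1 by rewrite ltnS -(card_uniqP up) max_card.
have pT : path (sub_adj T) x p.
  apply: sub_path pp => a b; rewrite /sub_adj => /andP[-> ab].
  exact: (subsetP sub).
(* A path of length one would be the edge between [x] and [y], which is not a parent edge; the cycle
   thus has at least three vertices. *)
have p2 : 1 < size p.
  case: p pp pl {up zp pT} => [|a [|b p]] //= pp pl; first by rewrite pl eqxx in xNy.
  by case/negP: nE; move: pp; rewrite pl andbT => /andP[].
exists (Ordinal zp); apply/existsP; exists (in_tuple (x :: p)).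
apply/and3P; split=> //.
rewrite /= rcons_path pT -pl /sub_adj eq_sym xNy setUC.
exact: ET.
Qed.

Lemma kappa_parent_funs : kappa G = #|parent_funs|.
Proof.
rewrite -(card_in_imset parent_edges_inj); apply: eq_card => T; rewrite inE.
apply/idP/imsetP=> [/tree_parent_edges[h hP ->]|[h hP ->]]; first by exists h.
exact: parent_edges_tree.
Qed.

(** Each vertex has at most [#|G|] admissible parents. This crude bound is enough to exclude small
    groups. *)
Lemma kappa_leq : kappa G <= (#|G| ^ #|G|)%N.
Proof.
rewrite kappa_parent_funs.
apply: leq_trans (_ : #|family (fun v => finset (parent_choice v))| <= _).
  apply: subset_leq_card; apply/subsetP=> h /parent_funsP[hc _].
  by apply/familyP=> v; rewrite inE.
rewrite card_family foldrE big_image /= (bigID (fun v => v \in G)) /=.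
rewrite -(muln1 (#|G| ^ #|G|)%N) leq_mul //.
  rewrite -prod_nat_const; apply: leq_prod => v vG; apply: subset_leq_card.
  apply/subsetP=> u; rewrite inE /parent_choice.
  by case: ifP => _; [case/andP | move/eqP->; apply: group1].
rewrite big1 // => v vG; rewrite -(cards1 (1 : gT)); apply: eq_card => u.
by rewrite inE /parent_choice !inE (negPf vG) andbF.
Qed.

End ParentFunctions.

(** * The matrix-tree theorem *)

Section MatrixTree.
Import GRing.Theory Num.Theory.
Local Open Scope ring_scope.
Variables (gT : finGroupType).

Definition mxF (F : gT -> gT -> int) : 'M[int]_#|gT| :=
  \matrix_(i, j) F (enum_val i) (enum_val j).

Lemma mul_mxF (A B : gT -> gT -> int) :
  mxF A *m mxF B = mxF (fun x y => \sum_z A x z * B z y).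
Proof.
apply/matrixP=> i j; rewrite !mxE [RHS](reindex _ (onW_bij _ (enum_val_bij gT))) /=.
by apply: eq_bigr => k _; rewrite !mxE.
Qed.

Lemma eq_mxF (A B : gT -> gT -> int) : A =2 B -> mxF A = mxF B.
Proof. by move=> E; apply/matrixP=> i j; rewrite !mxE E. Qed.

Lemma mxF1 : mxF (fun x y => (x == y)%:R) = 1%:M.
Proof. by apply/matrixP=> i j; rewrite !mxE (inj_eq enum_val_inj). Qed.

Lemma sum_enum_val (F : gT -> int) : \sum_(i < #|gT|) F (enum_val i) = \sum_v F v.
Proof. by rewrite [RHS](reindex _ (onW_bij _ (enum_val_bij gT))). Qed.

Lemma prod_enum_rank (F : 'I_#|gT| -> int) : \prod_i F i = \prod_(v : gT) F (enum_rank v).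
Proof. exact: (reindex _ (onW_bij _ (@enum_rank_bij gT))). Qed.

(** Row [v] is the unit vector of [v] minus that of its parent, the latter dropped when the parent
    is the root. Keeping the full size, with a unit row at the root, replaces striking out a row and
    a column. *)
Definition parent_mx (h : gT -> gT) (v j : gT) : int :=
  (v == j)%:R - ((h v != 1%g) && (h v == j))%:R.

(** The indicator of the vertices that never reach the root is a kernel vector, since it takes the
    same value at a vertex and at its parent. *)
Lemma det_parent_mx0 h v : h 1%g = 1%g -> ~~ fconnect h v 1%g -> \det (mxF (parent_mx h)) = 0.
Proof.
move=> h1 nv; rewrite -det_tr; apply/eqP/det0P.
exists (\row_i (~~ fconnect h (enum_val i) 1%g)%:R).
  apply/eqP=> /rowP/(_ (enum_rank v)); rewrite !mxE enum_rankK nv.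
  by move/eqP; rewrite oner_eq0.
apply/rowP=> i; rewrite !mxE.
set x := enum_val i.
rewrite (eq_bigr (fun k => (~~ fconnect h (enum_val k) 1%g)%:R * parent_mx h x (enum_val k)));
  last by move=> k _; rewrite !mxE.
rewrite (sum_enum_val (fun k => (~~ fconnect h k 1%g)%:R * parent_mx h x k)).
rewrite /parent_mx; under eq_bigr do rewrite mulrBr.
rewrite sumrB (bigD1 x) //= eqxx mulr1 big1 ?addr0; last first.
  by move=> y; rewrite eq_sym => /negPf->; rewrite mulr0.
rewrite (bigD1 (h x)) //= eqxx andbT big1 ?addr0; last first.
  by move=> y; rewrite eq_sym => /negPf->; rewrite andbF mulr0.
have [hx1|hx1] := eqVneq (h x) 1%g.
  have -> : fconnect h x 1%g by rewrite -hx1 fconnect1.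
  by rewrite mulr0 subr0.
rewrite mulr1; case: (eqVneq x 1%g) hx1 => [->|x1 _]; first by rewrite h1 eqxx.
suff -> : fconnect h x 1%g = fconnect h (h x) 1%g by rewrite subrr.
apply/idP/idP=> [|xc]; last exact: connect_trans (fconnect1 h x) xc.
case/connectP=> -[|a p] /=; first by move=> _ E; rewrite -E eqxx in x1.
by case/andP=> /eqP-> hp El; apply/connectP; exists p.
Qed.

(** Take [v] whose parent [u] is a child of the root, and attach [v] to the root instead. Row [v]
    changes by the unit vector of [u], which is row [u], so the determinant is unchanged; induct on
    the number of vertices not attached to the root. *)
Lemma det_parent_mx1 h : h 1%g = 1%g -> (forall v, fconnect h v 1%g) ->
  \det (mxF (parent_mx h)) = 1.
Proof.
elim: {h}#|_|.+1 {-2}h (ltnSn #|[set v | h v != 1%g]|) => // n IHn h; rewrite ltnS => hn h1 hc.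
case: (set_0Vmem [set v | h v != 1%g]) => [h0|[v0]].
  rewrite (_ : mxF _ = 1%:M) ?det1 // -mxF1; apply: eq_mxF => x y.
  by move/setP/(_ x): h0; rewrite /parent_mx !inE => ->; rewrite subr0.
rewrite inE => hv0.
have [v [hv hhv]] : exists v, h v != 1%g /\ h (h v) = 1%g.
  have := iter_findex (hc v0).
  elim: (findex h v0 1%g) => [/= E|k IHk]; first by rewrite E h1 eqxx in hv0.
  case: k IHk => [|k] IHk; first by move/eqP; rewrite /= (negPf hv0).
  have [E|ne] := eqVneq (iter k.+1 h v0) 1%g; first by move=> _; apply: IHk.
  by exists (iter k h v0).
set u := h v in hv hhv.
have uv : u != v by apply/eqP=> E; move: hv; rewrite -hhv E -/u E eqxx.
pose h' x := if x == v then 1%g else h x.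
have h'P : \det (mxF (parent_mx h')) = 1.
  apply: IHn.
  - apply: leq_trans hn; apply: proper_card; apply/properP; split.
      by apply/subsetP=> x; rewrite !inE /h'; case: ifP => //; rewrite eqxx.
    by exists v; rewrite !inE /h' ?eqxx.
  - by rewrite /h' h1; case: ifP.
  move=> x; have := iter_findex (hc x).
  move: (findex h x 1%g) => k; elim: k x => [|k IHk] x; first by move=> /= ->.
  have [->|xv] := eqVneq x v; first by move=> _; apply: connect1; rewrite /= /h' eqxx.
  rewrite iterSr => /IHk; apply: connect_trans; apply: connect1.
  by rewrite /= /h' (negPf xv).
pose C x j : int := if x == v then (u == j)%:R else parent_mx h x j.
rewrite (@determinant_multilinear _ _ _ (mxF (parent_mx h')) (mxF C) (enum_rank v) 1 (-1)).
- rewrite h'P (@determinant_alternate _ _ (mxF C) (enum_rank u) (enum_rank v)).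
  + by rewrite mulr0 addr0 mulr1.
  + by rewrite (inj_eq enum_rank_inj).
  move=> j; rewrite !mxE !enum_rankK /C eqxx (negPf uv) /parent_mx hhv eqxx /=.
  by rewrite subr0.
- apply/rowP=> j; rewrite !mxE !enum_rankK /parent_mx /h' /C -/u !eqxx hv /=.
  by rewrite subr0 mul1r mulN1r.
- apply/matrixP=> i j; rewrite !mxE /parent_mx /h' ifN //.
  by rewrite -(inj_eq enum_rank_inj) enum_valK eq_sym neq_lift.
- apply/matrixP=> i j; rewrite !mxE /C ifN //.
  by rewrite -(inj_eq enum_rank_inj) enum_valK eq_sym neq_lift.
Qed.

Lemma det_mxF (A : gT -> gT -> int) :
  \det (mxF A) = \sum_(s : 'S_#|gT|) (-1) ^+ s * \prod_v A v (enum_val (s (enum_rank v))).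
Proof.
apply: eq_bigr => s _; rewrite prod_enum_rank; congr (_ * _).
by apply: eq_bigr => v _; rewrite mxE enum_rankK.
Qed.

Variable G : {group gT}.

(** Written as the sum of the rows of [parent_mx] over all admissible parents, ready for multilinear
    expansion. On [G^#] it is the Laplacian with the column of the identity cleared; the other rows
    are unit vectors. *)
Definition laplacian (v j : gT) : int :=
  \sum_(u | parent_choice G v u) ((v == j)%:R - ((u != 1%g) && (u == j))%:R).

(** Expanding by multilinearity in the rows gives one determinant per choice of parents, equal to 1
    if every vertex reaches the root and to 0 otherwise. *)
Lemma kappa_det : (kappa G)%:Z = \det (mxF laplacian).
Proof.
rewrite det_mxF.
under eq_bigr => s _ do rewrite (bigA_distr_big_dep _ _) big_distrr /=.
rewrite exchange_big /= kappa_parent_funs.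
transitivity (\sum_(h in family (fun v => parent_choice G v)) \det (mxF (parent_mx h))); last first.
  apply: eq_bigr => h _; rewrite det_mxF; apply: eq_bigr => s _; congr (_ * _).
rewrite -natz -sum1_card natr_sum (bigID (fun h => h \in family (fun v => parent_choice G v))) /=.
rewrite [X in _ + X]big1 ?addr0; last first.
  by move=> h /andP[/parent_funsP[hc _] /negP[]]; apply/familyP.
rewrite [RHS](bigID (fun h => h \in parent_funs G)) /= [X in _ = _ + X]big1 ?addr0; last first.
  move=> h /andP[/familyP hc].
  rewrite inE negb_and => /orP[/negP[]|]; first exact/forallP.
  case/forallPn=> v; apply: det_parent_mx0.
  have : parent_choice G 1%g (h 1%g) by apply: hc.
  by rewrite /parent_choice !inE eqxx => /eqP.
apply: eq_big => [h|h /andP[/parent_funsP[hc hr] _]]; first by rewrite andbC.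
rewrite det_parent_mx1 //.
by move: (hc 1%g); rewrite /parent_choice !inE eqxx => /eqP.
Qed.

End MatrixTree.

(** * Twin vertices and a divisor of the number of spanning trees *)

Section Twins.
Import GRing.Theory Num.Theory.
Variables (gT : finGroupType) (G : {group gT}).

Definition nbhd (x : gT) : {set gT} :=
  [set y in G | (<[x]> \subset <[y]>) || (<[y]> \subset <[x]>)].

(** [pick] depends only on the predicate, so elements of [G^#] with the same closed neighbourhood
    get the same representative. *)
Definition twin_rep (x : gT) : gT :=
  odflt x [pick y | (y \in G^#) && (nbhd y == nbhd x)].

Definition twins : {set gT} := [set x in G^# | twin_rep x != x].

Lemma nbhd_id x : x \in G -> x \in nbhd x.
Proof. by rewrite inE subxx => ->. Qed.

Lemma nbhd_1 x : 1 \in nbhd x.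
Proof. by rewrite inE group1 cycle1 sub1G orbT. Qed.

Lemma twin_repP x : x \in G^# -> twin_rep x \in G^# /\ nbhd (twin_rep x) = nbhd x.
Proof.
move=> xG; rewrite /twin_rep; case: pickP => [y /andP[? /eqP] //|/(_ x)].
by rewrite xG eqxx.
Qed.

Lemma eq_twin_rep x y : x \in G^# -> nbhd x = nbhd y -> twin_rep x = twin_rep y.
Proof.
move=> xG E; rewrite /twin_rep E; case: pickP => // /(_ x).
by rewrite xG E eqxx.
Qed.

Lemma twin_rep_id x : x \in G^# -> twin_rep (twin_rep x) = twin_rep x.
Proof. by move=> xG; case: (twin_repP xG) => tG E; apply: eq_twin_rep. Qed.

Lemma twin_rep_notin x : x \in G^# -> twin_rep x \notin twins.
Proof. by move=> xG; rewrite inE twin_rep_id // eqxx andbF. Qed.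

Local Open Scope ring_scope.

(** The degree is [#|nbhd x|] minus one, and the diagonal correction is absorbed by using the closed
    neighbourhood. The subtracted term depends on [nbhd x] only, so it cancels between twins. *)
Lemma laplacianE x j : x \in G^# ->
  laplacian G x j = (x == j)%:R *+ #|nbhd x| - ((j != 1%g) && (j \in nbhd x))%:R.
Proof.
move=> xG; have xG' : x \in G by case/setD1P: xG.
have x1 : x != 1%g by case/setD1P: xG.
rewrite /laplacian (eq_bigl (fun u => u \in nbhd x :\ x)); last first.
  move=> u; rewrite parent_choice_in // !inE /power_adj eq_sym.
  by rewrite andbCA.
rewrite sumrB sumr_const [in RHS](cardsD1 x) nbhd_id // add1n mulrS -addrAC.
have [jx|nj] := boolP (j \in nbhd x :\ x).
  rewrite (bigD1 j) //= eqxx andbT big1 ?addr0; last first.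
    by move=> u /andP[_ /negPf->]; rewrite andbF.
  by move: jx; rewrite !inE eq_sym => /andP[/negPf-> /andP[-> ->]]; rewrite !andbT add0r addrC.
rewrite big1; last first.
  by move=> u ux; case: (u =P j) => [E|]; [rewrite -E ux in nj | rewrite andbF].
move: nj; rewrite !inE negb_and negbK eq_sym; case: eqP => /= [<- _|_ /negPf].
  by rewrite x1 xG' subxx /= subrr add0r subr0.
by move->; rewrite andbF mul0rn !subr0 ?addr0.
Qed.

Lemma laplacian_out x j : x \notin G^# -> laplacian G x j = (x == j)%:R.
Proof.
move=> xG; rewrite /laplacian (eq_bigl (fun u => u == 1%g)) ?big_pred1_eq ?eqxx ?subr0 //.
by move=> u; rewrite /parent_choice (negPf xG).
Qed.

(** Read as a parent function, this yields a matrix of determinant 1 whose left multiplication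
    subtracts from each twin's row the row of its representative. *)
Definition twin_parent x := if x \in twins then twin_rep x else 1%g.

Definition twin_reduced x j : int :=
  if x \in twins then (x == j)%:R - (twin_rep x == j)%:R else laplacian G x j.

Lemma det_twin_parent : \det (mxF (parent_mx twin_parent)) = 1.
Proof.
have t1 x : x \notin twins -> twin_parent x = 1%g by rewrite /twin_parent => /negPf->.
apply: det_parent_mx1; first by apply: t1; rewrite !inE eqxx.
move=> x; apply: connect_trans (fconnect1 _ _) _; apply: connect_trans (fconnect1 _ _) _.
case: (boolP (x \in twins)) => xS.
  have -> : twin_parent x = twin_rep x by rewrite /twin_parent xS.
  by rewrite t1 // twin_rep_notin //; move: xS; rewrite inE => /andP[].
by rewrite (t1 x) // t1 // !inE eqxx.
Qed.

Lemma twin_parent_mx_row x (F : gT -> int) :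
  \sum_z parent_mx twin_parent x z * F z = F x - if x \in twins then F (twin_rep x) else 0.
Proof.
under eq_bigr do rewrite mulrBl; rewrite sumrB; congr (_ - _).
  rewrite (bigD1 x) //= eqxx mul1r big1 ?addr0 // => z; rewrite eq_sym => /negPf->.
  by rewrite mul0r.
rewrite /twin_parent; case: ifP => [xS|_]; last first.
  by rewrite big1 // => z _; rewrite eqxx mul0r.
rewrite (bigD1 (twin_rep x)) //= eqxx andbT big1 ?addr0 => [|z].
  suff -> : twin_rep x != 1%g by rewrite mul1r.
  by move: xS; rewrite inE => /andP[/twin_repP[/setD1P[]]].
by rewrite eq_sym => /negPf->; rewrite andbF mul0r.
Qed.

(* The Laplacian row of [x] minus that of its representative is [#|nbhd x|] times the difference of
   the two unit vectors. *)
Lemma kappa_twins :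
  (kappa G)%:Z = (\prod_(x in twins) #|nbhd x|)%N%:Z * \det (mxF twin_reduced).
Proof.
pose d x : int := if x \in twins then #|nbhd x|%:R else 1.
set P := (\prod_(x in twins) _)%N.
have <- : \det (diag_mx (\row_(i < #|gT|) d (enum_val i))) = P%:Z.
  rewrite /P det_diag prod_enum_rank -natz natr_prod [RHS]big_mkcond /=.
  by apply: eq_bigr => x _; rewrite mxE enum_rankK /d; case: ifP.
rewrite kappa_det -det_mulmx -[LHS]mul1r -det_twin_parent -det_mulmx mul_mxF.
congr (\det _); apply/matrixP=> i j; rewrite mul_diag_mx !mxE.
move: (enum_val i) (enum_val j) => {i j} x j.
rewrite twin_parent_mx_row /d /twin_reduced.
case: ifP => [|_]; last by rewrite subr0 mul1r.
rewrite inE => /andP[xG _]; case: (twin_repP xG) => tG E.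
rewrite !laplacianE // E mulrBr !mulr_natl.
by rewrite opprB addrA subrK.
Qed.

Lemma prod_twins_dvd : (\prod_(x in twins) #|nbhd x| %| kappa G)%N.
Proof. by rewrite -[kappa G]absz_nat kappa_twins abszM dvdn_mulr // absz_nat. Qed.

(* When adjacency is an equivalence relation on [G^#], adding to the row of a class representative
   the rows of its twins turns the reduced matrix into a unipotent one. *)
Lemma kappa_partition :
    (forall x y, x \in G^# -> y \in nbhd x -> y != 1%g -> nbhd y = nbhd x) ->
  kappa G = (\prod_(x in twins) #|nbhd x|)%N.
Proof.
move=> eqN.
pose E x z : int := (x == z)%:R + ((x \in G^#) && (x \notin twins) && (z \in twins) && (twin_rep z == x))%:R.
have EN : mxF E *m mxF twin_reduced = mxF (parent_mx twin_parent).
  rewrite mul_mxF; apply: eq_mxF => x j.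
  rewrite /E; under eq_bigr do rewrite mulrDl; rewrite big_split /=.
  rewrite (bigD1 x) //= eqxx mul1r big1 ?addr0; last first.
    by move=> z; rewrite eq_sym => /negPf->; rewrite mul0r.
  have [xS|xS] := boolP (x \in twins).
    rewrite big1 ?addr0 => [|z _]; last by rewrite andbF mul0r.
    rewrite /twin_reduced /parent_mx /twin_parent xS; case: (twin_rep x =P 1%g) => // t1.
    by move: xS; rewrite inE => /andP[/twin_repP[/setD1P[]]]; rewrite t1 eqxx.
  rewrite {1}/twin_reduced /parent_mx /twin_parent (negPf xS) /= eqxx /= subr0.
  have [xG|xG] := boolP (x \in G^#); last first.
    by rewrite big1 ?addr0 ?laplacian_out // => z _; rewrite mul0r.
  have tx : twin_rep x = x by apply/eqP; move: xS; rewrite inE xG negbK.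
  have xG' : x \in G by case/setD1P: xG.
  have x1 : x != 1%g by case/setD1P: xG.
  pose Y := [set z in twins | twin_rep z == x].
  (* The neighbourhood of a representative is its class together with the identity; hence its row
     and the reduced rows of the class add up to the unit vector of [x]. *)
  have Nx : nbhd x = 1%g |: (x |: Y).
    apply/setP=> y; rewrite !in_setU1.
    have [->|y1] := eqVneq y 1%g; first by rewrite nbhd_1.
    have [->|yx] := eqVneq y x; first by rewrite nbhd_id.
    rewrite /=; apply/idP/idP=> [yN|].
      have yG : y \in G^# by rewrite !inE y1; move: yN; rewrite inE => /andP[].
      have ty : twin_rep y = x by rewrite -tx; apply: eq_twin_rep => //; apply: eqN.
      by rewrite inE ty eqxx andbT inE yG ty eq_sym.
    rewrite inE => /andP[]; rewrite inE => /andP[yG _] /eqP ty.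
    case: (twin_repP yG) => _; rewrite ty => ->.
    by apply: nbhd_id; case/setD1P: yG.
  rewrite (eq_bigr (fun z => if z \in Y then (z == j)%:R - (x == j)%:R else 0)); last first.
    move=> z _; rewrite [z \in Y]inE /=; have [zS|] := boolP (z \in twins); last by rewrite mul0r.
    by rewrite /twin_reduced zS /=; case: eqP => [->|]; rewrite ?mul1r ?mul0r.
  rewrite -big_mkcond /= sumrB sumr_const laplacianE // Nx.
  have xY : x \notin Y by rewrite inE (negPf xS).
  have Y1 : 1%g \notin Y by rewrite !inE eqxx.
  rewrite !cardsU1 !in_setU1 [1%g == x]eq_sym (negPf x1) (negPf Y1) xY /= !add1n !mulrS.
  have -> : \sum_(i in Y) ((i == j)%:R : int) = (j \in Y)%:R.
    have [jY|jY] := boolP (j \in Y).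
      by rewrite (bigD1 j) //= eqxx big1 ?addr0 // => i /andP[_ /negPf->].
    by rewrite big1 // => i iY; case: eqP => // Ei; rewrite -Ei iY in jY.
  have [->|j1] := eqVneq j 1%g; first by rewrite (negPf Y1) (negPf x1) /= !mul0rn; ring.
  rewrite /= eq_sym; case: (j =P x) => [->|_] /=; first by rewrite (negPf xY) /=; ring.
  by rewrite !mul0rn; ring.
(* A product of two integer determinants is 1, so each has absolute value 1; [\det (mxF E)] is never
   computed. *)
have := congr1 (fun M => absz (\det M)) EN.
rewrite det_mulmx det_twin_parent abszM /= => /eqP; rewrite muln_eq1 => /andP[_ /eqP dN].
by rewrite -[LHS]absz_nat kappa_twins abszM dN muln1.
Qed.

End Twins.

(** * The number of spanning trees for A6 *)

Section PartitionCount.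
Variables (gT : finGroupType) (G : {group gT}).
Hypothesis nbhd_eq :
  forall x y, x \in G^# -> y \in nbhd G x -> y != 1 -> nbhd G y = nbhd G x.

(** A neighbourhood of size [c.+2] without the identity is a class of [c.+1] elements, one of them
    the representative; cross-multiplying avoids division. *)
Lemma card_twins_nbhd c : (#|[set x in twins G | #|nbhd G x| == c.+2]| * c.+1 =
  #|[set x in G^# | #|nbhd G x| == c.+2]| * c)%N.
Proof.
set A := [set x in G^# | _]; set S := [set x in twins G | _].
have SA : S \subset A.
  by apply/subsetP=> x; rewrite !inE => /andP[/andP[-> _] ->].
have memA x : (x \in A) = (x \in G^#) && (#|nbhd G x| == c.+2) by rewrite inE.
have memD x : (x \in A :\: S) = (x \notin twins G) && (x \in A).
  by rewrite in_setD memA [x \in S]inE negb_and andb_orl !andbA [_ && (_ == _)]andbC;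
     case: eqP => //= _; rewrite ?andbF ?orbF.
have cA : #|A| = (#|A :\: S| * c.+1)%N.
  rewrite -sum_nat_const -sum1_card.
  rewrite (partition_big (twin_rep G) (mem (A :\: S))) /= => [|x]; last first.
    rewrite memD !memA => /andP[xG xc]; have [tG E] := twin_repP xG.
    by rewrite tG E xc twin_rep_notin.
  apply: eq_bigr => r; rewrite memD memA => /and3P[nr rG /eqP rc].
  have tr : twin_rep G r = r by apply/eqP; move: nr; rewrite inE rG negbK.
  have -> : c.+1 = #|nbhd G r :\ 1|.
    by apply/eqP; rewrite -eqSS -rc (cardsD1 1 (nbhd G r)) nbhd_1.
  rewrite -sum1_card; apply: eq_bigl => x.
  rewrite memA; apply/idP/idP=> [/andP[/andP[xG _] /eqP <-]|].
    have [_ ->] := twin_repP xG.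
    by case/setD1P: xG => x1 xG; rewrite in_setD1 x1 nbhd_id.
  case/setD1P=> x1 xN; have E := nbhd_eq rG xN x1.
  have xG : x \in G^# by rewrite in_setD1 x1; move: xN; rewrite inE => /andP[->].
  by rewrite -(eq_twin_rep rG (esym E)) tr eqxx andbT xG E rc eqxx.
have /eqP := cardsID S A; rewrite (setIidPr SA) => /eqP E.
apply/eqP; rewrite -(eqn_add2r (#|A :\: S| * c.+1)%N) -mulnDl E.
by rewrite -cA mulnS addnC.
Qed.

End PartitionCount.

(** * Permutations as lists of values *)

Section PermCodes.

(** The left factor acts first, as in the product of permutations. *)
Definition mulp (a b : seq nat) := map (nth 0 b) a.
Definition expp n (a : seq nat) k := iter k (mulp a) (iota 0 n).

Variable n : nat.
Implicit Types s t : {perm 'I_n}.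

Definition code s : seq nat := [seq val (s i) | i <- enum 'I_n].

Lemma size_code s : size (code s) = n.
Proof. by rewrite size_map size_enum_ord. Qed.

Lemma nth_code s (i : 'I_n) : nth 0 (code s) i = s i.
Proof. by rewrite (nth_map i) ?size_enum_ord // nth_ord_enum. Qed.

Lemma code_inj : injective code.
Proof. by move=> s t E; apply/permP=> i; apply: ord_inj; rewrite -!nth_code E. Qed.

Lemma codeM s t : code (s * t) = mulp (code s) (code t).
Proof.
rewrite /mulp -map_comp; apply: eq_map => i /=.
by rewrite nth_code permM.
Qed.

Lemma code_uniq s : uniq (code s).
Proof.
rewrite map_inj_uniq ?enum_uniq // => i j /ord_inj; exact: perm_inj.
Qed.

Lemma code1 : code 1 = iota 0 n.
Proof. by rewrite -val_enum_ord; apply: eq_map => i; rewrite perm1. Qed.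

Lemma codeX s k : code (s ^+ k) = expp n (code s) k.
Proof. by elim: k => [|k IHk]; rewrite ?code1 // expgS codeM IHk. Qed.

End PermCodes.

Arguments code {n} s.
Arguments code_inj {n} [s t] : rename.

Section AlternatingSix.

Definition idp := iota 0 6.
Definition inversions (a : seq nat) :=
  count (fun p : nat * nat => (p.1 < p.2) && (nth 0 a p.2 < nth 0 a p.1))
    [seq (i, j) | i <- idp, j <- idp].
Definition transp i j := [seq if k == i then j else if k == j then i else k | k <- idp].
Definition even_lists := [seq a <- permutations idp | ~~ odd (inversions a)].
(** Five exponents suffice, as even permutations of six points have order at most 5; [order_check]
    verifies this. *)
Definition pows a := [seq expp 6 a k | k <- iota 0 5].
Definition linked (p q : seq nat * seq (seq nat)) := (p.1 \in q.2) || (q.1 \in p.2).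
Definition tagged := [seq (a, pows a) | a <- even_lists].
Definition nbhds := [seq (p.1, [seq q.1 | q <- tagged & linked p q]) | p <- tagged].

(** A transposition changes the parity of the number of inversions; induction on products of
    transpositions then identifies this parity with [odd_perm]. *)
Definition parity_check :=
  all (fun a => all (fun i => all (fun j =>
    (i == j) || (odd (inversions (mulp (transp i j) a)) == ~~ odd (inversions a))) idp) idp)
    (permutations idp).
Definition order_check :=
  all (fun a => has (fun k => expp 6 a k.+1 == idp) (iota 0 5)) even_lists.
(** Lists may be compared instead of sets, because all neighbourhoods are filtered from the same
    list [tagged]. *)
Definition nbhd_compat (p q : seq nat * seq (seq nat)) :=
  [|| q.1 == idp, q.1 \notin p.2 | q.2 == p.2].
Definition nbhd_ok (p : seq nat * seq (seq nat)) :=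
  (p.1 == idp) || (size p.2 \in [:: 3; 4; 5]) && all (nbhd_compat p) nbhds.
Definition nbhds_check := all nbhd_ok nbhds.
Definition nbhds_count c := count (fun p => (p.1 != idp) && (size p.2 == c)) nbhds.

Lemma parity_checkE : parity_check. Proof. by vm_compute. Qed.
Lemma order_checkE : order_check. Proof. by vm_compute. Qed.
Lemma nbhds_checkE : nbhds_check. Proof. by vm_compute. Qed.
(** These are 40 * 2, 45 * 3 and 36 * 4: the blocks are the cyclic subgroups of order 3, 4 and 5
    without the identity, each involution lying in a block of order 4. *)
Lemma nbhds_countE :
  [/\ nbhds_count 3 = 80, nbhds_count 4 = 135 & nbhds_count 5 = 144]%N.
Proof. by vm_compute. Qed.

Lemma nbhdsE :
  nbhds = [seq (a, [seq q.1 | q <- tagged & linked (a, pows a) q]) | a <- even_lists].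
Proof. by rewrite /nbhds /tagged -map_comp. Qed.

(* Conversion must not unfold these enumerations. *)
Opaque nbhds tagged even_lists.

Implicit Types s t x y : {perm 'I_6}.

Lemma code_idp : code (1 : {perm 'I_6}) = idp.
Proof. exact: code1. Qed.

Lemma code_permutations s : code s \in permutations idp.
Proof.
rewrite mem_permutations /idp -val_enum_ord /code map_comp.
apply/perm_map/uniq_perm; rewrite ?enum_uniq ?(map_inj_uniq perm_inj) ?enum_uniq //.
by move=> i; rewrite mem_enum -[i](permKV s) map_f // mem_enum.
Qed.

Lemma code_tperm (i j : 'I_6) : code (tperm i j) = transp i j.
Proof.
rewrite /transp /idp -val_enum_ord -map_comp; apply: eq_map => k /=.
by case: tpermP => [->|->|/eqP ki /eqP kj]; rewrite ?eqxx //;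
   [case: eqP => // -> | rewrite -!val_eqE in ki kj; rewrite (negPf ki) (negPf kj)].
Qed.

Lemma code_odd s : odd (inversions (code s)) = odd_perm s.
Proof.
have [ts -> dts] := prod_tpermP s.
elim: ts dts => [|[i j] ts IHts] /=; first by rewrite !big_nil odd_perm1 code_idp; vm_compute.
case/andP=> ij /IHts; rewrite !big_cons odd_mul_tperm ij /= => <-.
set a := (\prod_(_ <- _) _) .
have lt6 (k : 'I_6) : val k \in idp by rewrite mem_iota ltn_ord.
have := allP (allP (allP parity_checkE _ (code_permutations a)) _ (lt6 i)) _ (lt6 j).
rewrite val_eqE (negPf ij) codeM code_tperm /=.
by move/eqP.
Qed.

Lemma mem_even_lists s : (code s \in even_lists) = (s \in A6).
Proof. by rewrite mem_filter code_permutations andbT code_odd Alt_even. Qed.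

Lemma perm_even_lists : perm_eq [seq code s | s <- enum A6] even_lists.
Proof.
have ua : uniq [seq code s | s <- enum A6] by rewrite (map_inj_uniq code_inj) enum_uniq.
have sub : {subset [seq code s | s <- enum A6] <= even_lists}.
  by move=> _ /mapP[s sA ->]; rewrite mem_even_lists -mem_enum.
have c6 : size even_lists = 360 by vm_compute.
have sz : size even_lists <= size [seq code s | s <- enum A6].
  have := card_Alt (T := 'I_6); rewrite card_ord => /(_ isT).
  rewrite size_map -cardE c6 -[6`!]/(2 * 360)%N => /eqP.
  by rewrite eqn_pmul2l // => /eqP->.
have [_ mem] := uniq_min_size ua sub sz.
exact: uniq_perm ua (filter_uniq _ (permutations_uniq _)) mem.
Qed.

Lemma mem_pows x y : x \in A6 -> (code y \in pows (code x)) = (y \in <[x]>).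
Proof.
rewrite -mem_even_lists => xA.
have /allP/(_ _ xA)/hasP[k k5 /eqP] := order_checkE.
rewrite -codeX -code_idp => /code_inj xk.
apply/mapP/cycleP=> [[m _]|[m ->]]; first by rewrite -codeX => /code_inj->; exists m.
exists (m %% k.+1).
  rewrite mem_iota add0n; move: k5; rewrite mem_iota /= add0n.
  by apply: leq_trans; apply: ltn_mod.
by rewrite -codeX expg_mod.
Qed.

Definition code_nbhd x : seq (seq nat) :=
  [seq q.1 | q <- tagged & linked (code x, pows (code x)) q].

Lemma code_nbhd_in x : x \in A6 -> (code x, code_nbhd x) \in nbhds.
Proof.
move=> xA; apply/mapP; exists (code x, pows (code x)) => //.
by apply/mapP; exists (code x); rewrite ?mem_even_lists.
Qed.

Lemma mem_code_nbhd x y : x \in A6 -> (code y \in code_nbhd x) = (y \in nbhd A6 x).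
Proof.
move=> xA; rewrite inE !cycle_subG; apply/mapP/andP=> [[q]|[yA xy]].
  rewrite mem_filter => /andP[+ /mapP[a aE Eq]] Ey; subst q; rewrite /= in Ey; subst a.
  rewrite mem_even_lists in aE; rewrite /linked /= !mem_pows //.
exists (code y, pows (code y)) => //.
rewrite mem_filter /linked /= !mem_pows // xy /=.
by apply/mapP; exists (code y); rewrite ?mem_even_lists.
Qed.

Lemma size_code_nbhd x : x \in A6 -> size (code_nbhd x) = #|nbhd A6 x|.
Proof.
move=> xA; rewrite cardE -(size_map code); apply/perm_size/uniq_perm.
- have ue : uniq even_lists := filter_uniq _ (permutations_uniq _).
  have ut : uniq tagged by rewrite (map_inj_uniq _) ?ue => [|a b []].
  rewrite map_inj_in_uniq; first exact: filter_uniq.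
  by move=> p q; rewrite !mem_filter => /andP[_ /mapP[a _ ->]] /andP[_ /mapP[b _ ->]] /= ->.
- by rewrite (map_inj_uniq code_inj) enum_uniq.
move=> a; apply/idP/mapP=> [aN|[y + ->]]; last by rewrite mem_enum mem_code_nbhd.
have : a \in even_lists by case/mapP: aN => q; rewrite mem_filter => /andP[_ /mapP[b bE ->]] ->.
rewrite -(perm_mem perm_even_lists) => /mapP[y _ Ea]; exists y => //.
by rewrite mem_enum -mem_code_nbhd // -Ea.
Qed.

Lemma code_eq1 x : (code x == idp) = (x == 1).
Proof. by rewrite -code_idp (inj_eq code_inj). Qed.

Lemma nbhd_okE a A :
  nbhd_ok (a, A) = (a == idp) || (size A \in [:: 3; 4; 5]) && all (nbhd_compat (a, A)) nbhds.
Proof. by []. Qed.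

Lemma nbhd_compatE a A b B : nbhd_compat (a, A) (b, B) = [|| b == idp, b \notin A | B == A].
Proof. by []. Qed.

Lemma A6_nbhds_check x : x \in A6^# -> (#|nbhd A6 x| \in [:: 3; 4; 5]) /\
  forall y, y \in nbhd A6 x -> y != 1 -> nbhd A6 y = nbhd A6 x.
Proof.
case/setD1P=> x1 xA.
have := allP nbhds_checkE _ (code_nbhd_in xA).
rewrite nbhd_okE code_eq1 (negPf x1) orFb size_code_nbhd // => /andP[nx /allP ch].
split=> // y yN y1; have yA : y \in A6 by move: yN; rewrite inE => /andP[].
have := ch _ (code_nbhd_in yA).
rewrite nbhd_compatE code_eq1 (negPf y1) (mem_code_nbhd _ xA) yN !orFb => /eqP E.
by apply/setP=> z; rewrite -(mem_code_nbhd z yA) -(mem_code_nbhd z xA) E.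
Qed.

Lemma nbhds_countP c : nbhds_count c = count (fun p => (p.1 != idp) && (size p.2 == c)) nbhds.
Proof. by []. Qed.

Opaque nbhds_count.

Lemma A6_nbhds_count c : #|[set x in A6^# | #|nbhd A6 x| == c]| = nbhds_count c.
Proof.
have nE : perm_eq [seq (code x, code_nbhd x) | x <- enum A6] nbhds.
  rewrite nbhdsE.
  have /(perm_map (fun a => (a, [seq q.1 | q <- tagged & linked (a, pows a) q]))) := perm_even_lists.
  by rewrite -map_comp.
rewrite nbhds_countP -(elimT seq.permP nE) count_map -sum1_card.
rewrite -sum1_count big_enum_cond; apply: eq_bigl => x.
by rewrite inE in_setD1 /=; case: (boolP (x \in A6)) => xA; rewrite ?andbF //= code_eq1 andbT size_code_nbhd.
Qed.

Lemma kappa_A6 : kappa A6 = (4 ^ 90 * 3 ^ 40 * 5 ^ 108)%N.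
Proof.
have eqN x y : x \in A6^# -> y \in nbhd A6 x -> y != 1 -> nbhd A6 y = nbhd A6 x.
  by move=> xA; apply: (A6_nbhds_check xA).2.
have [n3 n4 n5] := nbhds_countE.
pose tw c := #|[set x in twins A6 | #|nbhd A6 x| == c]|.
have twE a b c : nbhds_count c.+2 = a -> (a * c = b * c.+1)%N -> tw c.+2 = b.
  move=> na ab; apply/eqP; rewrite -(eqn_pmul2r (ltn0Sn c)) -ab -na.
  by rewrite /tw (card_twins_nbhd eqN) A6_nbhds_count.
(* By [card_twins_nbhd], the twins are half of 80, two thirds of 135 and three quarters of 144. *)
have tw3 := twE _ 40 1%N n3 (erefl _).
have tw4 := twE _ 90 2 n4 (erefl _).
have tw5 := twE _ 108 3 n5 (erefl _).
have sep c : (\prod_(x in twins A6 | #|nbhd A6 x| == c) #|nbhd A6 x| = c ^ tw c)%N.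
  rewrite -prod_nat_const; apply: eq_big => [x|x /andP[_ /eqP //]].
  by rewrite inE.
have : kappa A6 = (4 ^ tw 4 * 3 ^ tw 3 * 5 ^ tw 5)%N; last by rewrite tw3 tw4 tw5.
rewrite (kappa_partition eqN) -!sep -mulnA.
rewrite (bigID (fun x => #|nbhd A6 x| == 4)) /=; congr (_ * _)%N.
rewrite (bigID (fun x => #|nbhd A6 x| == 3)) /=; congr (_ * _)%N; apply: eq_bigl => x.
  by rewrite -andbA; case: (#|nbhd A6 x| =P 3) => [->|]; rewrite ?andbF.
rewrite -!andbA; apply: andb_id2l; rewrite inE => /andP[/A6_nbhds_check[+ _] _].
by rewrite !inE => /or3P[] /eqP->.
Qed.

End AlternatingSix.

(** * Weights of maximal cyclic subgroups *)

(** The totient is multiplicative: compare the parts at the least prime of [n] and recurse on the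
    remaining parts. *)
Lemma totient_dvd_leq d n : d %| n -> 0 < n -> totient d <= totient n.
Proof.
elim: {n}n.+1 {-2}n (ltnSn n) d => // m IHm n; rewrite ltnS => nm d dn n0.
have [n1|n1] := leqP n 1; first by rewrite (_ : d = n) //; case: n n1 n0 dn {nm} => [|[|]] // _ _; rewrite dvdn1 => /eqP.
have pp := pdiv_prime n1; set p := pdiv n in pp.
have d0 : 0 < d by apply: dvdn_gt0 dn.
have pn : p \in \pi(n) by rewrite mem_primes pp n0 pdiv_dvd.
rewrite -(partnC p d0) -(partnC p n0) !totient_coprime ?coprime_partC //.
apply: leq_mul; last first.
  apply: IHm; rewrite ?part_gt0 ?partn_dvd //; apply: leq_trans nm.
  rewrite -{2}(partnC p n0) ltn_Pmull ?part_gt0 // p_part_gt1 //.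
rewrite !p_part.
have := dvdn_leq_log p n0 dn; case: (logn p d) => [|a] ab.
  by rewrite expn0 -[totient 1]/1%N totient_gt0 expn_gt0 prime_gt0.
case: (logn p n) ab => // b; rewrite ltnS => ab.
by rewrite !totient_pfactor // leq_mul // leq_pexp2l // prime_gt0.
Qed.

Section Weights.
Variables (gT : finGroupType) (G : {group gT}).

Definition max_cycle (x : gT) : bool :=
  [forall y in G, (<[x]> \subset <[y]>) ==> (<[y]> \subset <[x]>)].

Definition max_cycles : {set {set gT}} := [set <[x]> | x in G^# & max_cycle x].

(** The [p]-adic valuation of the factor that a maximal cyclic subgroup [C] contributes to
    [kappa G]. *)
Definition cycle_weight p (C : {set gT}) : nat := ((totient #|C|).-1 * logn p #|C|)%N.

Lemma max_cycle_nbhd x : x \in G -> max_cycle x -> nbhd G x = <[x]>.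
Proof.
move=> xG /forall_inP mx; apply/setP=> y; rewrite inE !cycle_subG.
have sxG : <[x]> \subset G by rewrite cycle_subG.
apply/andP/idP=> [[yG]|yx].
  case/orP=> // xy; have := mx y yG; rewrite cycle_subG xy /=.
  by rewrite cycle_subG.
by rewrite (subsetP sxG) // yx orbT.
Qed.

Lemma max_cycle_exists x : x \in G -> x != 1 -> exists2 C, C \in max_cycles & x \in C.
Proof.
move=> xG x1.
pose P y := (y \in G) && (x \in <[y]>).
have P0 : P x by rewrite /P xG cycle_id.
have [y /andP[yG xy] ymax] := arg_maxnP (fun y => #[y]) P0.
exists <[y]> => //; apply/imsetP; exists y => //.
rewrite inE !in_setD1 yG andbT; apply/andP; split.
  by apply: contraNneq x1 => y1; move: xy; rewrite y1 cycle1 inE.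
apply/forall_inP=> z zG; apply/implyP=> yz.
have := ymax z; rewrite /P zG (subsetP yz) // => /(_ isT) zy.
by have /eqP-> : <[y]> == <[z]> by rewrite eqEcard yz.
Qed.

Lemma max_cyclesP C : C \in max_cycles ->
  exists x, [/\ x \in G^#, max_cycle x & C = <[x]>].
Proof. by case/imsetP=> x; rewrite inE => /andP[? ?] ->; exists x. Qed.

(** All generators of [C] have closed neighbourhood [C], so at most one of them, the representative,
    is missing from [twins G]. *)
Lemma card_max_cycle_twins C : C \in max_cycles ->
  (totient #|C|).-1 <= #|[set x in twins G | nbhd G x == C]|.
Proof.
case/max_cyclesP=> x [xG mx ->].
have xG' : x \in G by case/setD1P: xG.
have Nx := max_cycle_nbhd xG' mx.
rewrite [#|<[x]>|]/(#[x]) totient_gen.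
set A := [set y | generator <[x]> y].
rewrite -subn1 leq_subLR -{1}(cardsID [set twin_rep G x]) leq_add //.
  by rewrite -(cards1 (twin_rep G x)) subset_leq_card ?subsetIr.
apply/subset_leq_card/subsetP=> y; rewrite !inE => /andP[yt /eqP xy].
have yG : y \in G by rewrite -cycle_subG -xy cycle_subG.
have y1 : y != 1 by rewrite -cycle_eq1 -xy cycle_eq1; case/setD1P: xG.
have Ny : nbhd G y = <[x]>.
  rewrite xy; apply: max_cycle_nbhd => //.
  by apply/forall_inP=> z zG; rewrite -xy; apply: (forall_inP mx).
rewrite Ny y1 yG eqxx !andbT /=; apply: contra yt => /eqP {1}<-.
by rewrite (@eq_twin_rep _ G y x) ?Nx // !inE y1.
Qed.

Lemma kappa_gt0 : 0 < kappa G.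
Proof.
rewrite kappa_parent_funs card_gt0; apply/set0Pn; exists [ffun=> 1].
apply/parent_funsP; split=> v; last by apply: connect1; rewrite /= ffunE.
rewrite /parent_choice ffunE; case: ifP => // vG; rewrite group1 /power_adj.
by case/setD1P: vG => -> _; rewrite cycle1 sub1G orbT.
Qed.

(** A twin counted for [C] has neighbourhood [C], so distinct maximal cyclic subgroups use disjoint
    sets of factors of the divisor of [kappa G]. *)
Lemma sum_cycle_weight p :
  \sum_(C in max_cycles) cycle_weight p C <= logn p (kappa G).
Proof.
have P0 : 0 < \prod_(x in twins G) #|nbhd G x|.
  by apply: prodn_cond_gt0 => x _; apply/card_gt0P; exists 1; apply: nbhd_1.
apply: leq_trans (dvdn_leq_log p kappa_gt0 (prod_twins_dvd G)).
have -> : logn p (\prod_(x in twins G) #|nbhd G x|) = (\sum_(x in twins G) logn p #|nbhd G x|)%N.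
  have N0 x : 0 < #|nbhd G x| by apply/card_gt0P; exists 1; apply: nbhd_1.
  pose ok m s := (0 < m) && (logn p m == s).
  have : ok (\prod_(x in twins G) #|nbhd G x|)%N (\sum_(x in twins G) logn p #|nbhd G x|)%N.
    apply: (big_rec2 ok) => [|x m s _]; first by rewrite /ok logn1.
    by case/andP=> m0 /eqP <-; rewrite /ok muln_gt0 N0 m0 lognM ?eqxx.
  by case/andP=> _ /eqP.
rewrite (bigID (fun x => nbhd G x \in max_cycles)) /=; apply: leq_trans (_ : _ <= _) (leq_addr _ _).
rewrite (partition_big (nbhd G) (mem max_cycles)) /= => [|x /andP[] //].
apply: leq_sum => C CM.
rewrite (eq_bigr (fun=> logn p #|C|)) => [|x /andP[_ /eqP-> //]].
rewrite sum_nat_const leq_mul2r; apply/orP; right.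
apply: leq_trans (card_max_cycle_twins CM) _; apply/subset_leq_card/subsetP=> x.
by rewrite inE => /andP[xt /eqP Nx]; rewrite unfold_in /= xt Nx CM eqxx.
Qed.

Definition subgroup_weight p (D : {set gT}) : nat :=
  (\sum_(C in max_cycles | D \subset C) cycle_weight p C)%N.

Definition prime_subgroups p : {set {group gT}} :=
  [set D : {group gT} | (D \subset G) && (#|D| == p)].

(** A cyclic group has at most one subgroup of order [p], so no maximal cyclic subgroup is charged
    twice. *)
Lemma sum_subgroup_weight p :
  \sum_(D in prime_subgroups p) subgroup_weight p D <= logn p (kappa G).
Proof.
apply: leq_trans (sum_cycle_weight p).
rewrite (exchange_big_dep (mem max_cycles)) /= => [|D C _ /andP[] //].
apply: leq_sum => C /max_cyclesP[x [_ _ ->]].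
rewrite sum_nat_const -[X in _ <= X]mul1n leq_mul2r; apply/orP; right.
apply/card_le1_eqP => D E /andP[+ /andP[_ sD]] /andP[+ /andP[_ sE]].
rewrite !inE => /andP[_ /eqP cD] /andP[_ /eqP cE].
apply/esym/group_inj/eqP; rewrite (eq_subG_cyclic (cycle_cyclic x) sD sE).
by apply/eqP; rewrite cD cE.
Qed.

Lemma max_cycle_sup y : y \in G -> y != 1 -> exists2 C, C \in max_cycles & <[y]> \subset C.
Proof.
move=> yG y1; have [C CM yC] := max_cycle_exists yG y1; exists C => //.
by case/max_cyclesP: CM yC => x [_ _ ->]; rewrite cycle_subG.
Qed.

Lemma cycle_weight_mono p y C : C \in max_cycles -> <[y]> \subset C ->
  cycle_weight p <[y]> <= cycle_weight p C.
Proof.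
case/max_cyclesP=> x [_ _ ->] yx; have d := cardSg yx.
rewrite leq_mul ?dvdn_leq_log //; have := totient_dvd_leq d (order_gt0 x).
by case: (totient _) => // a; case: (totient _).
Qed.

Lemma leq_subgroup_weight p y (D : {set gT}) : y \in G -> y != 1 -> D \subset <[y]> ->
  cycle_weight p <[y]> <= subgroup_weight p D.
Proof.
move=> yG y1 Dy; have [C CM yC] := max_cycle_sup yG y1.
rewrite /subgroup_weight (bigD1 C) /= ?CM ?(subset_trans Dy) //.
exact: leq_trans (cycle_weight_mono p CM yC) (leq_addr _ _).
Qed.

End Weights.

(** * Simple groups acting on their subgroups *)

Section SimpleActions.
Variables (gT : finGroupType) (G : {group gT}).
Hypothesis simpleG : simple G.

Section PermRepresentation.
Variables (rT : finType) (to : {action gT &-> rT}) (m : nat) (e : 'I_m -> rT).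
Hypothesis e_inj : injective e.
Hypothesis e_stable : forall g i, g \in G -> exists j, e j = to (e i) g.

Lemma perm_representation : exists phi : {morphism G >-> {perm 'I_m}},
  forall g i, g \in G -> e (phi g i) = to (e i) g.
Proof.
(* Outside [G] the identity map is the default, which makes [f g] injective for every [g]. *)
pose f g i := if g \in G then odflt i [pick j | e j == to (e i) g] else i.
have fE g i : g \in G -> e (f g i) = to (e i) g.
  move=> gG; rewrite /f gG; case: pickP => [j /eqP //|no].
  by have [j /eqP] := e_stable i gG; rewrite no.
have f_inj g : injective (f g).
  case gG : (g \in G) => i j; last by rewrite /f gG.
  by move/(congr1 e); rewrite !fE // => /act_inj/e_inj.
have fM : {in G &, {morph (fun g => perm (@f_inj g)) : x y / x * y}}.
  move=> x y xG yG; apply/permP=> i; rewrite permM !permE; apply: e_inj.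
  by rewrite !fE ?groupM // actM.
by exists (Morphism fM) => g i gG; rewrite /= permE fE.
Qed.

Lemma faithful_perm_representation : (exists2 g, g \in G & exists i, to (e i) g != e i) ->
  exists2 phi : {morphism G >-> {perm 'I_m}}, 'injm phi &
    forall g i, g \in G -> e (phi g i) = to (e i) g.
Proof.
case=> g gG [i ne]; have [phi phiE] := perm_representation; exists phi => //.
have [_ /(_ _ (ker_normal phi))[-> //|kG]] := simpleP _ simpleG.
case/eqP: ne; rewrite -phiE // (_ : phi g = 1) ?perm1 //.
by apply: mker; rewrite kG.
Qed.
End PermRepresentation.

Definition conj_stable (S : {set {group gT}}) : Prop :=
  forall g D, g \in G -> D \in S -> (D :^ g)%G \in S.

Lemma simple_moves (D : {group gT}) : D \subset G -> D :!=: 1 -> D :!=: G ->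
  exists2 g, g \in G & (D :^ g)%G != D.
Proof.
move=> sDG D1 DG; have : ~~ (D <| G).
  apply/negP=> nD; have [_ /(_ _ nD)[E|E]] := simpleP _ simpleG.
    by rewrite E eqxx in D1.
  by rewrite E eqxx in DG.
rewrite /normal sDG /= => /subsetPn[g gG ng]; exists g => //.
by apply: contra ng => /eqP/(congr1 val)/= E; apply/normP.
Qed.

Lemma conj_stable_embedding (S : {set {group gT}}) (D : {group gT}) m :
    conj_stable S -> D \in S -> D \subset G -> D :!=: 1 -> D :!=: G -> #|S| = m ->
  exists2 phi : {morphism G >-> {perm 'I_m}}, 'injm phi &
  exists2 e : 'I_m -> {group gT}, injective e & (forall i, e i \in S) /\
    forall g i, g \in G -> e (phi g i) = (e i :^ g)%G.
Proof.
move=> cS DS sDG D1 DG Sm; subst m.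
pose e (i : 'I_#|S|) := enum_val i.
have eS i : e i \in S by apply: enum_valP.
have eK E : E \in S -> exists i, e i = E.
  by move=> ES; exists (enum_rank_in DS E); rewrite /e enum_rankK_in.
have st g i : g \in G -> exists j, e j = 'JG%act (e i) g.
  by move=> gG; apply/eK/cS.
have e_inj : injective e by apply: enum_val_inj.
have [|phi ip phiE] := faithful_perm_representation e_inj st.
  have [g gG ne] := simple_moves sDG D1 DG; exists g => //.
  by have [i Ei] := eK D DS; exists i; rewrite Ei.
by exists phi => //; exists e.
Qed.

(** By simplicity, [G] embeds in the symmetric group on [S]. This is the main source of lower bounds
    on numbers of subgroups. *)
Lemma conj_stable_fact (S : {set {group gT}}) (D : {group gT}) :
    conj_stable S -> D \in S -> D \subset G -> D :!=: 1 -> D :!=: G ->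
  #|G| %| (#|S|)`!.
Proof.
move=> cS DS sDG D1 DG.
have [phi ip _] := conj_stable_embedding cS DS sDG D1 DG (erefl _).
rewrite -(card_injm ip) // -card_Sn -[X in _ %| X]cardsT.
exact: cardSg (subsetT (phi @* G)).
Qed.

Definition conjugates (D : {group gT}) : {set {group gT}} := [set (D :^ g)%G | g in G].

Lemma conjugates_stable D : conj_stable (conjugates D).
Proof.
move=> g E gG /imsetP[h hG ->]; apply/imsetP; exists (h * g); rewrite ?groupM //.
by apply/val_inj; rewrite /= conjsgM.
Qed.

Lemma conjugates_id D : D \in conjugates D.
Proof. by apply/imsetP; exists 1 => //; apply/val_inj; rewrite /= conjsg1. Qed.

Lemma card_group_conjugates (D : {group gT}) : #|conjugates D| = #|G : 'N_G(D)|.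
Proof. by rewrite -astab1JG -card_orbit. Qed.

End SimpleActions.

Lemma logn_kappa_A6 p :
  logn p (kappa A6) = (90 * logn p 4 + 40 * logn p 3 + 108 * logn p 5)%N.
Proof.
have E a b c : logn p (4 ^ a * 3 ^ b * 5 ^ c) = (a * logn p 4 + b * logn p 3 + c * logn p 5)%N.
  by rewrite !lognM ?muln_gt0 ?expn_gt0 // !lognX.
by rewrite kappa_A6 E.
Qed.

(** Since 60 = 4 * 3 * 5, only [3 ^ k <= 4 ^ k] is needed. The exponents stay symbolic so that the
    huge powers are never evaluated; they become [m = 40] and [k = 20]. *)
Lemma expn60_ltn m k : (60 ^ (m + k) < 4 ^ (m + k + k.+1) * 3 ^ m * 5 ^ (m + k))%N.
Proof.
have -> : (60 ^ (m + k) = 4 ^ (m + k) * (3 ^ m * 3 ^ k) * 5 ^ (m + k))%N.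
  by rewrite -(expnD 3) -2!expnMn.
rewrite ltn_pmul2r ?expn_gt0 // (mulnC (3 ^ m)%N) mulnA ltn_pmul2r ?expn_gt0 //.
rewrite [(4 ^ (m + k + _))%N]expnD ltn_pmul2l ?expn_gt0 //.
apply: (@leq_ltn_trans (4 ^ k)%N); last by rewrite ltn_exp2l.
by case: k => // k; rewrite leq_exp2r.
Qed.

Lemma kappa_A6_gt : (60 ^ 60 < kappa A6)%N.
Proof.
rewrite kappa_A6; apply: leq_trans (expn60_ltn 40 20) _.
by apply: leq_mul; [apply: leq_mul; [apply: leq_pexp2l | apply: leqnn] | apply: leq_pexp2l].
Qed.

(** * The primes dividing the order *)

Section KappaFacts.
Variables (gT : finGroupType) (G : {group gT}).
Hypothesis simpleG : simple G.
Hypothesis kappaG : kappa G = kappa A6.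

(** The value 60 is what later forces the index of an embedded copy of [G] in [A6] below 6. *)
Lemma card_gt60 : 60 < #|G|.
Proof.
rewrite ltnNge; apply/negP=> le; have := kappa_A6_gt.
rewrite ltnNge -kappaG (leq_trans (kappa_leq G)) //.
apply: leq_trans (leq_pexp2l _ le) _ => //.
by rewrite leq_exp2r.
Qed.

(** For odd [p], a subgroup of order [p] has weight at least [p - 2 > 0], so [p] divides
    [kappa A6]. *)
Lemma pi_subset p : prime p -> p %| #|G| -> p \in [:: 2; 3; 5].
Proof.
move=> pp pG; have [x xG ox] := Cauchy pp pG.
have x1 : x != 1 by rewrite -order_gt1 ox prime_gt1.
have [p2|p2] := leqP p 2; first by rewrite !inE eqn_leq p2 prime_gt1.
have : 0 < logn p (kappa G).
  apply: leq_trans (sum_subgroup_weight G p).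
  have DP : <[x]>%G \in prime_subgroups G p by rewrite inE cycle_subG xG -ox /=.
  rewrite (bigD1 <[x]>%G) //=; apply: leq_trans (leq_addr _ _).
  apply: leq_trans (leq_subgroup_weight p xG x1 (subxx _)).
  rewrite /cycle_weight -[#|_|]/#[x] ox logn_prime // eqxx muln1.
  by rewrite totient_prime //; case: p p2 {pp pG ox DP} => [|[|[|p]]].
rewrite kappaG logn_kappa_A6 !inE.
case: (p =P 2) => [//|/eqP n2]; case: (p =P 3) => [//|/eqP n3]; case: (p =P 5) => [//|/eqP n5].
rewrite -[4]/(2 ^ 2)%N lognX !logn_prime //.
by rewrite (negPf n2) (negPf n3) (negPf n5).
Qed.

Lemma not_solvable : ~~ solvable G.
Proof.
apply/negP=> /(simple_sol_prime)/(_ simpleG) pG.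
have := pi_subset pG (dvdnn _); have := card_gt60.
by rewrite !inE => h /or3P[] /eqP E; rewrite E in h.
Qed.

Lemma primes_dvd p : p \in [:: 2; 3; 5] -> p %| #|G|.
Proof.
have sub : {subset primes #|G| <= [:: 2; 3; 5]}.
  by move=> q; rewrite mem_primes => /and3P[? _]; apply: pi_subset.
have sz : size [:: 2; 3; 5] <= size (primes #|G|).
  rewrite ltnNge; apply: contra not_solvable; exact: Burnside_p_a_q_b.
have [_ eqi] := uniq_min_size (primes_uniq _) sub sz.
by rewrite -eqi mem_primes => /and3P[].
Qed.

End KappaFacts.

Lemma sum_card_disjoint (I T : finType) (P : {pred I}) (F : I -> {set T}) (X : {set T}) :
    (forall i, i \in P -> F i \subset X) ->
    (forall i j x, i \in P -> j \in P -> x \in F i -> x \in F j -> i = j) ->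
  \sum_(i in P) #|F i| <= #|X|.
Proof.
move=> sFX dF; under eq_bigr do rewrite -sum1_card.
rewrite (exchange_big_dep (mem X)) /= => [|i x iP xF]; last exact: (subsetP (sFX i iP)).
rewrite -sum1_card; apply: leq_sum => x _; rewrite sum1_card.
apply/card_le1_eqP => i j /andP[iP xi] /andP[jP xj].
exact: esym (dF i j x iP jP xi xj).
Qed.

Section PrimeSubgroups.
Variables (gT : finGroupType).
Implicit Types (G A B D S T : {group gT}) (x y : gT) (p : nat).

Lemma prime_subgroup_gen D p : prime p -> #|D| = p -> exists2 x, #[x] = p & D = <[x]>%G.
Proof.
move=> pp oD; have /cyclicP[x Dx] : cyclic D by apply: prime_cyclic; rewrite oD.
by exists x; [rewrite -oD Dx | apply: val_inj].
Qed.

Lemma prime_subgroup_cycle D p x : prime p -> #|D| = p -> x \in D -> x != 1 -> D = <[x]>%G.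
Proof.
move=> pp oD xD x1; apply/val_inj/eqP; rewrite eq_sym eqEcard cycle_subG xD oD.
have n1 : #[x] != 1%N by rewrite order_eq1.
have dx : #[x] %| p by rewrite -oD order_dvdG.
by rewrite -(elimT (prime_nt_dvdP pp n1) dx) leqnn.
Qed.

Lemma card_prime_elements G p : prime p ->
  #|[set x in G | #[x] == p]| = (#|prime_subgroups G p| * p.-1)%N.
Proof.
move=> pp; rewrite -sum_nat_const -sum1_card.
rewrite (partition_big (fun x => <[x]>%G) (mem (prime_subgroups G p))) /= => [|x]; last first.
  by rewrite !inE cycle_subG => /andP[-> ->].
apply: eq_bigr => D; rewrite inE => /andP[sDG /eqP oD].
have <- : #|D :\ 1| = p.-1 by rewrite -oD (cardsD1 1 D) group1.
rewrite -sum1_card; apply: eq_bigl => x; rewrite !inE.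
apply/idP/idP=> [/andP[/andP[_ ox] /eqP <-]|/andP[x1 xD]].
  by rewrite cycle_id andbT -order_gt1 (eqP ox) prime_gt1.
have ox : #[x] = p.
  apply/prime_nt_dvdP=> //; first by rewrite order_eq1.
  by rewrite -oD order_dvdG.
rewrite (subsetP sDG) // ox eqxx /=; apply/eqP/val_inj/eqP => /=.
by rewrite eqEcard cycle_subG xD oD [#|<[x]>|]ox leqnn.
Qed.

(** The number of Sylow [p]-subgroups of [A <*> B] divides [#|A|] and is 1 modulo [p], hence is 1.
    So [A] normalizes [B], and the commutators lie in [A :&: B = 1]. *)
Lemma norm_prime_cent A B p : prime p -> #|B| = p -> ~~ (p %| #|A|) -> B \subset 'N(A) ->
  (forall d, d %| #|A| -> d %% p = 1%N -> d = 1%N) -> B \subset 'C(A).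
Proof.
move=> pp oB pA nAB divA.
have coAB : coprime #|A| #|B| by rewrite oB coprime_sym prime_coprime.
have tiAB : A :&: B = 1 := coprime_TIg coAB.
have sBK : B \subset A <*> B by apply: joing_subr.
have oK : #|A <*> B| = (#|A| * #|B|)%N by rewrite norm_joinEr // TI_cardMg.
have sylB : p.-Sylow(A <*> B) B.
  rewrite pHallE sBK oK oB /= partnM ?cardG_gt0 ?prime_gt0 //.
  by rewrite (@part_pnat_id p p) ?pnat_id // p_part lognE (negPf pA) !andbF expn0 mul1n.
have nB : A <*> B \subset 'N(B).
  have d1 : #|A <*> B : 'N_(A <*> B)(B)| = 1%N.
    apply: divA; last by rewrite -(card_Syl sylB) card_Syl_mod.
    have -> : #|A| = #|A <*> B : B| by rewrite -divgS // oK mulnK ?cardG_gt0.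
    by apply: indexgS; rewrite subsetI sBK normG.
  by move/eqP: d1; rewrite indexg_eq1 subsetI => /andP[].
apply/commG1P/trivgP; rewrite -tiAB setIC commg_subI // subsetI subxx //=.
by apply: subset_trans nB; apply: joing_subl.
Qed.

End PrimeSubgroups.

Section KappaLocal.
Variables (gT : finGroupType) (G : {group gT}).
Hypothesis simpleG : simple G.
Hypothesis kappaG : kappa G = kappa A6.
Implicit Types (D S T P : {group gT}) (p : nat).

Lemma logn_kappa : [/\ logn 2 (kappa G) = 180, logn 3 (kappa G) = 40 & logn 5 (kappa G) = 108]%N.
Proof. by rewrite kappaG !logn_kappa_A6. Qed.

Lemma pgroup_proper p D : p.-group D -> D :!=: G.
Proof.
move=> pD; apply: contraNneq (not_solvable simpleG kappaG) => <-.
exact: pgroup_sol pD.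
Qed.

Lemma stable_card_fact p D (S : {set {group gT}}) :
  p.-group D -> D \subset G -> D :!=: 1 -> D \in S -> conj_stable G S -> #|G| %| (#|S|)`!.
Proof.
by move=> pD sDG D1 DS cS; apply: (conj_stable_fact simpleG cS DS) => //; apply: pgroup_proper pD.
Qed.

(** Four conjugates or fewer would bound [#|G|] by 4! = 24. *)
Lemma card_conjugates_gt4 p D : p.-group D -> D \subset G -> D :!=: 1 -> 4 < #|conjugates G D|.
Proof.
move=> pD sDG D1.
have dv := stable_card_fact pD sDG D1 (conjugates_id G D) (@conjugates_stable _ G D).
rewrite ltnNge; apply/negP=> le4; have := card_gt60 kappaG.
rewrite ltnNge (leq_trans (dvdn_leq (fact_gt0 _) dv)) //.
by apply: leq_trans (leq_fact le4) _.
Qed.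

(** Each conjugate of [D] lies in the corresponding conjugate of [<[y]>], which has the same
    weight. *)
Lemma conjugates_weight p D y : #|D| = p -> prime p -> y \in G -> D \subset <[y]> ->
  #|conjugates G D| * cycle_weight p <[y]> <= logn p (kappa G).
Proof.
move=> oD pp yG Dy; apply: leq_trans (sum_subgroup_weight G p).
have y1 : y != 1.
  apply: contraTneq Dy => ->; rewrite cycle1 subG1 -cardG_gt1 oD.
  by rewrite prime_gt1.
rewrite (bigID (mem (conjugates G D))) /=; apply: leq_trans (leq_addr _ _).
rewrite (eq_bigl (mem (conjugates G D))); last first.
  move=> E /=; apply: andb_idl => /imsetP[g gG ->]; rewrite inE cardJg oD eqxx andbT.
  rewrite -(conjGid gG) conjSg (subset_trans Dy) // cycle_subG //.
rewrite -sum_nat_const; apply: leq_sum => E /imsetP[g gG ->].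
have -> : cycle_weight p <[y]> = cycle_weight p <[y ^ g]> by rewrite /cycle_weight cycleJ cardJg.
by apply: leq_subgroup_weight; rewrite ?groupJ ?conjg_eq1 // cycleJ conjSg.
Qed.

Lemma order_weight p y : prime p -> y \in G -> p %| #[y] ->
  exists D, [/\ #|D| = p, D \subset <[y]> &
    #|conjugates G D| * cycle_weight p <[y]> <= logn p (kappa G)].
Proof.
move=> pp yG py; have [x xy ox] := Cauchy pp py.
have sx : <[x]>%G \subset <[y]> by rewrite cycle_subG.
by exists <[x]>%G; split=> //; apply: conjugates_weight.
Qed.

Lemma order_weight_leq p y : prime p -> y \in G -> p %| #[y] ->
  5 * cycle_weight p <[y]> <= logn p (kappa G).
Proof.
move=> pp yG py; have [D [oD sD]] := order_weight pp yG py; apply: leq_trans.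
rewrite leq_mul2r; apply/orP; right; apply: (@card_conjugates_gt4 p).
- by rewrite /pgroup oD pnat_id.
- by apply: subset_trans sD _; rewrite cycle_subG.
by rewrite -cardG_gt1 oD prime_gt1.
Qed.

(** The weight at 3 would be (6 - 1) * 2 = 10, and five conjugates would need 50 > 40. *)
Lemma not_order9 y : y \in G -> #[y] != 9.
Proof.
move=> yG; apply/eqP=> oy; have := @order_weight_leq 3 y isT yG.
by case: logn_kappa => _ -> _; rewrite /cycle_weight -[#|<[y]>|]/#[y] oy => /(_ isT).
Qed.

(** The weight at 5 would be (20 - 1) * 2 = 38, and five conjugates would need 190 > 108. *)
Lemma not_order25 y : y \in G -> #[y] != 25.
Proof.
move=> yG; apply/eqP=> oy; have := @order_weight_leq 5 y isT yG.
by case: logn_kappa => _ _ ->; rewrite /cycle_weight -[#|<[y]>|]/#[y] oy => /(_ isT).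
Qed.

Lemma order_pgroup p x : prime p -> (forall y, y \in G -> #[y] != (p ^ 2)%N) -> x \in G ->
  p.-elt x -> x != 1 -> #[x] = p.
Proof.
move=> pp no2 xG px x1; have [k ok] := p_natP px.
case: k ok => [|[|k]] ok.
- by move: x1; rewrite -order_eq1 ok.
- by rewrite ok expn1.
have /eqP := no2 (x ^+ (p ^ k)) (groupX _ xG).
rewrite orderXdiv ok ?dvdn_exp2l ?(leq_trans (leqnSn k)) //.
by rewrite -expnB ?prime_gt0 ?(leq_trans (leqnSn k)) // !subSn ?subnn // -addn2 addKn.
Qed.

Lemma pgroup_sub_prime p S : prime p -> (forall y, y \in G -> #[y] != (p ^ 2)%N) ->
  p.-group S -> S \subset G -> S :\ 1 \subset [set x in G | #[x] == p].
Proof.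
move=> pp no2 pS sSG; apply/subsetP=> x /setD1P[x1 xS].
have xG := subsetP sSG x xS; rewrite inE xG; apply/eqP.
exact: order_pgroup (mem_p_elt pS xS) x1.
Qed.

End KappaLocal.

(** * Sylow 5-subgroups *)

Lemma not_25_dvd_fact n : n < 10 -> ~~ (25 %| n`!).
Proof.
move=> n10; rewrite (@pfactor_dvdn 5 2) ?fact_gt0 // -ltnNge.
by do 10![case: n n10 => [|n] n10; first by rewrite ?factS ?lognM ?muln_gt0 ?fact_gt0].
Qed.

Lemma card_setI_geq (T : finType) (A B X : {set T}) m n k :
  m <= #|A| -> n <= #|B| -> A \subset X -> B \subset X -> #|X| <= k ->
  m + n - k <= #|A :&: B|.
Proof.
move=> mA nB AX BX Xk; have UX : #|A :|: B| <= #|X| by rewrite subset_leq_card // subUset AX.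
by have := cardsUI A B; lia.
Qed.

Section SylowFive.
Variables (gT : finGroupType) (G : {group gT}).
Hypothesis simpleG : simple G.
Hypothesis kappaG : kappa G = kappa A6.
Implicit Types (D S T P : {group gT}) (p : nat).

Lemma card_prime_subgroups_leq p : prime p ->
  #|prime_subgroups G p| * p.-2 <= logn p (kappa G).
Proof.
move=> pp; apply: leq_trans (sum_subgroup_weight G p).
rewrite -sum_nat_const; apply: leq_sum => D; rewrite inE => /andP[sDG /eqP oD].
have [x ox ED] := prime_subgroup_gen pp oD; subst D; rewrite cycle_subG in sDG.
apply: leq_trans (leq_subgroup_weight p sDG _ (subxx _)); last by rewrite -order_gt1 ox prime_gt1.
by rewrite /cycle_weight oD totient_prime // logn_prime // eqxx muln1.
Qed.

Lemma card_order5 : #|[set x in G | #[x] == 5]| <= 144.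
Proof.
rewrite card_prime_elements //; have := @card_prime_subgroups_leq 5 isT.
by case: (logn_kappa kappaG) => _ _ ->; lia.
Qed.

Lemma sylow_moves p S : prime p -> p %| #|G| -> p.-Sylow(G) S ->
  exists2 S' : {group gT}, p.-Sylow(G) S' & S' != S.
Proof.
move=> pp pG sylS; have pS := pHall_pgroup sylS.
have S1 : S :!=: 1.
  rewrite -cardG_gt1 (card_Hall sylS) p_part_gt1 mem_primes pp pG cardG_gt0 //.
have [g gG ne] := simple_moves simpleG (pHall_sub sylS) S1 (pgroup_proper simpleG kappaG pS).
by exists (S :^ g)%G => //; rewrite pHallJ.
Qed.

Lemma sylow_setI_card p S S' k : prime p -> p.-Sylow(G) S -> p.-Sylow(G) S' -> S' != S ->
  #|S| = (p ^ k.+1)%N -> #|S :&: S'| %| p ^ k.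
Proof.
move=> pp sylS sylS' ne oS.
have /p_natP[j oj] : p.-nat #|S :&: S'| by apply: pgroupS (subsetIl _ _) (pHall_pgroup sylS).
rewrite oj dvdn_exp2l // -ltnS -(ltn_exp2l _ _ (prime_gt1 pp)) -oj -oS.
apply: proper_card; rewrite properEneq subsetIl andbT; apply: contra ne => /eqP/setIidPl sSS'.
apply/eqP/val_inj/eqP; rewrite eq_sym eqEcard sSS' /=.
by rewrite (card_Hall sylS) (card_Hall sylS').
Qed.

Lemma card_Syl_gt1 p : prime p -> p %| #|G| -> p < #|'Syl_p(G)|.
Proof.
move=> pp pG; have [S sylS] := Sylow_exists p G.
have [S' sylS' ne] := sylow_moves pp pG sylS.
have n2 : 1 < #|'Syl_p(G)|.
  by apply/card_gt1P; exists S; exists S'; rewrite !inE sylS sylS' eq_sym ne.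
have := card_Syl_mod G pp; rewrite ltnNge => nm; apply/negP=> np.
move: np; rewrite leq_eqVlt => /orP[/eqP E|lt].
  by rewrite E modnn in nm.
by rewrite modn_small // in nm; rewrite nm in n2.
Qed.

Let O5 := [set x in G | #[x] == 5].

Lemma order5_sub S : 5.-group S -> S \subset G -> S :\ 1 \subset O5.
Proof. exact: (@pgroup_sub_prime _ _ 5) isT (not_order25 simpleG kappaG). Qed.

Section Order25.
Hypothesis card_S : forall S, 5.-Sylow(G) S -> #|S| = 25.

Lemma sylow25_abelian S : 5.-Sylow(G) S -> abelian S.
Proof. by move=> sylS; apply: (@card_p2group_abelian _ 5) => //; rewrite card_S. Qed.

(** Otherwise each Sylow subgroup has 24 elements of order 5 of its own among at most 144. There
    would be exactly six of them, and 25 would divide 6!. *)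
Lemma sylow25_meet : exists S S' : {group gT},
  [/\ 5.-Sylow(G) S, 5.-Sylow(G) S', S' != S & S :&: S' != 1].
Proof.
case: (pickP (fun SS : {group gT} * {group gT} =>
  [&& 5.-Sylow(G) SS.1, 5.-Sylow(G) SS.2, SS.2 != SS.1 & SS.1 :&: SS.2 != 1])) => [[S S'] /and4P[]|no].
  by exists S, S'.
have ti S S' x : S \in 'Syl_5(G) -> S' \in 'Syl_5(G) -> x \in S :\ 1 -> x \in S' :\ 1 -> S = S'.
  rewrite !inE => sylS sylS' /andP[x1 xS] /andP[_ xS']; apply/eqP; rewrite eq_sym.
  have := no (S, S'); rewrite /= sylS sylS' /= => /negbT; rewrite negb_and !negbK.
  by case/orP=> // /eqP/setP/(_ x); rewrite !inE xS xS' (negPf x1).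
have sub S : S \in 'Syl_5(G) -> S :\ 1 \subset O5.
  by rewrite inE => sylS; apply: order5_sub (pHall_pgroup sylS) (pHall_sub sylS).
have := leq_trans (sum_card_disjoint sub ti) card_order5.
rewrite (eq_bigr (fun=> 24)) => [|S]; last first.
  by rewrite inE => /card_S oS; have := cardsD1 1 S; rewrite group1 oS => -[].
rewrite sum_nat_const => n6.
have n5 := card_Syl_gt1 (isT : prime 5) (@primes_dvd _ _ simpleG kappaG 5 isT).
have n : #|'Syl_5(G)| = 6 by lia.
have [S sylS] := Sylow_exists 5 G.
have S1 : S :!=: 1 by rewrite -cardG_gt1 card_S.
have := stable_card_fact simpleG kappaG (pHall_pgroup sylS) (pHall_sub sylS) S1.
move/(_ 'Syl_5(G)); rewrite inE sylS n => /(_ isT) dv.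
have {dv} : #|G| %| 6`!.
  apply: dv => g D gG; rewrite !inE => sylD.
  by rewrite pHallJ.
move/(dvdn_trans (cardSg (pHall_sub sylS))).
by rewrite card_S.
Qed.

(** [S] and [S'] are abelian, so ['C_G(D)] has at least two, hence at least six, Sylow 5-subgroups.
    They meet pairwise in [D], which gives 6 * 20 elements outside [D] and 4 inside. *)
Lemma card_order5_cent D S S' : #|D| = 5 -> D \subset G ->
    5.-Sylow(G) S -> 5.-Sylow(G) S' -> S' != S -> D \subset S -> D \subset S' ->
  124 <= #|O5 :&: 'C_G(D)|.
Proof.
move=> oD sDG sylS sylS' ne sDS sDS'.
have cent T : 5.-Sylow(G) T -> D \subset T -> T \subset 'C_G(D).
  move=> sylT sDT; rewrite subsetI (pHall_sub sylT) centsC.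
  exact: subset_trans sDT (sylow25_abelian sylT).
have sylC T : 5.-Sylow(G) T -> D \subset T -> 5.-Sylow('C_G(D)) T.
  by move=> sylT sDT; apply: pHall_subl (cent T sylT sDT) (subsetIl _ _) sylT.
have oT T : T \in 'Syl_5('C_G(D)) -> [/\ #|T| = 25, D \subset T & T \subset 'C_G(D)].
  rewrite inE => sylT; have [c cC ET] := Sylow_trans (sylC S sylS sDS) sylT.
  split; last exact: pHall_sub sylT.
    by rewrite ET cardJg card_S.
  rewrite ET -(conjSg _ _ c^-1) conjsgK; suff -> : D :^ c^-1 = D by [].
  by apply: normP; rewrite groupV; case/setIP: cC => _ /(subsetP (cent_sub D)).
have n6 : 5 < #|'Syl_5('C_G(D))|.
  have n2 : 1 < #|'Syl_5('C_G(D))|.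
    by apply/card_gt1P; exists S; exists S'; rewrite !inE !sylC // eq_sym ne.
  by move: n2 (card_Syl_mod 'C_G(D)%G (isT : prime 5)); move: #|'Syl_5('C_G(D))| => n; lia.
have sub T : T \in 'Syl_5('C_G(D)) -> T :\: D \subset (O5 :&: 'C_G(D)) :\: D.
  move=> TC; have [o25 sDT sTC] := oT T TC; apply/subsetP=> x /setDP[xT xD].
  have x1 : x != 1 by apply: contraNneq xD => ->.
  have pT : 5.-group T by rewrite /pgroup o25.
  rewrite inE xD inE (subsetP sTC) // andbT.
  apply: (subsetP (order5_sub pT (subset_trans sTC (subsetIl _ _)))).
  by rewrite !inE x1.
have ti T T' x : T \in 'Syl_5('C_G(D)) -> T' \in 'Syl_5('C_G(D)) ->
    x \in T :\: D -> x \in T' :\: D -> T = T'.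
  move=> TC T'C /setDP[xT xD] /setDP[xT' _].
  have [o sDT sTC] := oT T TC; have [o' sDT' sTC'] := oT T' T'C.
  have : #|T :&: T'| %| 25 by rewrite -o cardSg ?subsetIl.
  have : 5 < #|T :&: T'|.
    rewrite -oD; apply: proper_card; apply/properP; rewrite subsetI sDT sDT'; split=> //.
    by exists x; rewrite // inE xT.
  move=> gt5 d25; have o25 : #|T :&: T'| = 25.
    have : #|T :&: T'| \in divisors 25 by rewrite -dvdn_divisors.
    by rewrite !inE => /or3P[] /eqP E //; rewrite E in gt5.
  have ET : T :&: T' = T by apply/eqP; rewrite eqEcard subsetIl o25 o.
  have ET' : T :&: T' = T' by apply/eqP; rewrite eqEcard subsetIr o25 o'.
  by apply: val_inj; rewrite /= -ET ET'.
have := sum_card_disjoint sub ti.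
rewrite (eq_bigr (fun=> 20)) => [|T /oT[o25 sDT _]]; last first.
  by have := cardsID D T; rewrite (setIidPr sDT) o25 oD; lia.
rewrite sum_nat_const => le20.
have D4 : 4 <= #|(O5 :&: 'C_G(D)) :&: D|.
  have := cardsD1 1 D; rewrite group1 oD => -[->]; apply: subset_leq_card.
  have pD : 5.-group D by rewrite /pgroup oD.
  rewrite subsetI subsetDl andbT subsetI order5_sub //=.
  by apply: subset_trans (subsetDl _ _) (subset_trans sDS (cent S sylS sDS)).
by have := cardsID D (O5 :&: 'C_G(D)); lia.
Qed.

(* Two distinct commuting conjugates [D], [D'] of order 5 have centralizers that overlap in more
   than the 24 elements of order 5 of the central Sylow subgroup [D D'] of the overlap. *)
Lemma sylow25_contra : False.
Proof.
have [S [S' [sylS sylS' ne meet]]] := sylow25_meet.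
pose D := (S :&: S')%G.
have sDS : D \subset S by apply: subsetIl.
have sDS' : D \subset S' by apply: subsetIr.
have sDG : D \subset G := subset_trans sDS (pHall_sub sylS).
have pD : 5.-group D := pgroupS sDS (pHall_pgroup sylS).
have oD : #|D| = 5.
  have : #|D| %| 5 by apply: (@sylow_setI_card 5 S S' 1); rewrite ?card_S.
  have /negPf : #|D| != 1%N by rewrite -trivg_card1.
  by rewrite dvdn_divisors // !inE => -> /eqP.
have c10 : 10 <= #|conjugates G D|.
  have := stable_card_fact simpleG kappaG pD sDG meet (conjugates_id G D) (@conjugates_stable _ G D).
  move/(dvdn_trans (cardSg (pHall_sub sylS))); rewrite card_S // leqNgt => dv.
  by apply: contraL dv => /not_25_dvd_fact.
have oC := card_order5_cent oD sDG sylS sylS' ne sDS sDS'.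
have conjP E : E \in conjugates G D -> [/\ #|E| = 5, E \subset G & 5.-group E].
  case/imsetP=> g gG ->; rewrite /pgroup /= cardJg oD; split=> //.
  by rewrite -(conjGid gG) conjSg.
(* At most 144 - 124 = 20 elements of order 5 lie outside the centralizer, so at most five
   conjugates do; of at least ten conjugates, some other than [D] lies inside. *)
have [E EA /andP[sEC nED]] : exists2 E, E \in conjugates G D & (E \subset 'C_G(D)) && (E != D).
  pose I : {set {group gT}} := [set E : {group gT} | E \subset 'C_G(D)].
  have ti E F x : E \in conjugates G D :\: I ->
      F \in conjugates G D :\: I ->
      x \in E :\ 1 -> x \in F :\ 1 -> E = F.
    move=> /setDP[/conjP[oE _ _] _] /setDP[/conjP[oF _ _] _] /setD1P[x1 xE] /setD1P[_ xF].
    by rewrite (prime_subgroup_cycle _ oE xE x1) // (prime_subgroup_cycle _ oF xF x1).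
  have sub E : E \in conjugates G D :\: I ->
      E :\ 1 \subset O5 :\: 'C_G(D).
    case/setDP=> /conjP[oE sEG pE]; rewrite inE => nEC; apply/subsetP=> x xE.
    rewrite inE (subsetP (order5_sub pE sEG)) // andbT; apply: contra nEC => xC.
    by case/setD1P: xE => x1 xE; rewrite (prime_subgroup_cycle _ oE xE x1) // cycle_subG.
  have := sum_card_disjoint sub ti; rewrite (eq_bigr (fun=> 4)) => [|E /setDP[/conjP[oE _ _] _]]; last first.
    by have := cardsD1 1 E; rewrite group1 oE => -[].
  rewrite sum_nat_const => le4.
  have := cardsID 'C_G(D) O5; have := card_order5; rewrite -/O5 => c5 cI.
  have := cardsID I (conjugates G D).
  set X := _ :&: _ => cX; have : 1 < #|X| by move: le4 cI c5 cX oC c10; clear; lia.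
  case/card_gt1P=> E [F []]; rewrite !inE => /andP[EA sE] /andP[FA sF] EF.
  have [ED|ED] := eqVneq E D; last by exists E; rewrite ?sE.
  by exists F; rewrite // sF -ED eq_sym.
have [oE sEG pE] := conjP E EA.
have oC' : 124 <= #|O5 :&: 'C_G(E)|.
  case/imsetP: EA => g gG EE.
  apply: (@card_order5_cent E (S :^ g) (S' :^ g)); rewrite ?pHallJ //.
  - by apply: contra ne => /eqP/(congr1 val)/= /conjsg_inj E'; apply/eqP/val_inj.
  - by rewrite EE conjSg.
  by rewrite EE conjSg.
have sDC : D \subset 'C_G(D) by rewrite subsetI sDG; apply: abelianS sDS (sylow25_abelian sylS).
have sDE : D \subset 'C(E) by rewrite centsC; apply: subset_trans sEC (subsetIr _ _).
have sEE : E \subset 'C_G(E).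
  rewrite subsetI sEG; apply: cyclic_abelian; apply: prime_cyclic; by rewrite oE.
pose K := ('C_G(D) :&: 'C_G(E))%G; pose R := (D <*> E)%G.
have tiDE : D :&: E = 1.
  apply/eqP; rewrite trivg_card1; have : #|D :&: E| %| 5 by rewrite -oD cardSg ?subsetIl.
  rewrite dvdn_divisors // !inE => /orP[// | /eqP o5].
  case/negP: nED; apply/eqP/val_inj/eqP; rewrite /= eq_sym eqEcard oE oD leqnn andbT.
  by apply/setIidPl/eqP; rewrite eqEcard subsetIl o5 oD.
have oR : #|R| = 25.
  rewrite /= norm_joinEr; last exact: subset_trans (subset_trans sEC (subsetIr _ _)) (cent_sub _).
  by rewrite TI_cardMg // oD oE.
have sRK : R \subset K.
  have sDE' : D \subset 'C_G(E) by rewrite subsetI sDG.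
  rewrite join_subG; apply/andP; split; rewrite subsetI; first by rewrite sDC sDE'.
  by rewrite sEC sEE.
have cKR : K \subset 'C(R).
  by rewrite centY subsetI; apply/andP; split; [apply: subset_trans (subsetIl _ _) (subsetIr _ _)
    | apply: subset_trans (subsetIr _ _) (subsetIr _ _)].
have sKG : K \subset G by apply: subset_trans (subsetIl _ _) (subsetIl _ _).
have sylR : 5.-Sylow(K) R.
  apply: (pHall_subl sRK sKG).
  by rewrite pHallE (subset_trans sRK sKG) oR -(card_Hall sylS) card_S.
have nR : R <| K by rewrite /normal sRK (subset_trans cKR) ?cent_sub.
have sub : O5 :&: K \subset R :\ 1.
  apply/subsetP=> x /setIP[]; rewrite inE => /andP[xG /eqP ox] xK.
  rewrite in_setD1 -order_gt1 ox /= (mem_normal_Hall sylR) //.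
  by rewrite /p_elt ox.
have cR : #|R :\ 1| = 24 by have := cardsD1 1 R; rewrite group1 oR add1n => -[->].
(* The two centralizers share at least 124 + 124 - 144 = 104 elements of order 5, more than 24. *)
have := subset_leq_card sub; rewrite {}cR.
have -> : O5 :&: K = (O5 :&: 'C_G(D)) :&: (O5 :&: 'C_G(E)) by rewrite setIACA setIid.
apply/negP; rewrite -ltnNge; apply: leq_trans (card_setI_geq oC oC' _ _ card_order5) => //.
  exact: subsetIl.
exact: subsetIl.
Qed.

End Order25.
End SylowFive.

(** * The number of Sylow 5-subgroups *)

Section SylowFiveCount.
Variables (gT : finGroupType) (G : {group gT}).
Hypothesis simpleG : simple G.
Hypothesis kappaG : kappa G = kappa A6.
Implicit Types (D S T P : {group gT}) (p : nat).

Lemma card_sylow5 S : 5.-Sylow(G) S -> #|S| = 5.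
Proof.
move=> sylS; have /p_natP[k ok] : 5.-nat #|S| := pHall_pgroup sylS.
have card_all T : 5.-Sylow(G) T -> #|T| = (5 ^ k)%N.
  by move=> sylT; rewrite (card_Hall sylT) -(card_Hall sylS).
have sub T : 5.-Sylow(G) T -> T :\ 1 \subset [set x in G | #[x] == 5].
  by move=> sylT; apply: order5_sub => //; [apply: pHall_pgroup sylT | apply: pHall_sub sylT].
have le144 : #|S :\ 1| <= 144 by apply: leq_trans (subset_leq_card (sub S sylS)) (card_order5 simpleG kappaG).
have oS := cardsD1 1 S; rewrite group1 ok add1n in oS.
have [S' sylS' ne] := @sylow_moves _ G simpleG kappaG 5 S isT (@primes_dvd _ G simpleG kappaG 5 isT) sylS.
case: k ok card_all oS => [|[|[|[|k]]]] ok card_all oS //.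
- have : 1 < #|S|; last by rewrite ok.
  by rewrite (card_Hall sylS) p_part_gt1 mem_primes cardG_gt0 (@primes_dvd _ G simpleG kappaG 5).
- by case: (sylow25_contra simpleG kappaG card_all).
- have := @dvdn_leq _ (5 ^ 2) isT (sylow_setI_card (isT : prime 5) sylS sylS' ne ok).
  have : #|(S :|: S')| <= 145.
    rewrite (cardsD1 1) inE group1 orTb add1n ltnS.
    apply: leq_trans (card_order5 simpleG kappaG); apply: subset_leq_card.
    by rewrite setDUl subUset !sub.
  move=> le1 le2; have := cardsUI S S'; rewrite ok (card_all _ sylS') => /eqP; rewrite eqn_leq => /andP[_].
  by rewrite leqNgt (leq_ltn_trans (leq_add le1 le2)).
have : 5 ^ 4 <= 5 ^ k.+4 by rewrite leq_exp2l.
by rewrite oS leqNgt (leq_ltn_trans (_ : _ <= 145)).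
Qed.

Lemma Syl5E : 'Syl_5(G) = prime_subgroups G 5.
Proof.
apply/setP=> S; rewrite !inE; apply/idP/andP=> [sylS|[sSG /eqP oS]].
  by rewrite (pHall_sub sylS) card_sylow5.
have [T sylT] := Sylow_exists 5 G.
by rewrite pHallE sSG oS -(card_Hall sylT) card_sylow5.
Qed.

Lemma card_Syl5 : #|'Syl_5(G)| \in [:: 6; 16; 36].
Proof.
have le36 : #|'Syl_5(G)| <= 36.
  have := card_prime_subgroups_leq G (isT : prime 5); rewrite -Syl5E.
  by case: (logn_kappa kappaG) => _ _ ->; rewrite -[108]/(36 * 3)%N leq_pmul2r.
have gt5 := @card_Syl_gt1 _ G simpleG kappaG 5 isT (@primes_dvd _ G simpleG kappaG 5 isT).
have nmod := card_Syl_mod G (isT : prime 5).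
have ndvd q : prime q -> q %| #|'Syl_5(G)| -> q \in [:: 2; 3; 5].
  by move=> pq qn; apply: (pi_subset kappaG) => //; apply: dvdn_trans qn (card_Syl_dvd _ _).
move: #|'Syl_5(G)| le36 gt5 nmod ndvd => n le36 gt5 nmod ndvd.
have : n \in [:: 6; 11; 16; 21; 26; 31; 36] by rewrite !inE; lia.
rewrite !inE => /or4P[/eqP->|/eqP E|/eqP->|/or4P[/eqP E|/eqP E|/eqP E|/eqP->]] //; subst n.
- by have := ndvd 11 isT isT.
- by have := ndvd 7 isT isT.
- by have := ndvd 13 isT isT.
by have := ndvd 31 isT isT.
Qed.

(** The weight at 5 of a cyclic group of order 15 is 7, and 16 * 7 = 112 > 108. *)
Lemma not_order15 x : #|'Syl_5(G)| != 6 -> x \in G -> #[x] != 15.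
Proof.
move=> n6 xG; apply/eqP=> ox; have := card_Syl5; rewrite inE (negPf n6) orFb => n16.
have p5 : 5 %| #[x] by rewrite ox.
have [D [oD sDx]] := order_weight (isT : prime 5) xG p5.
have sDG : D \subset G by apply: subset_trans sDx _; rewrite cycle_subG.
have sylD : 5.-Sylow(G) D by move/setP/(_ D): Syl5E; rewrite !inE sDG oD => ->.
rewrite card_group_conjugates -(card_Syl sylD) /cycle_weight -[#|<[x]>|]/#[x] ox.
case: (logn_kappa kappaG) => _ _ ->.
by move: n16; rewrite !inE => /orP[/eqP-> | /eqP->].
Qed.

Lemma no_commuting_3_5 x y : #|'Syl_5(G)| != 6 -> x \in G -> y \in G ->
  #[x] = 3 -> #[y] = 5 -> ~ commute x y.
Proof.
move=> n6 xG yG ox oy cxy; have := not_order15 n6 (groupM xG yG).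
by rewrite orderM ?ox ?oy.
Qed.

(** Since 5 is not 1 modulo 3, an element of order 3 normalizing [P] centralizes it, giving an
    element of order 15. *)
Lemma sylow5_norm3 P : #|'Syl_5(G)| != 6 -> 5.-Sylow(G) P -> ~~ (3 %| #|'N_G(P)|).
Proof.
move=> n6 sylP; have oP := card_sylow5 sylP.
apply/negP=> /(Cauchy (isT : prime 3))[x /setIP[xG xN] ox].
have [y oy EP] := prime_subgroup_gen (isT : prime 5) oP.
have : <[x]>%G \subset 'C(P).
  apply: (@norm_prime_cent _ _ _ 3); rewrite ?oP ?cycle_subG //.
  by move=> d; rewrite dvdn_divisors // !inE => /orP[] /eqP->.
rewrite EP cent_cycle cycle_subG => /cent1P cxy.
apply: (no_commuting_3_5 n6 xG _ ox oy) => //.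
by rewrite -cycle_subG -[<[y]>]/(gval <[y]>%G) -EP (pHall_sub sylP).
Qed.

(** With 16 Sylow subgroups, 3 would divide neither their number nor the order of a normalizer,
    hence not [#|G|]. *)
Lemma card_Syl5_36 : #|'Syl_5(G)| != 6 -> #|'Syl_5(G)| = 36.
Proof.
move=> n6; have := card_Syl5; rewrite inE (negPf n6) orFb !inE => /orP[/eqP n16|/eqP //].
have [P sylP] := Sylow_exists 5 G.
have := sylow5_norm3 n6 sylP; have := @primes_dvd _ G simpleG kappaG 3 isT.
rewrite -(Lagrange (subsetIl G 'N(P))) -(card_Syl sylP) n16 Euclid_dvdM // orbF.
by move=> ->.
Qed.

End SylowFiveCount.

(** * The case of six Sylow 5-subgroups *)

Section SixPoints.
Variables (gT : finGroupType) (G : {group gT}).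
Hypothesis simpleG : simple G.
Hypothesis kappaG : kappa G = kappa A6.

Lemma simple_A6 : simple A6.
Proof. by apply: simple_Alt5; rewrite card_ord. Qed.

Lemma card_A6 : #|A6| = 360.
Proof.
have := card_Alt (T := 'I_6); rewrite card_ord => /(_ isT).
by rewrite -[6`!]/(2 * 360)%N => /eqP; rewrite eqn_pmul2l // => /eqP.
Qed.

(** The alternating group has index at most 2, so a subgroup meeting it trivially has order at most
    2. *)
Lemma simple_perm_even n (H : {group {perm 'I_n}}) : simple H -> 2 < #|H| -> H \subset 'Alt_('I_n).
Proof.
move=> simpleH H2; have nHA : H :&: 'Alt_('I_n) <| H.
  by apply: normalGI (subsetT _) (Alt_normal _).
have [_ /(_ _ nHA)[ti|/setIidPl //]] := simpleP _ simpleH.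
suff : #|H| <= 2 by rewrite leqNgt H2.
have [n2|n1] := leqP 2 n; last first.
  apply: leq_trans (max_card _) _; rewrite card_Sn.
  by case: n n1 {H simpleH H2 nHA ti} => [|[|n]].
have : #|H * 'Alt_('I_n)| <= n`! by rewrite -card_Sn max_card.
have := card_Alt (T := 'I_n); rewrite card_ord => /(_ n2) <-.
by rewrite TI_cardMg // leq_pmul2r ?cardG_gt0.
Qed.

(** A proper image in [A6] has order above 60, hence index below 6; simplicity of [A6] would then
    make 360 divide a factorial not exceeding 5!. *)
Lemma isog_A6_of_6 : #|'Syl_5(G)| = 6 -> G \isog A6.
Proof.
move=> n6; have [P sylP] := Sylow_exists 5 G.
have oP := card_sylow5 simpleG kappaG sylP.
have sP : P \in 'Syl_5(G) by rewrite inE.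
have P1 : P :!=: 1 by rewrite -cardG_gt1 oP.
have cS : conj_stable G 'Syl_5(G) by move=> g D gG; rewrite !inE => sylD; rewrite pHallJ.
have PG := pgroup_proper simpleG kappaG (pHall_pgroup sylP).
have [phi ip _] := conj_stable_embedding simpleG cS sP (pHall_sub sylP) P1 PG n6.
have isoH : G \isog phi @* G by apply: sub_isog.
have simpleH : simple (phi @* G) by rewrite -(isog_simple isoH).
have oH : #|phi @* G| = #|G| := card_injm ip (subxx _).
have gt60 := card_gt60 kappaG.
have sHA : phi @* G \subset A6 by apply: simple_perm_even simpleH _; rewrite oH (ltn_trans _ gt60).
suff <- : phi @* G = A6 by [].
apply/eqP; rewrite eqEsubset sHA; apply/negPn/negP=> nAH.
have HA : phi @* G != A6 by apply: contraNneq nAH => ->; rewrite subxx.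
have H1 : phi @* G != 1 by rewrite -cardG_gt1 oH (ltn_trans _ gt60).
have := conj_stable_fact simple_A6 (@conjugates_stable _ A6 (phi @* G)%G)
  (conjugates_id A6 (phi @* G)%G) sHA H1 HA.
rewrite card_group_conjugates card_A6.
have le : #|A6 : 'N_A6(phi @* G)| * #|G| <= 360.
  rewrite -card_A6 -(Lagrange sHA) oH mulnC leq_mul2l; apply/orP; right.
  by apply/dvdn_leq/indexgS; rewrite // subsetI sHA normG.
have lt6 : #|A6 : 'N_A6(phi @* G)| < 6.
  by rewrite ltnNge; apply/negP=> ge6; have := leq_trans (leq_mul ge6 gt60) le.
rewrite ltnS in lt6 => dv.
by have := leq_trans (dvdn_leq (fact_gt0 _) dv) (leq_fact lt6).
Qed.
End SixPoints.

(** * Sylow 3-subgroups *)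

Section SylowThree.
Variables (gT : finGroupType) (G : {group gT}).
Hypothesis simpleG : simple G.
Hypothesis kappaG : kappa G = kappa A6.
Hypothesis n5_neq6 : #|'Syl_5(G)| != 6.
Implicit Types (A D S T P : {group gT}) (p : nat).

Lemma card_G_norm P : 5.-Sylow(G) P -> #|G| = (36 * #|'N_G(P)|)%N.
Proof.
move=> sylP; rewrite -(Lagrange (subsetIl G 'N(P))) -(card_Syl sylP) mulnC.
by rewrite (card_Syl5_36 simpleG kappaG n5_neq6).
Qed.

Lemma dvd4_G : 4 %| #|G|.
Proof. by have [P /card_G_norm->] := Sylow_exists 5 G; rewrite dvdn_mulr. Qed.

(** The factor 36 supplies the whole 3-part, as 3 does not divide the order of the normalizer. *)
Lemma logn3_G : logn 3 #|G| = 2.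
Proof.
have [P sylP] := Sylow_exists 5 G; rewrite (card_G_norm sylP) lognM ?cardG_gt0 //.
by rewrite [logn 3 #|_|]lognE (negPf (sylow5_norm3 simpleG kappaG n5_neq6 sylP)) !andbF.
Qed.

Lemma logn5_G : logn 5 #|G| = 1%N.
Proof.
have [P sylP] := Sylow_exists 5 G; have := card_Hall sylP.
rewrite (card_sylow5 simpleG kappaG sylP) p_part; case: (logn _ _) => [|[|k]] //.
by move=> E; have := @ltn_exp2l 5 1 k.+2 isT; rewrite -E.
Qed.

Lemma card_sylow3 T : 3.-Sylow(G) T -> #|T| = 9.
Proof. by move/card_Hall->; rewrite p_part logn3_G. Qed.

Lemma sylow3_abelian T : 3.-Sylow(G) T -> abelian T.
Proof. by move=> sylT; apply: (@card_p2group_abelian _ 3) => //; rewrite card_sylow3. Qed.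

Let O3 := [set x in G | #[x] == 3].

Lemma order3_sub T : 3.-group T -> T \subset G -> T :\ 1 \subset O3.
Proof. exact: (@pgroup_sub_prime _ _ 3) isT (not_order9 simpleG kappaG). Qed.

Lemma card_prime3 : #|prime_subgroups G 3| <= 40.
Proof.
have := card_prime_subgroups_leq G (isT : prime 3).
by case: (logn_kappa kappaG) => _ -> _; rewrite muln1.
Qed.

Lemma card_order3 : #|O3| <= 80.
Proof. by rewrite card_prime_elements // -[80]/(40 * 2)%N leq_pmul2r // card_prime3. Qed.

(** The order of [A] divides 9, none of whose divisors above 1 is 1 modulo 5; so [P] would
    centralize [A] and an element of order 5 would commute with one of order 3. *)
Lemma sylow5_not_norm A P : 5.-Sylow(G) P -> A \subset G -> 3.-group A -> A :!=: 1 -> ~~ (P \subset 'N(A)).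
Proof.
move=> sylP sAG pA A1; have oP := card_sylow5 simpleG kappaG sylP.
have dA : #|A| %| 9.
  have := cardSg sAG; have /p_natP[k ok] : 3.-nat #|A| := pA.
  by rewrite ok pfactor_dvdn ?cardG_gt0 // logn3_G => k2; rewrite (@dvdn_exp2l 3 k 2).
apply/negP=> nPA; have : P \subset 'C(A).
  apply: (norm_prime_cent (isT : prime 5) oP) => //.
    by apply/negP=> d5; have := dvdn_trans d5 dA.
  move=> d dvd; have := dvdn_trans dvd dA.
  by rewrite (dvdn_divisors _ (isT : 0 < 9)) !inE => /or3P[] /eqP->.
have [x xA x1] := trivgPn _ A1.
have := subsetP (order3_sub pA sAG) x; rewrite in_setD1 x1 xA inE => /(_ isT)/andP[xG /eqP ox].
have [y oy EP] := prime_subgroup_gen (isT : prime 5) oP.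
have yP : y \in P by rewrite EP /= cycle_id.
move/subsetP/(_ y yP)/centP/(_ x xA) => cyx.
have yG := subsetP (pHall_sub sylP) y yP.
exact: (no_commuting_3_5 simpleG kappaG n5_neq6 xG yG ox oy (esym cyx)).
Qed.

(** A Sylow 5-subgroup acts on [S] without fixed points. *)
Lemma dvd5_stable (S : {set {group gT}}) : conj_stable G S ->
  (forall A, A \in S -> [/\ A \subset G, 3.-group A & A :!=: 1]) -> 5 %| #|S|.
Proof.
move=> cS S3; have [P sylP] := Sylow_exists 5 G.
have sPG := pHall_sub sylP.
have actsP : [acts P, on S | 'JG].
  by apply/subsetP=> x xP; rewrite !inE; apply/subsetP=> A AS; rewrite inE cS // (subsetP sPG).
have := pgroup_fix_mod (pHall_pgroup sylP) actsP.
rewrite (_ : 'Fix_(S | 'JG)(P) = set0) ?cards0 ?mod0n; first by move/eqP.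
apply/setP=> A; rewrite in_setI in_set0 afixJG; apply/negP=> /andP[/S3[sAG pA A1]].
exact/negP/sylow5_not_norm.
Qed.

Definition sylow_over D : {set {group gT}} := [set T in 'Syl_3(G) | D \subset T].

Lemma conj_stable_Syl p : conj_stable G 'Syl_p(G).
Proof. by move=> g D gG; rewrite !inE => sylD; rewrite pHallJ. Qed.

Lemma dvd5_Syl3 : 5 %| #|'Syl_3(G)|.
Proof.
apply: dvd5_stable (@conj_stable_Syl 3) _ => T; rewrite inE => sylT.
by rewrite (pHall_sub sylT) (pHall_pgroup sylT) -cardG_gt1 card_sylow3.
Qed.

Lemma prime_subgroup3P D : D \in prime_subgroups G 3 ->
  [/\ D \subset G, #|D| = 3, 3.-group D & D :!=: 1].
Proof. by rewrite inE -cardG_gt1 /pgroup => /andP[sDG /eqP oD]; rewrite sDG oD. Qed.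

Lemma not_5_dvd_cent D : D \in prime_subgroups G 3 -> ~~ (5 %| #|'C_G(D)|).
Proof.
case/prime_subgroup3P=> sDG oD _ _; apply/negP=> /(Cauchy (isT : prime 5))[y /setIP[yG yC] oy].
have [x ox ED] := prime_subgroup_gen (isT : prime 3) oD.
have xG : x \in G by rewrite -cycle_subG -[<[x]>]/(gval <[x]>%G) -ED.
apply: (no_commuting_3_5 simpleG kappaG n5_neq6 xG yG ox oy).
by apply/esym/(centP yC); rewrite ED /= cycle_id.
Qed.

(** Sylow 3-subgroups are abelian, so those above [D] centralize it; conversely, conjugation inside
    ['C_G(D)] fixes [D], so all Sylow 3-subgroups of the centralizer contain it. *)
Lemma Syl_cent_over D : D \in prime_subgroups G 3 -> 'Syl_3('C_G(D)) = sylow_over D.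
Proof.
case/prime_subgroup3P=> sDG oD pD _.
have sylC T : 3.-Sylow(G) T -> D \subset T -> 3.-Sylow('C_G(D)) T.
  move=> sylT sDT; apply: (pHall_subl _ (subsetIl _ _) sylT).
  rewrite subsetI (pHall_sub sylT) centsC.
  exact: subset_trans sDT (sylow3_abelian sylT).
have [S sylS sDS] := Sylow_superset sDG pD.
apply/setP=> T; rewrite !inE; apply/idP/andP=> [sylT|[]]; last exact: sylC.
have [c /setIP[cG cC] ET] := Sylow_trans (sylC S sylS sDS) sylT.
rewrite ET pHallJ //; split=> //.
suff <- : D :^ c = D by rewrite conjSg.
by apply: normP; apply: (subsetP (cent_sub D)).
Qed.

Lemma sylow_over_disjoint D T T' x : #|D| = 3 -> T \in sylow_over D -> T' \in sylow_over D ->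
  x \in T :\: D -> x \in T' :\: D -> T = T'.
Proof.
rewrite !inE => oD /andP[sylT sDT] /andP[sylT' sDT'] /andP[xD xT] /andP[_ xT'].
apply/eqP; rewrite eq_sym; apply/negPn/negP=> ne.
have := @sylow_setI_card _ _ 3 T T' 1 isT sylT sylT' ne (card_sylow3 sylT).
rewrite expn1 -oD => /(dvdn_leq (cardG_gt0 D)); rewrite leqNgt => /negP[].
apply: proper_card; apply/properP; rewrite subsetI sDT sDT'; split=> //.
by exists x; rewrite // inE xT.
Qed.

(** Each such Sylow subgroup has six elements of order 3 of its own outside [D], so their number [n]
    satisfies 6n + 2 <= 80. It is 1 modulo 3, prime to 5, and has no prime factor above 5, which
    removes 7, 10 and 13. *)
Lemma card_sylow_over D : D \in prime_subgroups G 3 -> #|sylow_over D| \in [:: 1%N; 4].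
Proof.
move=> DP; have [sDG oD pD _] := prime_subgroup3P DP.
have sub T : T \in sylow_over D -> T :\: D \subset O3 :\: D.
  rewrite !inE => /andP[sylT sDT]; apply/subsetP=> x /setDP[xT xD].
  rewrite in_setD xD (subsetP (order3_sub (pHall_pgroup sylT) (pHall_sub sylT))) //.
  by rewrite !inE xT andbT; apply: contraNneq xD => ->.
have ti T T' x : T \in sylow_over D -> T' \in sylow_over D -> x \in T :\: D -> x \in T' :\: D -> T = T'.
  exact: sylow_over_disjoint.
have := sum_card_disjoint sub ti.
rewrite (eq_bigr (fun=> 6)) => [|T]; last first.
  rewrite inE inE => /andP[sylT sDT]; have := cardsID D T.
  rewrite (setIidPr sDT) oD (card_sylow3 sylT) => /eqP.
  by rewrite -[9]/(3 + 6)%N eqn_add2l => /eqP.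
rewrite sum_nat_const => le6.
have D2 : 2 <= #|O3 :&: D|.
  have := cardsD1 1 D; rewrite group1 oD add1n => -[->]; apply: subset_leq_card.
  by rewrite subsetI subsetDl andbT order3_sub.
have le13 : #|sylow_over D| <= 13.
  rewrite -(@leq_pmul2r 6) //; apply: leq_trans le6 _.
  rewrite -(@leq_add2l 2); apply: leq_trans (leq_add D2 (leqnn _)) _.
  by rewrite cardsID; apply: card_order3.
have := card_Syl_mod 'C_G(D)%G (isT : prime 3).
have dC := card_Syl_dvd 3 'C_G(D)%G; have n5 := not_5_dvd_cent DP.
have ndvd q : prime q -> q %| #|'Syl_3('C_G(D))| -> q \in [:: 2; 3; 5].
  move=> pq qn; apply: (pi_subset kappaG) => //; apply: dvdn_trans qn _.
  by apply: dvdn_trans dC (cardSg (subsetIl _ _)).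
have {dC n5} n5 : ~~ (5 %| #|'Syl_3('C_G(D))|) by apply: contra n5 => n5; apply: dvdn_trans n5 dC.
move: ndvd n5; rewrite (Syl_cent_over DP); move: #|_| le13 => n; clear.
move=> le13 ndvd n5 nmod.
have : n \in [:: 1%N; 4; 7; 10; 13] by rewrite !inE; lia.
rewrite !inE => /or4P[->|->|/eqP E|/orP[/eqP E|/eqP E]]; rewrite ?orbT //; subst n.
- by have := ndvd 7 isT isT.
- by [].
by have := ndvd 13 isT isT.
Qed.

(** Count incident pairs: a Sylow 3-subgroup has eight elements of order 3, hence four subgroups of
    order 3. *)
Lemma sum_sylow_over :
  (\sum_(D in prime_subgroups G 3) #|sylow_over D| = 4 * #|'Syl_3(G)|)%N.
Proof.
under eq_bigr do rewrite -sum1_card.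
rewrite (exchange_big_dep (mem 'Syl_3(G))) /= => [|D T _]; last by rewrite inE => /andP[].
rewrite mulnC -sum_nat_const; apply: eq_bigr => T; rewrite inE => sylT.
rewrite sum1_card; apply/eqP; rewrite -(@eqn_pmul2r 2) //.
have -> : #|[pred D | (D \in prime_subgroups G 3) && (T \in sylow_over D)]| = #|prime_subgroups T 3|.
  apply: eq_card => D; rewrite !inE sylT andbC andbA /=; apply: andb_id2r => _.
  by apply: andb_idr => sDT; apply: subset_trans sDT (pHall_sub sylT).
rewrite -[2]/(3.-1) -card_prime_elements //.
have := cardsD1 1 T; rewrite group1 (card_sylow3 sylT) add1n => -[c8].
rewrite -[(4 * _)%N]/8 c8; apply/eqP/eq_card=> x; rewrite !inE.
apply/andP/andP=> [[xT /eqP ox]|[x1 xT]]; first by rewrite -order_gt1 ox.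
have := subsetP (order3_sub (pHall_pgroup sylT) (pHall_sub sylT)) x.
by rewrite !inE x1 xT => /(_ isT)/andP[].
Qed.

Lemma card_Syl3_10_40 : #|'Syl_3(G)| = 10 \/ #|'Syl_3(G)| = 40.
Proof.
have le40 : #|'Syl_3(G)| <= 40.
  rewrite -(@leq_pmul2l 4) // -sum_sylow_over.
  apply: leq_trans (_ : \sum_(D in prime_subgroups G 3) 4 <= _)%N.
    by apply: leq_sum => D /card_sylow_over; rewrite !inE => /orP[] /eqP->.
  by rewrite sum_nat_const mulnC leq_mul2l card_prime3.
have d25 : ~~ (25 %| #|'Syl_3(G)|).
  apply/negP=> /dvdn_trans/(_ (card_Syl_dvd 3 G)).
  by rewrite (@pfactor_dvdn 5 2) ?cardG_gt0 // logn5_G.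
move: dvd5_Syl3 (card_Syl_mod G (isT : prime 3)) (card_Syl_gt1 simpleG kappaG (isT : prime 3)
  (@primes_dvd _ G simpleG kappaG 3 isT)).
move: #|_| le40 d25 => n; clear => le40 d25 d5 nmod n3.
have : n \in [:: 10; 25; 40] by rewrite !inE; lia.
by rewrite !inE => /or3P[/eqP|/eqP E|/eqP]; [left | rewrite E in d25 | right].
Qed.

End SylowThree.

(** * Ten Sylow 3-subgroups with trivial intersections *)

Section SylowThreeTI.
Variables (gT : finGroupType) (G : {group gT}).
Hypothesis simpleG : simple G.
Hypothesis kappaG : kappa G = kappa A6.
Hypothesis n5_neq6 : #|'Syl_5(G)| != 6.
Implicit Types (A D S T P : {group gT}) (p : nat).

(** Let [E] be a subgroup of order 4 of the centralizer. An element of order 4 in [E] gives a cyclic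
    group of order 12, of weight 3. Otherwise two involutions give cyclic groups of order 6, of
    weight 1 each, whose maximal overgroups differ because a cyclic group has only one
    involution. *)
Lemma weight_involutions_cent D : D \in prime_subgroups G 3 -> 4 %| #|'C_G(D)| ->
  2 <= subgroup_weight G 3 D.
Proof.
move=> DP d4; have [sDG oD pD D1] := prime_subgroup3P DP.
have [x ox ED] := prime_subgroup_gen (isT : prime 3) oD.
have xD : x \in D by rewrite ED /= cycle_id.
have xG : x \in G := subsetP sDG x xD.
have DE : (D : {set gT}) = <[x]> by rewrite ED.
have [S2 sylS2] := Sylow_exists 2 'C_G(D).
have le2 : 2 <= logn 2 #|S2|.
  rewrite (card_Hall sylS2) p_part pfactorK // -(pfactor_dvdn 2) ?cardG_gt0 //.
have [E [sES _ oE]] := normal_pgroup (pHall_pgroup sylS2) (normal_refl S2) le2.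
have EC e : e \in E -> [/\ e \in G & commute x e].
  move/(subsetP sES)/(subsetP (pHall_sub sylS2))/setIP=> [eG /centP eC]; split=> //.
  exact: esym (eC x xD).
have gen e : e \in E -> coprime 3 #[e] -> [/\ x * e \in G, #[x * e] = (3 * #[e])%N,
    x * e != 1, D \subset <[x * e]> & e \in <[x * e]>].
  move=> /EC[eG cxe] co; have oxe : #[x * e] = (3 * #[e])%N by rewrite orderM ?ox.
  split=> //; first exact: groupM.
  - by rewrite -order_gt1 oxe; apply: leq_trans (leq_mul (leqnn 3) (order_gt0 e)).
  - by rewrite DE cycleM ?ox // mulG_subl.
  by rewrite cycleM ?ox // (subsetP (mulG_subr _ _)) ?cycle_id.
have ordE e : e \in E -> e != 1 -> #[e] = 2 \/ #[e] = 4.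
  move=> eE e1; have : #[e] %| 4 by rewrite -[4]oE order_dvdG.
  rewrite dvdn_divisors // !inE order_eq1 (negPf e1) /=.
  by case/orP=> /eqP; [left | right].
case: (pickP (fun e => (e \in E) && (#[e] == 4))) => [e /andP[eE /eqP oe]|no4].
  have [|xeG oxe xe1 sD _] := gen e eE; first by rewrite oe.
  apply: leq_trans (leq_subgroup_weight 3 xeG xe1 sD).
  by rewrite /cycle_weight [#|_|]oxe oe.
have ord2 e : e \in E -> e != 1 -> #[e] = 2.
  by move=> eE e1; case: (ordE e eE e1) => // oe; have := no4 e; rewrite eE oe.
have : 1 < #|E :\ 1| by have := cardsD1 1 E; rewrite group1 oE add1n => -[<-].
case/card_gt1P=> a [b [/setD1P[a1 aE] /setD1P[b1 bE] ab]].
have oa := ord2 a aE a1; have ob := ord2 b bE b1.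
have [|xaG oxa xa1 sDa axa] := gen a aE; first by rewrite oa.
have [|xbG oxb xb1 sDb bxb] := gen b bE; first by rewrite ob.
have [A AM sA] := max_cycle_sup xaG xa1; have [B BM sB] := max_cycle_sup xbG xb1.
have wA : 1 <= cycle_weight 3 A.
  by apply: leq_trans (cycle_weight_mono 3 AM sA); rewrite /cycle_weight [#|_|]oxa oa.
have wB : 1 <= cycle_weight 3 B.
  by apply: leq_trans (cycle_weight_mono 3 BM sB); rewrite /cycle_weight [#|_|]oxb ob.
have AB : B != A.
  apply: contra ab => /eqP EBA; case: (max_cyclesP AM) => c [_ _ EA].
  have sa : <[a]>%G \subset <[c]>%G by rewrite cycle_subG /= -EA (subsetP sA).
  have sb : <[b]>%G \subset <[c]>%G by rewrite cycle_subG /= -EA -EBA (subsetP sB).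
  have := eq_subG_cyclic (cycle_cyclic c) sa sb.
  rewrite /= [#|<[a]>|]oa [#|<[b]>|]ob eqxx => /eqP/setP/(_ a).
  by rewrite cycle_id (cycle2g ob) !inE (negPf a1) => /esym.
rewrite /subgroup_weight (bigD1 A) /= ?AM ?(subset_trans sDa) //.
rewrite (bigD1 B) /= ?BM ?(subset_trans sDb) ?AB // addnA.
exact: leq_trans (leq_add wA wB) (leq_addr _ _).
Qed.

(** Four Sylow subgroups over [D] make 4 divide [#|'C_G(D)|], so the number over [D] is at most
    twice the weight of [D]. Summing gives 4 * [#|'Syl_3(G)|] <= 2 * 40, which excludes 40. *)
Lemma card_Syl3 : #|'Syl_3(G)| = 10.
Proof.
have : 4 * #|'Syl_3(G)| <= 80.
  rewrite -(sum_sylow_over simpleG kappaG n5_neq6) -[80]/(40 * 2)%N.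
  have <- : logn 3 (kappa G) = 40 by case: (logn_kappa kappaG).
  apply: leq_trans (_ : \sum_(D in prime_subgroups G 3) subgroup_weight G 3 D * 2 <= _)%N.
    apply: leq_sum => D DP.
    have := card_sylow_over simpleG kappaG n5_neq6 DP; rewrite !inE => /orP[/eqP->|/eqP r4].
      have [sDG oD pD D1] := prime_subgroup3P DP.
      have [x ox ED] := prime_subgroup_gen (isT : prime 3) oD.
      have DE : (D : {set gT}) = <[x]> by rewrite ED.
      rewrite muln_gt0 andbT DE.
      apply: leq_trans (leq_subgroup_weight 3 _ _ (subxx _)).
      + by rewrite /cycle_weight [#|_|]ox.
      + by rewrite -cycle_subG -DE.
      by rewrite -order_gt1 ox.
    rewrite r4 -[4]/(2 * 2)%N leq_pmul2r // weight_involutions_cent // -r4.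
    by rewrite -(Syl_cent_over simpleG kappaG n5_neq6 DP) card_Syl_dvd.
  by rewrite -big_distrl leq_pmul2r //= sum_subgroup_weight.
by case: (card_Syl3_10_40 simpleG kappaG n5_neq6) => -> //.
Qed.

Lemma card_sylow_overJ D g : g \in G -> D \in prime_subgroups G 3 ->
  #|sylow_over G D| <= #|sylow_over G (D :^ g)%G|.
Proof.
move=> gG DP; have inj : injective (fun T => (T :^ g)%G).
  by move=> T T' /(congr1 val)/= /conjsg_inj E; apply: val_inj.
rewrite -(card_imset _ inj); apply/subset_leq_card/subsetP=> _ /imsetP[T + ->].
by rewrite !inE conjSg pHallJ.
Qed.

Lemma sylow3_meet D T T' : 3.-Sylow(G) T -> 3.-Sylow(G) T' -> T' != T ->
  #|D| = 3 -> D \subset T -> D \subset T' -> D :=: T :&: T'.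
Proof.
move=> sylT sylT' ne oD sDT sDT'; apply/eqP; rewrite eqEcard subsetI sDT sDT' oD.
have oT := card_sylow3 simpleG kappaG n5_neq6 sylT.
exact: dvdn_leq (@sylow_setI_card _ _ 3 T T' 1 isT sylT sylT' ne oT).
Qed.

(* Subgroups of order 3 lying in four Sylow subgroups would form a class of at least ten, hence
   exhaust the subgroups of order 3; then a Sylow subgroup would meet twelve of the nine others. *)
Lemma card_sylow_over_eq1 D : D \in prime_subgroups G 3 -> #|sylow_over G D| = 1%N.
Proof.
move=> DP; have := card_sylow_over simpleG kappaG n5_neq6 DP.
rewrite !inE => /orP[/eqP // | r4].
pose B := [set E in prime_subgroups G 3 | #|sylow_over G E| == 4].
have BP E : E \in B -> E \in prime_subgroups G 3 by rewrite inE => /andP[].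
have DB : D \in B by rewrite inE DP.
have [sDG oD pD D1] := prime_subgroup3P DP.
have cB : conj_stable G B.
  move=> g E gG EB; have EP := BP E EB.
  have EP' : (E :^ g)%G \in prime_subgroups G 3.
    by move: EP; rewrite !inE cardJg -{2}(conjGid gG) conjSg.
  have rE : #|sylow_over G E| = 4 by move: EB; rewrite inE => /andP[_ /eqP].
  rewrite inE EP' /=; have := card_sylow_over simpleG kappaG n5_neq6 EP'.
  rewrite !inE; case/orP=> // /eqP r1.
  by have := card_sylow_overJ gG EP; rewrite rE r1.
have B5 : 5 %| #|B|.
  apply: (dvd5_stable simpleG kappaG n5_neq6 cB) => E /BP/prime_subgroup3P[sEG oE pE E1].
  by split.
(* Since 9 divides [#|G|], it divides the factorial of [#|B|], but it does not divide 5! = 120. *)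
have B6 : 5 < #|B|.
  rewrite ltnNge; apply/negP=> le5.
  have d9 : 9 %| #|B|`!.
    apply: dvdn_trans (stable_card_fact simpleG kappaG pD sDG D1 DB cB).
    by rewrite (@pfactor_dvdn 3 2) ?cardG_gt0 // (logn3_G simpleG kappaG).
  have d5 : #|B|`! %| 5`!.
    by rewrite -(ffact_fact (leq_subr #|B| 5)) subKn // dvdn_mull.
  by have := dvdn_trans d9 d5.
have B10 : 10 <= #|B| by move: B5 B6; clear; move: #|_| => n; lia.
have allB E : E \in prime_subgroups G 3 -> E \in B.
  move=> EP; apply/negPn/negP=> nEB.
  have := sum_sylow_over simpleG kappaG n5_neq6; rewrite card_Syl3.
  rewrite (bigID (mem B)) /= => sum40.
  have le4 : 4 * #|B| <= \sum_(i in prime_subgroups G 3 | i \in B) #|sylow_over G i|.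
    rewrite (eq_bigl (fun F => F \in B)) => [|F]; last by apply: andb_idl; apply: BP.
    by rewrite mulnC -sum_nat_const; apply: leq_sum => F; rewrite inE => /andP[_ /eqP->].
  have ge1 : 1 <= \sum_(i in prime_subgroups G 3 | i \notin B) #|sylow_over G i|.
    rewrite (bigD1 E) ?EP //=; apply: leq_trans (leq_addr _ _).
    by have := card_sylow_over simpleG kappaG n5_neq6 EP; rewrite !inE => /orP[] /eqP->.
  have := leq_add (leq_trans (leq_mul (leqnn 4) B10) le4) ge1.
  by rewrite sum40.
have [T sylT] := Sylow_exists 3 G.
have oT := card_sylow3 simpleG kappaG n5_neq6 sylT.
have TP E : E \in prime_subgroups T 3 -> [/\ #|E| = 3, E \subset T & E \in B].
  rewrite inE => /andP[sET /eqP oE]; split=> //; apply: allB.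
  by rewrite inE oE (subset_trans sET (pHall_sub sylT)) eqxx.
have sub E : E \in prime_subgroups T 3 -> sylow_over G E :\ T \subset 'Syl_3(G) :\ T.
  by move=> _; apply/setSD/subsetP=> S; rewrite inE => /andP[].
have ti E F S : E \in prime_subgroups T 3 -> F \in prime_subgroups T 3 ->
    S \in sylow_over G E :\ T -> S \in sylow_over G F :\ T -> E = F.
  move=> /TP[oE sET _] /TP[oF sFT _] /setD1P[ST]; rewrite !inE => /andP[sylS sES] /and3P[_ _ sFS].
  by apply: val_inj; rewrite /= (sylow3_meet sylT sylS ST oE sET sES) (sylow3_meet sylT sylS ST oF sFT sFS).
(* Each of the four subgroups of order 3 of [T] lies in three further Sylow subgroups, and these
   twelve are distinct. *)
have := sum_card_disjoint sub ti.
rewrite (eq_bigr (fun=> 3)) => [|E /TP[oE sET]]; last first.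
  rewrite inE => /andP[_ /eqP rE]; have := cardsD1 T (sylow_over G E).
  by rewrite rE !inE sylT sET add1n => -[].
have := cardsD1 T 'Syl_3(G); rewrite card_Syl3 inE sylT add1n => -[<-].
rewrite sum_nat_const; have := @card_prime_elements _ T 3 isT.
have -> : #|[set x in T | #[x] == 3]| = 8.
  have := cardsD1 1 T; rewrite group1 oT add1n => -[->]; apply: eq_card => x; rewrite !inE.
  apply/andP/andP=> [[xT /eqP ox]|[x1 xT]]; first by rewrite -order_gt1 ox.
  have := subsetP (order3_sub simpleG kappaG (pHall_pgroup sylT) (pHall_sub sylT)) x.
  by rewrite !inE x1 xT => /(_ isT)/andP[].
by move: #|_| => n; clear; lia.
Qed.

Lemma sylow3_TI T T' : 3.-Sylow(G) T -> 3.-Sylow(G) T' -> T' != T -> T :&: T' = 1.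
Proof.
move=> sylT sylT' ne; apply/eqP/negPn/negP=> meet.
have [x /setIP[xT xT'] x1] := trivgPn _ meet.
have := subsetP (order3_sub simpleG kappaG (pHall_pgroup sylT) (pHall_sub sylT)) x.
rewrite in_setD1 x1 xT inE => /(_ isT)/andP[xG /eqP ox].
have DP : <[x]>%G \in prime_subgroups G 3 by rewrite inE cycle_subG xG [#|_|]ox /=.
have /eqP/cards1P[S ES] := card_sylow_over_eq1 DP.
have inS (U : {group gT}) : 3.-Sylow(G) U -> x \in U -> U = S.
  move=> sylU xU; have : U \in sylow_over G <[x]>%G by rewrite !inE sylU cycle_subG.
  by rewrite ES inE => /eqP.
by rewrite (inS T' sylT' xT') (inS T sylT xT) eqxx in ne.
Qed.

End SylowThreeTI.

(** * The action on ten points *)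

(** Composing with the transposition of [x] and [s x] removes one 2-cycle. *)
Lemma odd_perm_involutive (T : finType) (s : {perm T}) : involutive s ->
  exists2 k, #|[set x | s x != x]| = k.*2 & odd_perm s = odd k.
Proof.
elim: {s}#|_|.+1 {-2}s (ltnSn #|[set x | s x != x]|) => // n IHn s; rewrite ltnS => le sK.
case: (set_0Vmem [set x | s x != x]) => [s0|[x]].
  exists 0; first by rewrite s0 cards0.
  rewrite (_ : s = 1) ?odd_perm1 //; apply/permP=> x; rewrite perm1; apply/eqP.
  by move/setP/(_ x): s0; rewrite !inE => /negbT; rewrite negbK.
rewrite inE => sx; pose s' := tperm x (s x) * s.
have s'E z : s' z = if (z == x) || (z == s x) then z else s z.
  rewrite permM; case: tpermP => [->|->|/eqP/negPf-> /eqP/negPf-> //]; rewrite eqxx ?orbT ?sK //.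
have mE : [set z | s' z != z] = [set z | s z != z] :\: [set x; s x].
  apply/setP=> z; rewrite !inE s'E; case: ifP => //; rewrite eqxx //.
have sub : [set x; s x] \subset [set z | s z != z].
  by apply/subsetP=> z /set2P[]->; rewrite inE ?sK // eq_sym.
have c2 : #|[set x; s x]| = 2 by rewrite cards2 eq_sym sx.
have cE : #|[set z | s z != z]| = (2 + #|[set z | s' z != z]|)%N.
  by rewrite mE -(cardsID [set x; s x] [set z | s z != z]) (setIidPr sub) c2.
have [||k ks ok] := IHn s'.
- by rewrite cE addSn in le; apply: leq_trans le; rewrite ltnS leq_addl.
- move=> z; rewrite (s'E z); case: ifP => [zx|/norP[z1 z2]]; first by rewrite s'E zx.
  by rewrite s'E sK (inv_eq sK) (negPf z2) (inj_eq perm_inj) (negPf z1).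
exists k.+1; first by rewrite cE ks doubleS.
have := odd_mul_tperm x (s x) s; rewrite -/s' ok eq_sym sx /= => ->.
by rewrite negbK.
Qed.

Section TenPoints.
Variables (gT : finGroupType) (G : {group gT}).
Hypothesis simpleG : simple G.
Hypothesis kappaG : kappa G = kappa A6.
Hypothesis n5_neq6 : #|'Syl_5(G)| != 6.
Implicit Types (A D S T P : {group gT}) (p : nat).

Definition fixed_sylows (g : gT) : {set {group gT}} := [set T in 'Syl_3(G) | g \in 'N(T)].

Lemma mem_fixed_sylows g T : (T \in fixed_sylows g) = 3.-Sylow(G) T && (g \in 'N(T)).
Proof. by rewrite inE [T \in _]inE. Qed.

Section Pair.
Variables T T' : {group gT}.
Hypotheses (sylT : 3.-Sylow(G) T) (sylT' : 3.-Sylow(G) T') (neT : T' != T).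

(** An element of [T] normalizing [T'] lies in [T'], its only Sylow 3-subgroup there, hence is
    trivial. So [T] acts regularly on the nine other Sylow subgroups. *)
Lemma sylow3_regular_inj : {in T &, injective (fun t => (T' :^ t)%G)}.
Proof.
move=> t s tT sT /(congr1 val)/= E; have sG := subsetP (pHall_sub sylT).
apply/eqP; rewrite eq_mulgV1; set u := _ * _; have uT : u \in T by rewrite groupM ?groupV.
have uN : u \in 'N(T') by apply/normP; rewrite conjsgM E conjsgK.
have uT' : u \in T'.
  have nT' : T' <| 'N_G(T') by rewrite /normal subsetI (pHall_sub sylT') normG subsetIr.
  have sylN : 3.-Sylow('N_G(T')) T' by apply: (pHall_subl (normal_sub nT') (subsetIl _ _) sylT').
  rewrite (mem_normal_Hall sylN nT') ?(mem_p_elt (pHall_pgroup sylT)) //.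
  by rewrite inE uN sG.
have : u \in T :&: T' by rewrite inE uT.
by rewrite (sylow3_TI simpleG kappaG n5_neq6 sylT sylT' neT) => /set1gP->.
Qed.

Lemma sylow3_regular_sub : [set (T' :^ t)%G | t in T] = 'Syl_3(G) :\ T.
Proof.
apply/eqP; rewrite eqEcard; apply/andP; split.
  apply/subsetP=> _ /imsetP[t tT ->]; have tG := subsetP (pHall_sub sylT) t tT.
  rewrite !inE pHallJ // sylT' andbT; apply: contra neT => /eqP/(congr1 val)/= E.
  by apply/eqP/val_inj; rewrite /= -(conjsgK t T') E; apply: conjGid; rewrite groupV.
rewrite (card_in_imset sylow3_regular_inj) (card_sylow3 simpleG kappaG n5_neq6 sylT).
have := cardsD1 T 'Syl_3(G); rewrite inE sylT (card_Syl3 simpleG kappaG n5_neq6) add1n => -[<-].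
by [].
Qed.

Lemma sylow3_regular S : 3.-Sylow(G) S -> S != T -> exists2 t, t \in T & S = (T' :^ t)%G.
Proof.
move=> sylS ST; have : S \in 'Syl_3(G) :\ T by rewrite !inE ST.
by rewrite -sylow3_regular_sub => /imsetP.
Qed.

Lemma stabilizer2_conj g t : g \in 'N(T) -> g \in 'N(T') -> t \in T ->
  ((T' :^ t) :^ g = T' :^ (t ^ g))%G.
Proof.
move=> gT1 gT' tT; apply: val_inj => /=.
by rewrite -[in RHS](normP gT') -!conjsgM -conjgC.
Qed.

(** Labelling [T' :^ t] by [t] turns the action of [g] on the other nine points into conjugation on
    [T]; the extra fixed point is [T] itself. *)
Lemma card_fixed_sylows g : g \in 'N(T) -> g \in 'N(T') ->
  #|fixed_sylows g| = #|'C_T[g]|.+1.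
Proof.
move=> gT1 gT'; rewrite (cardsD1 T) mem_fixed_sylows sylT gT1 add1n; congr _.+1.
have injC : {in 'C_T[g] &, injective (fun t => (T' :^ t)%G)}.
  by move=> t s /setIP[tT _] /setIP[sT _]; apply: sylow3_regular_inj.
rewrite -(card_in_imset injC); apply: eq_card => S; rewrite in_setD1 mem_fixed_sylows.
apply/and3P/imsetP=> [[ST sylS /normP gS]|[t /setIP[tT tC] ->]].
  have [t tT ES] := sylow3_regular sylS ST; exists t => //; rewrite inE tT.
  apply/cent1P/commgP/conjg_fixP; apply: sylow3_regular_inj => //.
    by rewrite memJ_norm.
  by rewrite -stabilizer2_conj // -ES; apply: val_inj.
have tG := subsetP (pHall_sub sylT) t tT.
have : (T' :^ t)%G \in 'Syl_3(G) :\ T by rewrite -sylow3_regular_sub; apply/imsetP; exists t.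
rewrite in_setD1 [_ \in 'Syl_3(G)]inE => /andP[neS sylS]; split=> //; apply/normP.
have /(congr1 val)/= -> := stabilizer2_conj gT1 gT' tT; suff -> : t ^ g = t by [].
by apply/conjg_fixP/commgP/cent1P.
Qed.

End Pair.

Lemma sylow3_perm : exists2 phi : {morphism G >-> {perm 'I_10}}, 'injm phi &
  exists2 e : 'I_10 -> {group gT}, injective e & (forall i, e i \in 'Syl_3(G)) /\
    forall g i, g \in G -> e (phi g i) = (e i :^ g)%G.
Proof.
have [T sylT] := Sylow_exists 3 G; have pT := pHall_pgroup sylT.
have TS : T \in 'Syl_3(G) by rewrite inE.
apply: (conj_stable_embedding simpleG (@conj_stable_Syl _ G 3) TS (pHall_sub sylT)).
- by rewrite -cardG_gt1 (card_sylow3 simpleG kappaG n5_neq6 sylT).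
- exact: pgroup_proper pT.
exact: card_Syl3.
Qed.

Lemma fixed_sylows_full g : g \in G -> 10 <= #|fixed_sylows g| -> g = 1.
Proof.
move=> gG le; have [phi ip [e e_inj [eS eJ]]] := sylow3_perm.
have EF : fixed_sylows g = 'Syl_3(G).
  apply/eqP; rewrite eqEcard (card_Syl3 simpleG kappaG n5_neq6) le andbT.
  by apply/subsetP=> T; rewrite inE => /andP[].
apply: (injmP ip) => //; rewrite morph1; apply/permP=> i; rewrite perm1; apply: e_inj.
rewrite eJ //; apply: val_inj; apply: normP.
by have := eS i; rewrite -EF inE => /andP[].
Qed.

(** The simple image consists of even permutations, so an involution has an even number of
    2-cycles. *)
Lemma fixed_sylows_involution z : z \in G -> #[z] = 2 -> 4 %| 10 - #|fixed_sylows z|.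
Proof.
move=> zG oz; have [phi ip [e e_inj [eS eJ]]] := sylow3_perm.
have oG : #|phi @* G| = #|G| := card_injm ip (subxx _).
have isoH : G \isog phi @* G by apply: sub_isog.
have simpleH : simple (phi @* G) by rewrite -(isog_simple isoH).
have even : phi @* G \subset 'Alt_('I_10).
  by apply: simple_perm_even => //; rewrite oG; apply: leq_trans (card_gt60 kappaG).
have ev : ~~ odd_perm (phi z).
  by rewrite -Alt_even (subsetP even) // mem_morphim.
have zK : involutive (phi z).
  move=> i; have : (phi z * phi z) i = i; last by rewrite permM.
  have zz : z * z = 1 by have := expg_order z; rewrite oz.
  by rewrite -morphM // zz morph1 perm1.
have [k km ok] := odd_perm_involutive zK.
have EF : #|fixed_sylows z| = #|[set i | phi z i == i]|.
  have eI : codom e =i 'Syl_3(G).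
    apply/subset_cardP; first by rewrite card_codom // card_ord (card_Syl3 simpleG kappaG n5_neq6).
    by apply/subsetP=> _ /codomP[i ->].
  rewrite -(card_imset _ e_inj); apply: eq_card => T; rewrite mem_fixed_sylows.
  apply/andP/imsetP=> [[sylT zT]|[i]].
    have /codomP[i Ei] : T \in codom e by rewrite eI inE.
    exists i => //; rewrite inE; apply/eqP/e_inj; rewrite eJ // -Ei.
    by apply: val_inj; apply: normP.
  rewrite inE => /eqP iz ->; have := eS i; rewrite inE => ->; split=> //.
  by apply/normP; have := congr1 val (eJ z i zG); rewrite /= iz.
have := cardsC [set i | phi z i == i]; rewrite card_ord -EF.
have -> : ~: [set i | phi z i == i] = [set i | phi z i != i] by apply/setP=> i; rewrite !inE.
rewrite km => <-; rewrite addKn.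
by move: ev; rewrite ok => /even_halfK <-; rewrite -muln2 -muln2 -mulnA dvdn_mull.
Qed.

(** The number of fixed points is below 10 and 2 modulo 4, thus 2 or 6; one less than it divides 9,
    which leaves 2. *)
Lemma involution_fixed z : z \in G -> #[z] = 2 -> #|fixed_sylows z| = 2 /\
  forall T, T \in fixed_sylows z -> 'C_T[z] = 1.
Proof.
move=> zG oz; have d4 := fixed_sylows_involution zG oz.
have z1 : z != 1 by rewrite -order_gt1 oz.
have lt10 : #|fixed_sylows z| < 10.
  by rewrite ltnNge; apply: contra z1 => /(fixed_sylows_full zG)->.
have ge2 : 1 < #|fixed_sylows z|.
  by move: d4 lt10; move: #|_| => n; do 2![case: n => [|n] //].
have cT T : T \in fixed_sylows z -> #|fixed_sylows z| = #|'C_T[z]|.+1 /\ #|'C_T[z]| %| 9.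
  move=> TF; have : 0 < #|fixed_sylows z :\ T| by move: ge2; rewrite (cardsD1 T) TF.
  case/card_gt0P=> T' /setD1P[ne]; rewrite mem_fixed_sylows => /andP[sylT' zT'].
  move: TF; rewrite mem_fixed_sylows => /andP[sylT zT].
  by rewrite (card_fixed_sylows sylT sylT' ne zT zT') -(card_sylow3 simpleG kappaG n5_neq6 sylT) cardSg ?subsetIl.
have f2 : #|fixed_sylows z| = 2.
  have [T /cT[E d9]] := elimT card_gt0P (ltnW ge2).
  move: d9 d4 lt10; rewrite dvdn_divisors // E !inE => /or3P[] /eqP-> //.
split=> // T /cT[+ _]; rewrite f2 => -[/esym/eqP]; rewrite -trivg_card1.
by move/eqP.
Qed.

End TenPoints.

Section Order360.
Variables (gT : finGroupType) (G : {group gT}).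
Hypothesis simpleG : simple G.
Hypothesis kappaG : kappa G = kappa A6.
Hypothesis n5_neq6 : #|'Syl_5(G)| != 6.
Implicit Types (A D S T P : {group gT}) (p : nat).

Let card3 := card_sylow3 simpleG kappaG n5_neq6.

(** As [T] is abelian, [t ^ z * t] is fixed by [z], hence trivial. *)
Lemma involution_inverts z T : z \in G -> #[z] = 2 -> T \in fixed_sylows G z ->
  {in T, forall t, t ^ z = t^-1}.
Proof.
move=> zG oz TF t tT; have [_ /(_ T TF) C1] := involution_fixed simpleG kappaG n5_neq6 zG oz.
move: TF; rewrite mem_fixed_sylows => /andP[sylT zN].
have zz : z * z = 1 by have := expg_order z; rewrite oz.
have tzT : t ^ z \in T by rewrite memJ_norm.
have tzz : (t ^ z) ^ z = t by rewrite -conjgM zz conjg1.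
have ctt : t * t ^ z = t ^ z * t := centsP (sylow3_abelian simpleG kappaG n5_neq6 sylT) t tT _ tzT.
have : t ^ z * t \in 'C_T[z].
  rewrite inE groupM //; apply/cent1P/commgP/conjg_fixP.
  by rewrite conjMg tzz ctt.
rewrite C1 => /set1gP tzt; apply/eqP; rewrite eq_mulgV1 invgK; exact/eqP.
Qed.

Lemma fix_trivial T T' g : 3.-Sylow(G) T -> 3.-Sylow(G) T' -> T' != T -> g \in G ->
  g \in 'N(T) -> g \in 'N(T') -> g \in 'C(T) -> g = 1.
Proof.
move=> sylT sylT' ne gG gT1 gT' gC; apply: (fixed_sylows_full simpleG kappaG n5_neq6 gG).
rewrite (card_fixed_sylows simpleG kappaG n5_neq6 sylT sylT' ne gT1 gT') ltnS -(card3 sylT).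
apply: subset_leq_card; rewrite subsetI subxx; apply/subsetP=> t tT.
by apply/cent1P/esym/(centP gC).
Qed.

(** Both involutions invert [T], so their product centralizes it and then fixes all ten points. *)
Lemma involution_unique T T' z y : 3.-Sylow(G) T -> 3.-Sylow(G) T' -> T' != T ->
    z \in G -> #[z] = 2 -> z \in 'N(T) -> z \in 'N(T') ->
    y \in G -> #[y] = 2 -> y \in 'N(T) -> y \in 'N(T') -> z = y.
Proof.
move=> sylT sylT' ne zG oz zT zT' yG oy yT yT'.
have zz : y * y = 1 by have := expg_order y; rewrite oy.
have yV : y^-1 = y by apply/eqP; rewrite eq_invg_mul zz.
apply/eqP; rewrite -yV eq_mulgV1 invgK; apply/eqP.
apply: (fix_trivial sylT sylT' ne (groupM zG yG) (groupM zT yT) (groupM zT' yT')).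
apply/centP=> t tT; apply/esym/commgP/conjg_fixP.
have zF : T \in fixed_sylows G z by rewrite mem_fixed_sylows sylT.
have yF : T \in fixed_sylows G y by rewrite mem_fixed_sylows sylT.
by rewrite conjgM (involution_inverts zG oz zF tT) conjVg (involution_inverts yG oy yF tT) invgK.
Qed.

(** An involution is determined by its two fixed points, and ten points have 45 pairs. *)
Lemma card_involutions : #|[set z in G | #[z] == 2]| <= 45.
Proof.
have fixz z : z \in [set z in G | #[z] == 2] -> [/\ z \in G, #[z] = 2 & #|fixed_sylows G z| = 2].
  rewrite inE => /andP[zG /eqP oz]; split=> //.
  by have [] := involution_fixed simpleG kappaG n5_neq6 zG oz.
have inj : {in [set z in G | #[z] == 2] &, injective (fixed_sylows G)}.
  move=> z y /fixz[zG oz fz] /fixz[yG oy _] E.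
  have : 1 < #|fixed_sylows G z| by rewrite fz.
  case/card_gt1P=> T [T' [TF T'F]]; rewrite eq_sym => ne.
  have yT := TF; have yT' := T'F; rewrite E in yT yT'.
  move: TF T'F yT yT'; rewrite !mem_fixed_sylows => /andP[sylT zT] /andP[sylT' zT'] /andP[_ yT] /andP[_ yT'].
  exact: (involution_unique sylT sylT' ne zG oz zT zT' yG oy yT yT').
rewrite -(card_in_imset inj).
have <- : #|[set A : {set {group gT}} | A \subset 'Syl_3(G) & #|A| == 2]| = 45.
  by rewrite cards_draws (card_Syl3 simpleG kappaG n5_neq6).
apply/subset_leq_card/subsetP=> _ /imsetP[z /fixz[_ _ fz] ->].
by rewrite inE fz eqxx andbT; apply/subsetP=> T; rewrite inE => /andP[].
Qed.

(** If [d] lies in [T], it also lies in [T :^ z]; trivial intersections make [z] normalize [T], but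
    then ['C_T[z]] is trivial. *)
Lemma involution_order3 z d : z \in G -> d \in G -> #[z] = 2 -> #[d] = 3 -> ~ commute z d.
Proof.
move=> zG dG oz od czd.
have pd : 3.-group <[d]> by rewrite /pgroup [#|_|]od.
have sd : <[d]>%G \subset G by rewrite cycle_subG.
have [T sylT] := Sylow_superset sd pd; rewrite cycle_subG => dT.
have TF : T \in fixed_sylows G z.
  rewrite mem_fixed_sylows sylT; apply/normP/eqP/negPn/negP=> ne.
  have sylTz : 3.-Sylow(G) (T :^ z)%G by rewrite pHallJ.
  have neT : (T :^ z)%G != T by apply: contra ne => /eqP/(congr1 val)/= ->.
  have : d \in T :&: (T :^ z)%G.
    have dz : d ^ z^-1 = d by apply/conjg_fixP/commgP/commuteV/esym.
    by rewrite inE dT mem_conjg dz.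
  rewrite (sylow3_TI simpleG kappaG n5_neq6 sylT sylTz neT) => /set1gP d1.
  by rewrite d1 order1 in od.
have [_ /(_ T TF) C1] := involution_fixed simpleG kappaG n5_neq6 zG oz.
have : d \in 'C_T[z] by rewrite inE dT; apply/cent1P.
by rewrite C1 => /set1gP d1; rewrite d1 order1 in od.
Qed.

(** The group [<[y]>] permutes the two fixed points of [z], hence fixes them, while no Sylow
    5-subgroup normalizes a Sylow 3-subgroup. *)
Lemma involution_order5 z y : z \in G -> y \in G -> #[z] = 2 -> #[y] = 5 -> ~ commute z y.
Proof.
move=> zG yG oz oy czy.
have [f2 _] := involution_fixed simpleG kappaG n5_neq6 zG oz.
have oP : #|<[y]>%G| = 5 by [].
have pP : 5.-group <[y]>%G by rewrite /pgroup oP.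
have sylP : 5.-Sylow(G) <[y]>%G.
  by move/setP/(_ <[y]>%G): (Syl5E simpleG kappaG); rewrite !inE oP cycle_subG yG => ->.
have actP : [acts <[y]>, on fixed_sylows G z | 'JG].
  apply/subsetP=> x xy; rewrite !inE; apply/subsetP=> T.
  have xG : x \in G by apply: (subsetP (pHall_sub sylP)).
  rewrite mem_fixed_sylows => /andP[sylT zT]; rewrite inE mem_fixed_sylows /= pHallJ // sylT.
  suff -> : z = z ^ x by rewrite normJ memJ_conjg.
  have /cycleP[k ->] := xy; apply/esym/conjg_fixP/commgP; exact: commuteX.
have := pgroup_fix_mod pP actP; rewrite f2 => m2.
have : 0 < #|'Fix_(fixed_sylows G z | 'JG)(<[y]>)|.
  by rewrite lt0n; apply: contraPneq m2 => ->.
case/card_gt0P=> T; rewrite inE afixJG => /andP[TF yT].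
move: TF; rewrite mem_fixed_sylows => /andP[sylT _].
have T1 : T :!=: 1 by rewrite -cardG_gt1 card3.
have := sylow5_not_norm simpleG kappaG n5_neq6 sylP (pHall_sub sylT) (pHall_pgroup sylT) T1.
by rewrite yT.
Qed.

End Order360.

(** * Counting elements by order *)

Section CardG.
Variables (gT : finGroupType) (G : {group gT}).
Hypothesis simpleG : simple G.
Hypothesis kappaG : kappa G = kappa A6.
Hypothesis n5_neq6 : #|'Syl_5(G)| != 6.
Implicit Types (A D S T P : {group gT}) (p : nat).

Lemma order_prime_power p (x : gT) : 0 < p -> p %| #[x] -> #[x ^+ (#[x] %/ p)] = p.
Proof.
move=> p0 /dvdnP[k ok]; rewrite ok mulnK // orderXdiv ok ?dvdn_mulr //.
by rewrite mulKn //; case: k ok => // ok; have := order_gt0 x; rewrite ok.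
Qed.

Lemma order_one_prime x p q : x \in G -> prime p -> prime q -> p %| #[x] -> q %| #[x] -> p = q.
Proof.
move=> xG pp pq px qx; apply/eqP/negPn/negP=> ne.
have sp : p \in [:: 2; 3; 5].
  by apply: (pi_subset kappaG) => //; apply: dvdn_trans px (order_dvdG xG).
have sq : q \in [:: 2; 3; 5].
  by apply: (pi_subset kappaG) => //; apply: dvdn_trans qx (order_dvdG xG).
have bad a b : a %| #[x] -> b %| #[x] -> 0 < a -> 0 < b -> exists y z,
    [/\ y \in G, z \in G, #[y] = a, #[z] = b & commute y z].
  move=> ax bx a0 b0; exists (x ^+ (#[x] %/ a)), (x ^+ (#[x] %/ b)).
  by rewrite !order_prime_power ?groupX //; split=> //; apply/commuteX2.
have b23 : ~ (2 %| #[x] /\ 3 %| #[x]).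
  case=> x2 x3; have [y [z [yG zG oy oz]]] := bad 2 3 x2 x3 isT isT.
  exact: (involution_order3 simpleG kappaG n5_neq6 yG zG oy oz).
have b25 : ~ (2 %| #[x] /\ 5 %| #[x]).
  case=> x2 x5; have [y [z [yG zG oy oz]]] := bad 2 5 x2 x5 isT isT.
  exact: (involution_order5 simpleG kappaG n5_neq6 yG zG oy oz).
have b35 : ~ (3 %| #[x] /\ 5 %| #[x]).
  case=> x3 x5; have [y [z [yG zG oy oz]]] := bad 3 5 x3 x5 isT isT.
  exact: (no_commuting_3_5 simpleG kappaG n5_neq6 yG zG oy oz).
move: sp sq px qx ne; rewrite !inE.
by case/or3P=> /eqP->; case/or3P=> /eqP-> // px qx _; [case: b23|case: b25|case: b23|case: b35|case: b25|case: b35].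
Qed.

Lemma order_pelt x p : x \in G -> prime p -> p %| #[x] -> p.-elt x.
Proof.
move=> xG pp px; apply/pnatP=> // q pq qx.
by rewrite (order_one_prime xG pq pp qx px) inE.
Qed.

Lemma order_cases x : x \in G ->
  [\/ x = 1, #[x] = 3, #[x] = 5 | #[x] = 2 \/ 4 %| #[x]].
Proof.
move=> xG; have [->|x1] := eqVneq x 1; first by constructor 1.
have n1 : 1 < #[x] by rewrite order_gt1.
have pp := pdiv_prime n1; have pd := pdiv_dvd #[x]; move: (pdiv _) pp pd => p pp pd.
have sp : p \in [:: 2; 3; 5].
  by apply: (pi_subset kappaG) => //; apply: dvdn_trans pd (order_dvdG xG).
have px := order_pelt xG pp pd.
move: sp; rewrite !inE => /or3P[] /eqP E; subst p.
- constructor 4; have /p_natP[[|[|k]] ok] : 2.-nat #[x] := px.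
  + by rewrite ok in n1.
  + by left.
  by right; rewrite ok (@dvdn_exp2l 2 2).
- by constructor 2; apply: (order_pgroup pp (not_order9 simpleG kappaG) xG px x1).
by constructor 3; apply: (order_pgroup pp (not_order25 simpleG kappaG) xG px x1).
Qed.

Lemma card_order3_eq : #|[set x in G | #[x] == 3]| = 80.
Proof.
rewrite card_prime_elements //; have := sum_sylow_over simpleG kappaG n5_neq6.
rewrite (eq_bigr (fun=> 1%N)) => [|D DP]; last exact: card_sylow_over_eq1.
by rewrite sum1_card (card_Syl3 simpleG kappaG n5_neq6) => ->.
Qed.

Lemma card_order5_eq : #|[set x in G | #[x] == 5]| = 144.
Proof. by rewrite card_prime_elements // -(Syl5E simpleG kappaG) (card_Syl5_36 simpleG kappaG n5_neq6). Qed.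

Let E4 := [set x in G | 4 %| #[x]].

(** If nonempty, the intersection forces [#|C| = 2 ^ k.+2] and omits the identity and the
    involution, so it has at most [2 * (2 ^ k.+1 - 1)] elements; the weight is [k.+2] times the same
    bracket. *)
Lemma card_order4_max_cycle C : C \in max_cycles G -> #|E4 :&: C| <= cycle_weight 2 C.
Proof.
case/max_cyclesP=> c [/setD1P[_ cG] _ ->].
have [->|[x /setIP[]]] := set_0Vmem (E4 :&: <[c]>); first by rewrite cards0.
rewrite inE => /andP[xG x4] xc; have d4 := dvdn_trans x4 (order_dvdG xc).
have c2 : 2 %| #[c] by apply: dvdn_trans d4.
have /p_natP[k ok] : 2.-nat #[c] := @order_pelt c 2 cG isT c2.
case: k ok => [|[|k]] ok; try by rewrite [#|_|]ok in d4.
have oi := order_prime_power (isT : 0 < 2) c2; set i := c ^+ _ in oi.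
have sub : E4 :&: <[c]> \subset <[c]> :\: [set 1; i].
  apply/subsetP=> y /setIP[+ yc]; rewrite inE => /andP[yG y4]; rewrite inE yc andbT !inE.
  by apply/norP; split; apply: contraTneq y4 => ->; rewrite ?order1 ?oi.
apply: leq_trans (subset_leq_card sub) _.
have s2 : [set 1; i] \subset <[c]> by apply/subsetP=> y /set2P[] ->; rewrite ?group1 ?mem_cycle.
have i1 : 1 != i by rewrite eq_sym -order_gt1 oi.
have := cardsID [set 1; i] <[c]>; rewrite (setIidPr s2) cards2 i1 /cycle_weight [#|<[c]>|]ok.
rewrite totient_pfactor // pfactorK // mul1n => /esym E.
have -> : #|<[c]> :\: [set 1; i]| = (2 ^ k.+2 - 2)%N by rewrite E addKn.
apply: leq_trans (_ : (2 ^ k.+1).-1 * 2 <= _)%N; last by rewrite leq_mul2l orbT.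
by rewrite [(2 ^ k.+2)%N]expnS mulnC -subn1 mulnBl.
Qed.

Lemma card_order4_leq : #|E4| <= 180.
Proof.
have <- : logn 2 (kappa G) = 180 by case: (logn_kappa kappaG).
apply: leq_trans (sum_cycle_weight G 2).
apply: (@leq_trans (\sum_(C in max_cycles G) #|E4 :&: C|)%N); last first.
  by apply: leq_sum => C; apply: card_order4_max_cycle.
under eq_bigr do rewrite -sum1_card.
rewrite (exchange_big_dep (mem E4)) /= => [|C x _]; last by rewrite inE => /andP[].
rewrite -sum1_card; apply: leq_sum => x xE; rewrite sum1_card.
have xG : x \in G by move: xE; rewrite inE => /andP[].
have x1 : x != 1 by apply: contraTneq xE => ->; rewrite inE order1 andbF.
have [C CM xC] := max_cycle_exists xG x1.
by apply/card_gt0P; exists C; rewrite unfold_in /= CM inE xE xC.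
Qed.

(** 1 + 80 + 144 elements of order 1, 3 and 5, at most 45 involutions, and at most 180 elements of
    order divisible by 4. *)
Lemma card_G_leq : #|G| <= 450.
Proof.
pose O n := [set x in G | #[x] == n].
have sub : G \subset [set 1] :|: O 3 :|: O 5 :|: O 2 :|: E4.
  apply/subsetP=> x xG; rewrite !inE xG /=.
  by case: (order_cases xG) => [->|->|->|[->|->]]; rewrite ?eqxx ?orbT.
apply: leq_trans (subset_leq_card sub) _.
apply: leq_trans (leq_card_setU _ _) _.
apply: leq_trans (leq_add (leq_card_setU _ _) (leqnn _)) _.
apply: leq_trans (leq_add (leq_add (leq_card_setU _ _) (leqnn _)) (leqnn _)) _.
apply: leq_trans (leq_add (leq_add (leq_add (leq_card_setU _ _) (leqnn _)) (leqnn _)) (leqnn _)) _.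
rewrite cards1 card_order3_eq card_order5_eq.
exact: leq_add (leq_add (leqnn 225) (card_involutions simpleG kappaG n5_neq6)) card_order4_leq.
Qed.

Lemma card_G_geq : 225 <= #|G|.
Proof.
pose O n := [set x in G | #[x] == n].
have sub : [set 1] :|: (O 3 :|: O 5) \subset G.
  rewrite !subUset sub1set group1 /=; apply/andP; split; apply/subsetP=> x; by rewrite inE => /andP[].
apply: leq_trans (subset_leq_card sub).
rewrite cardsU1 !inE group1 order1 /= cardsU card_order3_eq card_order5_eq.
rewrite (_ : O 3 :&: O 5 = set0) ?cards0 //; apply/setP=> x; rewrite !inE.
by case: (#[x] =P 3) => [->|]; rewrite !andbF.
Qed.

Section Pair.
Variables T T' : {group gT}.
Hypotheses (sylT : 3.-Sylow(G) T) (sylT' : 3.-Sylow(G) T') (neT : T' != T).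

Lemma card_stabilizer2_mul : #|G| = (90 * #|'N_G(T) :&: 'N(T')|)%N.
Proof.
have sTN : T \subset 'N_G(T) by rewrite subsetI (pHall_sub sylT) normG.
have defN : ('N_G(T) :&: 'N(T')) * T = 'N_G(T).
  apply/eqP; rewrite eqEsubset mul_subG ?subsetIl //=; apply/subsetP=> n nN.
  have /setIP[nG nT] := nN.
  have nneT : (T' :^ n)%G != T.
    apply: contra neT => /eqP/(congr1 val)/= E; apply/eqP/val_inj => /=.
    by apply: (conjsg_inj (x := n)); rewrite E (normP nT).
  have [|t tT Et] := sylow3_regular simpleG kappaG n5_neq6 sylT sylT' neT _ nneT.
    by rewrite pHallJ.
  rewrite -(mulgKV t n); apply: mem_mulg => //.
  apply/setIP; split; first by rewrite (groupM nN) // groupV (subsetP sTN t tT).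
  apply/normP.
  by rewrite conjsgM; have /= -> := congr1 val Et; rewrite conjsgK.
have ti : ('N_G(T) :&: 'N(T')) :&: T = 1.
  apply/trivgP/subsetP=> t /setIP[/setIP[_ tN] tT]; apply/set1gP.
  apply: (sylow3_regular_inj simpleG kappaG n5_neq6 sylT sylT' neT tT (group1 T)).
  by apply: val_inj; rewrite /= conjsg1; apply: normP.
rewrite -(Lagrange (subsetIl G 'N(T))) -(card_Syl sylT) (card_Syl3 simpleG kappaG n5_neq6).
have := TI_cardMg ti; rewrite defN (card_sylow3 simpleG kappaG n5_neq6 sylT) => ->.
by rewrite mulnAC -mulnA mulnC.
Qed.

(** If [m] is this order, [90 * m] lies between 225 and 450 and is divisible by 4, which leaves
    [m = 4]. *)
Lemma card_stabilizer2 : #|'N_G(T) :&: 'N(T')| = 4.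
Proof.
have := dvd4_G simpleG kappaG n5_neq6; move: card_G_leq card_G_geq; rewrite card_stabilizer2_mul.
by move: #|_| => n; clear; lia.
Qed.

Lemma card_G : #|G| = 360.
Proof. by rewrite card_stabilizer2_mul card_stabilizer2. Qed.

(** The stabilizer has order 4 and at most one involution, so it is cyclic. *)
Lemma stabilizer2_cycle : exists f, [/\ f \in G, #[f] = 4 & 'N_G(T) :&: 'N(T') = <[f]>].
Proof.
set Q := _ :&: _; have oQ : #|Q| = 4 := card_stabilizer2.
have QP g : g \in Q -> [/\ g \in G, g \in 'N(T) & g \in 'N(T')].
  by case/setIP=> /setIP[-> ->] ->.
case: (pickP (fun f => (f \in Q) && (#[f] == 4))) => [f /andP[fQ /eqP of4]|no4].
  have [fG _ _] := QP f fQ.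
  by exists f; split=> //; apply/esym/eqP; rewrite eqEcard cycle_subG fQ oQ [#|<[f]>|]of4.
have ord2 e : e \in Q -> e != 1 -> #[e] = 2.
  move=> eQ e1; have : #[e] %| 4 by rewrite -[4]oQ order_dvdG.
  rewrite dvdn_divisors // !inE order_eq1 (negPf e1) /=.
  by case/orP=> /eqP // oe; have := no4 e; rewrite eQ oe.
have : 1 < #|Q :\ 1| by have := cardsD1 1 Q; rewrite group1 oQ add1n => -[<-].
case/card_gt1P=> a [b [/setD1P[a1 aQ] /setD1P[b1 bQ] /eqP[]]].
have [aG aT aT'] := QP a aQ; have [bG bT bT'] := QP b bQ.
exact: (involution_unique simpleG kappaG n5_neq6 sylT sylT' neT aG (ord2 a aQ a1) aT aT' bG (ord2 b bQ b1)).
Qed.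

End Pair.
End CardG.

(** * Uniqueness of the permutation group of degree ten *)

Section TenPointTables.
Local Open Scope nat_scope.

(* The point [3 i + j] stands for the Sylow subgroup [T' :^ (t ^+ i * u ^+ j)], the point [9] for
   [T = <t, u>]; here [f] generates the stabilizer of [T] and [T'], with [t ^ f = u] and
   [u ^ f = t^-1]. *)
Definition table_t := [:: 3; 4; 5; 6; 7; 8; 0; 1; 2; 9].
Definition table_u := [:: 1; 2; 0; 4; 5; 3; 7; 8; 6; 9].
Definition table_f := [:: 0; 6; 3; 1; 7; 4; 2; 8; 5; 9].
Definition table_w := [:: 9; 2; 1; 3; 7; 8; 6; 4; 5; 0].

(** The element of [T] that carries the point 0 to the point [c]. *)
Definition translation c := mulp (expp 10 table_t (c %/ 3)) (expp 10 table_u (c %% 3)).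

Definition word_table (W : seq nat) (cs : seq nat) : seq nat :=
  foldr (fun c r => mulp (mulp W (translation c)) r) (iota 0 10) cs.

(* [w] swaps [9] and [0] and satisfies [f * w = w * f ^+ e]. *)
Definition swap_table e a b : seq nat :=
  let fe := nth 0 (expp 10 table_f e) in
  [:: 9; fe a; fe (fe (fe a)); a; b; fe (fe (fe b)); fe (fe a); fe b; fe (fe b); 0].

(* For every candidate other than [table_w], one of these words stabilizes [9] and [0] without
   acting as a power of [f]. *)
Definition bad_words : seq (seq nat) :=
  [:: [:: 0; 0]; [:: 1; 2; 1]; [:: 1; 5; 6]; [:: 1; 5; 3]; [:: 1; 5; 1]; [:: 1; 5; 2];
      [:: 1; 1; 1]; [:: 1; 7; 1]; [:: 1; 7; 2]]%N.

Definition stab2_ok (v : seq nat) : bool :=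
  (nth 0 v 9 == 9) && (nth 0 v 0 == 0) ==> (v \in [seq expp 10 table_f k | k <- iota 0 4]).

Definition swap_ok W : bool :=
  uniq W && all (fun cs => stab2_ok (word_table W cs)) bad_words ==> (W == table_w).

(** Here [e] is 1 or 3 because the swap normalizes a cyclic group of order 4. Restricting [a] to 3
    and 4 is enough: these represent the two 4-cycles of [f], and the swap may be composed with a
    power of [f]. *)
Lemma swap_table_check :
  all (fun e => all (fun a => all (fun b => swap_ok (swap_table e a b)) (iota 0 10)) [:: 3; 4])
    [:: 1%N; 3].
Proof. by vm_compute. Qed.

End TenPointTables.

(** * Labelling the ten Sylow subgroups *)

Section Labelling.
Variables (gT : finGroupType) (G : {group gT}).
Hypothesis simpleG : simple G.
Hypothesis kappaG : kappa G = kappa A6.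
Hypothesis n5_neq6 : #|'Syl_5(G)| != 6.
Variables (T T' : {group gT}) (f t : gT).
Hypotheses (sylT : 3.-Sylow(G) T) (sylT' : 3.-Sylow(G) T') (neT : T' != T).
Hypotheses (fG : f \in G) (order_f : #[f] = 4) (defQ : 'N_G(T) :&: 'N(T') = <[f]>).
Hypotheses (tT : t \in T) (t1 : t != 1).

Let u := t ^ f.
Let sTG := pHall_sub sylT.

Lemma f_norm : f \in 'N(T) /\ f \in 'N(T').
Proof.
have : f \in 'N_G(T) :&: 'N(T') by rewrite defQ cycle_id.
by case/setIP=> /setIP[_ ->] ->.
Qed.

Let f_mod k : f ^+ (k %% 4) = f ^+ k.
Proof. by rewrite -order_f expg_mod_order. Qed.

Let uT : u \in T.
Proof. by rewrite memJ_norm //; case: f_norm. Qed.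

Lemma f2_inverts : t ^ (f ^+ 2) = t^-1.
Proof.
have [fT fT'] := f_norm.
apply: (involution_inverts simpleG kappaG n5_neq6 (groupX 2 fG) _ _ tT).
  by rewrite orderXdiv order_f.
by rewrite mem_fixed_sylows sylT groupX.
Qed.

Lemma u_conj_f : u ^ f = t^-1.
Proof. by rewrite -conjgM -f2_inverts. Qed.

Lemma order_t : #[t] = 3.
Proof.
have := subsetP (order3_sub simpleG kappaG (pHall_pgroup sylT) sTG) t.
by rewrite in_setD1 t1 tT inE => /(_ isT)/andP[_ /eqP].
Qed.

Let order_u : #[u] = 3. Proof. by rewrite orderJ order_t. Qed.

Lemma commute_tu : commute t u.
Proof. exact: (centsP (sylow3_abelian simpleG kappaG n5_neq6 sylT)) _ tT _ uT. Qed.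

(** If the groups met, [t ^ f] would be [t] or [t^-1], and [f ^+ 2] would fix [t] instead of
    inverting it. *)
Lemma cycle_tu_TI : <[t]> :&: <[u]> = 1.
Proof.
apply/trivgP/subsetP=> x /setIP[xt xu]; apply/set1gP/eqP/negPn/negP=> x1.
have ot : #|<[t]>%G| = 3 := order_t; have ou : #|<[u]>%G| = 3 := order_u.
have E : <[t]>%G = <[u]>%G.
  by rewrite (prime_subgroup_cycle _ ot xt x1) // (prime_subgroup_cycle _ ou xu x1).
have /cycleP[k uk] : u \in <[t]> by have /= -> := congr1 val E; apply: cycle_id.
have : t ^ (f ^+ 2) = t.
  rewrite conjgM -/u uk conjXg -/u uk -expgM -{2}[t]expg1; apply/eqP.
  rewrite eq_expg_mod_order order_t.
  have : u != 1 by rewrite -order_gt1 order_u.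
  have -> : u = t ^+ (k %% 3) by rewrite uk -order_t expg_mod_order.
  rewrite -modnMm; have := ltn_pmod k (isT : 0 < 3).
  by case: (k %% 3) => [|[|[|n]]] //; rewrite expg0 eqxx.
rewrite f2_inverts => tV; have := order_t.
have : t ^+ 2 = 1 by rewrite expgS expg1 -{1}tV mulVg.
by move/eqP; rewrite -order_dvdn => /[swap] ->.
Qed.

Definition pt i j := t ^+ i * u ^+ j.

Lemma pt_in i j : pt i j \in T. Proof. by rewrite groupM ?groupX. Qed.

Lemma pt_mod i j : pt (i %% 3) (j %% 3) = pt i j.
Proof. by rewrite /pt -{1}order_t -order_u !expg_mod_order. Qed.

Lemma pt_inj i j k l : i < 3 -> j < 3 -> k < 3 -> l < 3 -> pt i j = pt k l -> i = k /\ j = l.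
Proof.
rewrite /pt => i3 j3 k3 l3 E.
have E1 : (t ^+ k)^-1 * t ^+ i = u ^+ l * (u ^+ j)^-1.
  by apply: (mulgI (t ^+ k)); rewrite mulKVg mulgA -E mulgK.
have xt : (t ^+ k)^-1 * t ^+ i \in <[t]> by rewrite groupM ?groupV ?mem_cycle.
have xu : (t ^+ k)^-1 * t ^+ i \in <[u]> by rewrite E1 groupM ?groupV ?mem_cycle.
have x1 : (t ^+ k)^-1 * t ^+ i = 1.
  by apply/set1gP; rewrite -cycle_tu_TI inE xt.
have := x1; rewrite E1 => y1; move/eqP: x1; rewrite -eq_mulVg1 eq_expg_mod_order order_t.
rewrite !modn_small // => /eqP ki; move/eqP: y1; rewrite -eq_mulgV1 eq_expg_mod_order order_u.
by rewrite !modn_small // => /eqP.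
Qed.

Definition label k : {group gT} := if k < 9 then (T' :^ pt (k %/ 3) (k %% 3))%G else T.

Lemma label_pt i j : i < 3 -> j < 3 -> label (3 * i + j) = (T' :^ pt i j)%G.
Proof.
move=> i3 j3; rewrite /label ifT; last by move: i3 j3; clear; lia.
by rewrite mulnC divnMDl // modnMDl divn_small // modn_small // addn0.
Qed.

Lemma label9 : label 9 = T. Proof. by []. Qed.

Lemma label0 : label 0 = T'.
Proof. by apply: val_inj; rewrite /label div0n mod0n /pt !expg0 mulg1 /= conjsg1. Qed.

Lemma label_ind (P : nat -> Prop) :
  P 9 -> (forall i j, i < 3 -> j < 3 -> P (3 * i + j)%N) -> forall k, k < 10 -> P k.
Proof.
move=> P9 Pij k; rewrite ltnS leq_eqVlt => /orP[/eqP-> // | k9].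
rewrite (divn_eq k 3) mulnC; apply: Pij; last exact: ltn_pmod.
by rewrite ltn_divLR.
Qed.

Lemma label_sylow k : label k \in 'Syl_3(G).
Proof.
by rewrite inE /label; case: ifP => // _; rewrite pHallJ // (subsetP sTG) ?pt_in.
Qed.

Lemma label_neq9 i j : (T' :^ pt i j)%G != T.
Proof.
apply: contra neT => /eqP/(congr1 val)/= E; apply/eqP/val_inj => /=.
by apply: (conjsg_inj (x := pt i j)); rewrite E conjGid ?pt_in.
Qed.

Lemma label_inj k l : k < 10 -> l < 10 -> label k = label l -> k = l.
Proof.
move=> k10; move: l; elim/label_ind: k / k10 => [|i j i3 j3] l l10.
  elim/label_ind: l / l10 => [//|k l k3 l3].
  by rewrite label9 label_pt // => /esym/eqP; rewrite (negPf (label_neq9 _ _)).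
elim/label_ind: l / l10 => [|k l k3 l3].
  by rewrite label9 label_pt // => /eqP; rewrite (negPf (label_neq9 _ _)).
rewrite !label_pt // => /(sylow3_regular_inj simpleG kappaG n5_neq6 sylT sylT' neT).
by rewrite !pt_in => /(_ isT isT)/(pt_inj i3 j3 k3 l3)[-> ->].
Qed.

Let e (i : 'I_10) := label i.

Let e_inj : injective e.
Proof. by move=> i j E; apply/ord_inj/label_inj. Qed.

Lemma label_codom : codom e =i 'Syl_3(G).
Proof.
apply/subset_cardP; first by rewrite card_codom // card_ord (card_Syl3 simpleG kappaG n5_neq6).
by apply/subsetP=> _ /codomP[i ->]; apply: label_sylow.
Qed.

Lemma label_representation : exists2 phi : {morphism G >-> {perm 'I_10}}, 'injm phi &
  forall g i, g \in G -> label (phi g i) = (label i :^ g)%G.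
Proof.
have st g i : g \in G -> exists j, e j = 'JG%act (e i) g.
  move=> gG; have : (e i :^ g)%G \in codom e.
    by rewrite label_codom inE pHallJ //; have := label_sylow i; rewrite inE.
  by case/codomP=> j Ej; exists j; apply: esym Ej.
have [|phi ip phiE] := faithful_perm_representation simpleG e_inj st; last by exists phi.
have pT := pHall_pgroup sylT.
have T1 : T :!=: 1 by apply/trivgPn; exists t.
have [g gG ne] := simple_moves simpleG sTG T1 (pgroup_proper simpleG kappaG pT).
by exists g => //; exists (Ordinal (isT : 9 < 10)).
Qed.

Section Codes.
Variable phi : {morphism G >-> {perm 'I_10}}.
Hypothesis phiE : forall g i, g \in G -> label (phi g i) = (label i :^ g)%G.

Lemma label_code g k : g \in G -> k < 10 -> label (nth 0 (code (phi g)) k) = (label k :^ g)%G.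
Proof. by move=> gG k10; rewrite -(phiE (Ordinal k10) gG) (nth_code _ (Ordinal k10)). Qed.

Lemma code_lt g k : k < 10 -> nth 0 (code (phi g)) k < 10.
Proof. by move=> k10; rewrite (nth_code _ (Ordinal k10)) ltn_ord. Qed.

Lemma code_eq g L : g \in G -> size L = 10 -> all (gtn 10) L ->
  (forall k, k < 10 -> label (nth 0 L k) = (label k :^ g)%G) -> code (phi g) = L.
Proof.
move=> gG zL /allP L10 EL; apply: (@eq_from_nth _ 0); rewrite size_code // => k k10.
apply: label_inj; rewrite ?code_lt ?label_code ?EL //.
by apply: L10; rewrite mem_nth ?zL.
Qed.

Let tG := subsetP sTG t tT.
Let uG := subsetP sTG u uT.

Lemma code_t : code (phi t) = table_t.
Proof.
apply: code_eq => // k k10; elim/label_ind: k / k10 => [|i j i3 j3].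
  by apply: val_inj; rewrite /= -[label 9]/T conjGid.
have -> : nth 0 table_t (3 * i + j) = (3 * (i.+1 %% 3) + j)%N.
  by case: i j i3 j3 => [|[|[|]]] // [|[|[|]]].
rewrite !label_pt ?ltn_pmod //; apply: val_inj; rewrite /= -conjsgM.
rewrite -[in LHS](modn_small j3) pt_mod /pt expgSr -!mulgA; congr (_ :^ (_ * _)).
exact: commuteX commute_tu.
Qed.

Lemma code_u : code (phi u) = table_u.
Proof.
apply: code_eq => // k k10; elim/label_ind: k / k10 => [|i j i3 j3].
  by apply: val_inj; rewrite /= -[label 9]/T conjGid.
have -> : nth 0 table_u (3 * i + j) = (3 * i + (j.+1 %% 3))%N.
  by case: i j i3 j3 => [|[|[|]]] // [|[|[|]]].
rewrite !label_pt ?ltn_pmod //; apply: val_inj; rewrite /= -conjsgM.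
by rewrite -[in LHS](modn_small i3) pt_mod /pt expgSr -!mulgA.
Qed.

Lemma code_f : code (phi f) = table_f.
Proof.
have [fT fT'] := f_norm.
apply: code_eq => // k k10; elim/label_ind: k / k10 => [|i j i3 j3].
  by apply: val_inj; rewrite /= -[label 9]/T; apply/esym/normP.
(* Conjugation by [f] sends [t ^+ i * u ^+ j] to [u ^+ i * t^-1 ^+ j], and [t^-1 = t ^+ 2]. *)
have -> : nth 0 table_f (3 * i + j) = (3 * ((2 * j) %% 3) + i)%N.
  by case: i j i3 j3 => [|[|[|]]] // [|[|[|]]].
rewrite !label_pt ?ltn_pmod //; apply: val_inj => /=.
rewrite -[in LHS](modn_small i3) pt_mod -[in RHS]conjsgM (conjgC (pt i j) f) [in RHS]conjsgM (normP fT').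
rewrite /pt; congr (_ :^ _).
rewrite conjMg !conjXg -/u u_conj_f.
have -> : t^-1 = t ^+ 2 by apply/eqP; rewrite eq_invg_mul -expgS -order_t expg_order.
by rewrite -expgM; apply/commuteX2/commute_tu.
Qed.

Lemma nth_mulp a b k : k < size a -> nth 0 (mulp a b) k = nth 0 b (nth 0 a k).
Proof. exact: nth_map. Qed.

Lemma code_pt c : code (phi (pt (c %/ 3) (c %% 3))) = translation c.
Proof. by rewrite morphM ?groupX // codeM !morphX // !codeX code_t code_u. Qed.

Lemma code_stab2 g : g \in G -> stab2_ok (code (phi g)).
Proof.
move=> gG; apply/implyP=> /andP[/eqP g9 /eqP g0].
have gT1 : g \in 'N(T).
  by apply/normP; have /(congr1 val)/= := label_code gG (isT : 9 < 10); rewrite g9 => <-.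
have gT1' : g \in 'N(T').
  apply/normP; have := label_code gG (isT : 0 < 10); rewrite g0 label0.
  by move/(congr1 val) => /= <-.
have : g \in 'N_G(T) :&: 'N(T') by apply/setIP; split=> //; apply/setIP.
rewrite defQ => /cycleP[k ->]; apply/mapP; exists (k %% 4).
  by rewrite mem_iota add0n ltn_pmod.
by rewrite -f_mod morphX // codeX code_f.
Qed.

Section Swap.
Variable w : gT.
Hypotheses (wG : w \in G) (Tw : T :^ w = T') (T'w : T' :^ w = T).

Let wW := code (phi w).

Lemma code_word cs : exists2 g, g \in G & code (phi g) = word_table wW cs.
Proof.
elim: cs => [|c cs [g gG Eg]]; first by exists 1; [apply: group1 | rewrite morph1 code1].
have pG : pt (c %/ 3) (c %% 3) \in G by rewrite (subsetP sTG) ?pt_in.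
exists (w * pt (c %/ 3) (c %% 3) * g); first exact: groupM (groupM wG pG) gG.
by rewrite (morphM phi (groupM wG pG) gG) (morphM phi wG pG) !codeM Eg code_pt.
Qed.

(** A swap of [T] and [T'] normalizes their common stabilizer [<[f]>], so [f ^ w] is again a
    generator. *)
Lemma swap_normalizes : exists2 r, r \in [:: 1%N; 3] & f * w = w * f ^+ r.
Proof.
have [fT fT'] := f_norm.
have : f ^ w \in 'N_G(T) :&: 'N(T').
  apply/setIP; split; last by rewrite -Tw normJ memJ_conjg.
  by apply/setIP; split; [rewrite groupJ | rewrite -T'w normJ memJ_conjg].
rewrite defQ => /cycleP[k Ek]; have := orderJ f w; rewrite Ek -expg_mod_order order_f => oe.
exists (k %% 4); last by rewrite f_mod -Ek conjgC.
have := ltn_pmod k (isT : 0 < 4); move: oe; case: (k %% 4) => [|[|[|[|n]]]] //.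
  by rewrite order1.
by rewrite orderXdiv order_f.
Qed.

Lemma wW9 : nth 0 wW 9 = 0.
Proof.
apply: label_inj; rewrite ?code_lt // label_code // label0.
exact: val_inj.
Qed.

Lemma wW0 : nth 0 wW 0 = 9.
Proof.
apply: label_inj; rewrite ?code_lt // label_code // label0.
exact: val_inj.
Qed.

(** Off 0 and 9, [f] has the cycles 3, 1, 6, 2 and 4, 7, 8, 5, so the relation between [f] and [w]
    determines [w] from its values at 3 and 4. *)
Lemma swap_codeE : exists2 r, r \in [:: 1%N; 3] & wW = swap_table r (nth 0 wW 3) (nth 0 wW 4).
Proof.
have [r rr fw] := swap_normalizes; exists r => //.
have rel k : k < 10 -> nth 0 wW (nth 0 table_f k) = nth 0 (expp 10 table_f r) (nth 0 wW k).
  move=> k10; rewrite -!nth_mulp ?size_code //; congr (nth 0 _ k).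
  by rewrite /wW -code_f -codeX -!codeM -morphX // -!morphM ?groupX // fw.
apply: (@eq_from_nth _ 0); rewrite size_code //.
case=> [|[|[|[|[|[|[|[|[|[|k]]]]]]]]]] // _; rewrite /swap_table /=.
- exact: wW0.
- exact: (rel 3).
- by rewrite -(rel 3) // -(rel 1%N) // -(rel 6).
- by rewrite -(rel 4) // -(rel 7) // -(rel 8).
- by rewrite -(rel 3) // -(rel 1%N).
- exact: (rel 4).
- by rewrite -(rel 4) // -(rel 7).
exact: wW9.
Qed.

Lemma swap_code_w : nth 0 wW 3 \in [:: 3; 4] -> wW = table_w.
Proof.
move=> a34; have [r rr E] := swap_codeE.
have b10 : nth 0 wW 4 \in iota 0 10 by rewrite mem_iota /= code_lt.
have := allP (allP (allP swap_table_check r rr) _ a34) _ b10.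
rewrite -E => /implyP ok; apply/eqP/ok/andP; split; first exact: code_uniq.
by apply/allP=> cs _; have [g gG <-] := code_word cs; apply: code_stab2.
Qed.

(** The generated subgroup contains [T], and with [w] all ten Sylow subgroups; its normalizer of [T]
    has order divisible by 4 and 9. So its order is at least 360. *)
Lemma swap_generates : G :=: <<[set t; u; f; w]>>.
Proof.
have [fT fT'] := f_norm.
pose H := <<[set t; u; f; w]>>%G.
have inH x : x \in [set t; u; f; w] -> x \in H by apply: mem_gen.
have tH : t \in H by apply: inH; rewrite !inE eqxx.
have uH : u \in H by apply: inH; rewrite !inE eqxx ?orbT.
have fH : f \in H by apply: inH; rewrite !inE eqxx ?orbT.
have wH : w \in H by apply: inH; rewrite !inE eqxx ?orbT.
have sHG : H \subset G.
  by rewrite gen_subG; apply/subsetP=> x; rewrite !inE => /orP[/orP[/orP[]|]|] /eqP->.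
have ptH i j : pt i j \in H by rewrite groupM ?groupX.
have labT s : s \in T -> s \in H.
  move=> sT; have sG := subsetP sTG s sT.
  have : (T' :^ s)%G \in codom e by rewrite label_codom inE pHallJ.
  case/codomP=> -[k k10] Ek; move: Ek; rewrite /e /=.
  elim/label_ind: k / k10 => [|i j i3 j3].
    rewrite label9 => /(congr1 val)/= Es; case/eqP: neT; apply: val_inj => /=.
    by apply: (conjsg_inj (x := s)); rewrite Es conjGid.
  rewrite label_pt // => /(sylow3_regular_inj simpleG kappaG n5_neq6 sylT sylT' neT sT (pt_in i j)) ->.
  exact: ptH.
have sTH : T \subset H by apply/subsetP.
have sylTH : 3.-Sylow(H) T := pHall_subl sTH sHG sylT.
have sylS S : S \in 'Syl_3(G) -> S \in 'Syl_3(H).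
  rewrite -label_codom => /codomP[[k k10] ->]; rewrite /e /= inE.
  elim/label_ind: k / k10 => [|i j i3 j3]; first exact: sylTH.
  rewrite label_pt // pHallJ //.
  have <- : (T :^ w)%G = T' by apply: val_inj.
  by rewrite pHallJ.
have n10 : 10 <= #|H : 'N_H(T)|.
  rewrite -(card_Syl sylTH) -(card_Syl3 simpleG kappaG n5_neq6).
  by apply/subset_leq_card/subsetP.
have d36 : 36 %| #|'N_H(T)|.
  rewrite (@Gauss_dvd 4 9) // -{1}order_f -(card_sylow3 simpleG kappaG n5_neq6 sylT).
  rewrite order_dvdG ?cardSg //; first by rewrite subsetI sTH normG.
  by apply/setIP.
apply/eqP; rewrite eq_sym eqEcard sHG (card_G simpleG kappaG n5_neq6 sylT sylT' neT).
rewrite -(Lagrange (subsetIl H 'N(T))) -[360]/(36 * 10)%N leq_mul //.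
exact: dvdn_leq.
Qed.

End Swap.

(** Double transitivity: carry [T] to [T'], then bring the image of [T'] back to [T] by an element
    of [T']. *)
Lemma swap_exists : exists w, [/\ w \in G, T :^ w = T' & T' :^ w = T].
Proof.
have [g gG Eg] := Sylow_trans sylT sylT'.
pose S := (T' :^ g)%G; have sylS : 3.-Sylow(G) S by rewrite pHallJ.
have neS : S != T'.
  apply: contra neT => /eqP/(congr1 val)/= E; apply/eqP/val_inj => /=.
  by apply: (conjsg_inj (x := g)); rewrite E.
have neT' : T != T' by rewrite eq_sym.
have [h hT' /(congr1 val)/= Eh] := sylow3_regular simpleG kappaG n5_neq6 sylT' sylS neS sylT neT'.
have hG := subsetP (pHall_sub sylT') h hT'.
exists (g * h); split; first exact: groupM gG hG.
  by rewrite conjsgM -Eg (conjGid hT').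
by rewrite conjsgM.
Qed.

Lemma table_generators : exists2 w, w \in G &
  code (phi w) = table_w /\ G :=: <<[set t; u; f; w]>>.
Proof.
have [fT fT'] := f_norm; have [w0 [w0G Tw T'w]] := swap_exists.
pose a := nth 0 (code (phi w0)) 3.
have a10 : a < 10 by apply: code_lt.
have neq3 k : k < 10 -> k != 3 -> a != nth 0 (code (phi w0)) k.
  by move=> k10 k3; rewrite eq_sym nth_uniq ?size_code ?code_uniq.
have a9 : a != 9 by have := neq3 0 isT isT; rewrite (wW0 w0G T'w).
have a0 : a != 0 by have := neq3 9 isT isT; rewrite (wW9 w0G Tw).
have [m am] : exists m, nth 0 (expp 10 table_f m) a \in [:: 3; 4].
  have : has (fun m => nth 0 (expp 10 table_f m) a \in [:: 3; 4]) (iota 0 4).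
    by move: a10 a9 a0; clear; move: a => a; do 10![case: a => [|a] //].
  by case/hasP=> m _; exists m.
have wG : w0 * f ^+ m \in G by rewrite groupM ?groupX.
have Tw1 : T :^ (w0 * f ^+ m) = T' by rewrite conjsgM Tw; apply: normP; rewrite groupX.
have T'w1 : T' :^ (w0 * f ^+ m) = T by rewrite conjsgM T'w; apply: normP; rewrite groupX.
exists (w0 * f ^+ m) => //; split; last exact: swap_generates.
apply: (swap_code_w wG Tw1 T'w1).
by rewrite morphM ?groupX // morphX // codeM codeX code_f nth_mulp ?size_code.
Qed.

End Codes.

End Labelling.

Definition table_group : {group {perm 'I_10}} :=
  <<[set s | code s \in [:: table_t; table_u; table_f; table_w]]>>%G.

Lemma isog_table_group (gT : finGroupType) (G : {group gT}) :
  simple G -> kappa G = kappa A6 -> #|'Syl_5(G)| != 6 -> G \isog table_group.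
Proof.
move=> simpleG kappaG n6; have [T sylT] := Sylow_exists 3 G.
have [T' sylT' neT] := @sylow_moves _ G simpleG kappaG 3 T isT (@primes_dvd _ G simpleG kappaG 3 isT) sylT.
have [f [fG of4 defQ]] := stabilizer2_cycle simpleG kappaG n6 sylT sylT' neT.
have T1 : T :!=: 1 by rewrite -cardG_gt1 (card_sylow3 simpleG kappaG n6 sylT).
have [t tT t1] := trivgPn _ T1; have tG := subsetP (pHall_sub sylT) t tT.
have [phi ip phiE] := label_representation simpleG kappaG n6 sylT sylT' neT fG of4 defQ tT t1.
have [w wG [Ew defG]] := table_generators simpleG kappaG n6 sylT sylT' neT fG of4 defQ tT t1 phiE.
have Et := code_t simpleG kappaG n6 sylT sylT' neT fG of4 defQ tT t1 phiE.
have Eu := code_u simpleG kappaG n6 sylT sylT' neT fG of4 defQ tT t1 phiE.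
have Ef := code_f simpleG kappaG n6 sylT sylT' neT fG of4 defQ tT t1 phiE.
set A := [set t; t ^ f; f; w] in defG.
have sAG : A \subset G by have := subset_gen A; rewrite -defG.
suff -> : table_group = (phi @* G)%G by apply: sub_isog.
apply: val_inj; transitivity (phi @* <<A>>); last by rewrite -defG.
rewrite morphim_gen //=; congr <<_>>; apply/setP=> s.
rewrite inE morphimEsub //; apply/idP/imsetP=> [|[x + ->]].
  rewrite !inE => /or4P[] /eqP Es; [exists t | exists (t ^ f) | exists f | exists w];
    by [rewrite !inE eqxx ?orbT | apply: code_inj; rewrite Es].
by rewrite /A !inE => /orP[/orP[/orP[]|]|] /eqP->; rewrite ?Et ?Eu ?Ef ?Ew eqxx ?orbT.
Qed.

Lemma order5_countE : count (fun a => (a != idp) && (expp 6 a 5 == idp)) even_lists = 144.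
Proof. by vm_compute. Qed.

Lemma card_A6_order5 : #|[set x in A6 | #[x] == 5]| = 144.
Proof.
rewrite -order5_countE -(elimT seq.permP perm_even_lists) count_map -sum1_card -sum1_count.
rewrite big_enum_cond; apply: eq_bigl => x.
rewrite inE -[RHS]/((x \in A6) && ((code x != idp) && (expp 6 (code x) 5 == idp))).
rewrite -codeX !code_eq1; apply: andb_id2l => _.
apply/eqP/andP=> [ox|[x1 /eqP x5]].
  by have := expg_order x; rewrite ox => ->; rewrite -order_gt1 ox.
by apply: nt_prime_order.
Qed.

(** Six subgroups of order 5 would contain only 24 of the 144 elements of order 5. *)
Lemma card_Syl5_A6 : #|'Syl_5(A6)| != 6.
Proof.
rewrite (Syl5E simple_A6 (erefl _)); apply/eqP=> n6.
by have := @card_prime_elements _ A6 5 isT; rewrite card_A6_order5 n6.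
Qed.

Theorem theorem1p2 (gT : finGroupType) (G : {group gT}) :
  simple G -> kappa G = kappa A6 -> (G \isog A6)%g.
Proof.
move=> simpleG kappaG; have [n6|n6] := eqVneq #|'Syl_5(G)| 6; first exact: isog_A6_of_6.
apply: isog_trans (isog_table_group simpleG kappaG n6) _.
by rewrite isog_sym; apply: isog_table_group simple_A6 (erefl _) card_Syl5_A6.
Qed.
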